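(* Let $q=2^e$ with $e>1$, and let $n\ge3$. Let $G$ be the group generated by $\{\sigma,\delta,Z,U,V\}$ subject to the following relations. Then $G$ is isomorphic to $\Omega^+(2n,q)$. (i) Defining relations for $S_n$ on $\{U,V\}$, with $U=(1,2)$, $V=(1,2,\dots,n)$; $[Z,U^{V^2}]=1$ if $n>3$; $[Z,VUU^V]=1$ if $n>4$; $Z^2=1$; $[Z,Z^{V^2}]=1$ if $n>3$; $ZZ^V=Z^{U^V}$; $[Z,U]=1$; $[Z,Z^V]=1$; $[\delta,U^V]=1$; $[\delta,VU]=1$ if $n>3$; $[\delta,\delta^U]=1$; $\delta^{q-1}=1$; $\delta^Z=\delta^{-1}$; $[\delta,Z^V]=1$. (ii) Relations stating that $\sigma$ is centralised by: $U^{V^2}$ if $n>3$; $VUU^V$ if $n>4$; $Z^{V^2}$ if $n>3$; $\delta^{V^2}$; $ZU$; $\delta\delta^U$. (iii) Relations that present $\mathrm{SL}(2,q)$ on $\{\sigma,\Delta,U\}$, where $\Delta=[U,\delta]$, but omitting the relation $\Delta^{q-1}=1$; that is, a set of relations which together with $\Delta^{q-1}=1$ presents $\mathrm{SL}(2,q)$ on $\{\sigma,\Delta,U\}$. (iv) (a) $[\sigma,\sigma^V]=\sigma^{VU}$; (b) $[\sigma,\sigma^{VU}]=1$; (c) $[\sigma,\sigma^W]=1$, where $W=U^{VU}$; (d) if $n>3$ then $[\sigma,\sigma^{V^2}]=1$; (e) $[\sigma,\sigma^{Z^V}]=1$; (f) if $n=4$ then $[\sigma,\sigma^{Z^VV^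2}]=1$.
   Context: Conventions: $x^y=y^{-1}xy$, $[x,y]=x^{-1}y^{-1}xy$. Linear maps act on the right and fix unmentioned basis vectors. Generators of the presented group are denoted by the same symbols as the corresponding matrices. ''Relations that present (defining relations for) a group on given elements $g_1,\dots,g_k$'' means any set of relators in the free group on $k$ letters whose normal closure is the kernel of the natural map onto $\langle g_1,\dots,g_k\rangle$. Matrices: $\omega$ is a primitive element of $\mathrm{GF}(q)$, and $e_1,f_1,\dots,e_n,f_n$ a hyperbolic basis of the natural module of $\Omega^+(2n,q)$: the quadratic form vanishes on all $e_i,f_i$ and its polar form has $e_i.f_i=1$ and other products zero; $\Omega^+(2n,q)$ is the index $2$ subgroup (kernel of the Dickson invariant) of the full isometry group. $\sigma=(e_1\mapsto e_1+e_2,\ f_2\mapsto f_2+f_1)$; $\delta=(e_1\mapsto\omega^{-1}e_1,\ f_1\mapsto\omega f_1)$; $Z$ interchanges $e_1,f_1$ and $e_2,f_2$; $U$ interchanges $e_1,e_2$ and $f_1,f_2$; $V=(e_1,\dots,e_n)(f_1,\dots,f_n)$ cyclically permutes the $e_i$ and the $f_i$. In (iii), the matrices $\sigma,\Delta,U$ act on $(e_1,e_2)$ as $\begin{pmatrix}1&1\\0&1\end{pmatrix}$, $\begin{pmatrix}\omega^{-1}&0\\0&\omega\end{pmatrix}$, $\begin{pmatrix}0&1\\1&0\end{pmatrix}$, and generate a copy of $\mathrm{SL}(2,q)$. *)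

(* Defs.v *)
From HB Require Import structures.
From mathcomp Require Import all_boot all_order all_algebra all_fingroup.
From mathcomp Require Import generic_quotient boolp.
Set Implicit Arguments.
Unset Strict Implicit.
Unset Printing Implicit Defensive.
Import GRing.Theory.
Import GroupScope.

(* Free groups are realised on reduced words; the letter (x, false) stands for
   x and (x, true) for its formal inverse. *)
Section FreeGroup.
Variable X : choiceType.
Implicit Types (a b : X * bool) (s t u : seq (X * bool)).

Definition letter_inv a := (a.1, ~~ a.2).

Lemma letter_invK : involutive letter_inv.
Proof. by case=> x b; rewrite /letter_inv negbK. Qed.

Definition reduced s := sorted (fun a b => b != letter_inv a) s.

(* [push a s] freely reduces a :: s when s is reduced. *)
Definition push a s :=
  if s is b :: s' then if b == letter_inv a then s' else a :: s else [:: a].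

Definition free_mul s t := foldr push t s.
Definition free_inv s := rev (map letter_inv s).

Lemma push_reduced a s : reduced s -> reduced (push a s).
Proof.
case: s => [|b s] //= Hs; case: ifPn => [_|ne].
  exact: path_sorted Hs.
by rewrite /reduced /= ne.
Qed.

Lemma pushK a s : reduced s -> push a (push (letter_inv a) s) = s.
Proof.
case: s => [_|b s] /=; first by rewrite eqxx.
rewrite letter_invK; case: (eqVneq b a) => [->|_] Hs /=; last by rewrite eqxx.
by case: s Hs => [|c s] //= /andP[/negPf->].
Qed.

Lemma push_id a s : reduced (a :: s) -> push a s = a :: s.
Proof. by case: s => [|b s] //= /andP[/negPf->]. Qed.

Lemma free_mul_reduced s t : reduced t -> reduced (free_mul s t).
Proof. by move=> Ht; elim: s => //= a s; exact: push_reduced. Qed.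

Lemma free_mul_push a s t :
  reduced t -> free_mul (push a s) t = push a (free_mul s t).
Proof.
move=> Ht; case: s => [|b s] //=; case: eqP => [->|_] //=.
by rewrite pushK // free_mul_reduced.
Qed.

Lemma free_mulA s t u :
  reduced u -> free_mul s (free_mul t u) = free_mul (free_mul s t) u.
Proof. by move=> Hu; elim: s => //= a s ->; rewrite free_mul_push. Qed.

Lemma free_mulr1 s : reduced s -> free_mul s [::] = s.
Proof.
elim: s => // a s IHs Hs; rewrite /= IHs ?push_id //.
exact: path_sorted Hs.
Qed.

Lemma free_inv_reduced s : reduced s -> reduced (free_inv s).
Proof.
rewrite /reduced /free_inv rev_sorted sorted_map; apply: sub_sorted => a b.
by rewrite /= letter_invK eq_sym.
Qed.

Lemma free_mul_cat s1 s2 t : free_mul (s1 ++ s2) t = free_mul s1 (free_mul s2 t).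
Proof. exact: foldr_cat. Qed.

Lemma free_mulVl s t : reduced t -> free_mul (free_inv s) (free_mul s t) = t.
Proof.
move=> Ht; elim: s => // a s IHs.
rewrite /free_inv /= rev_cons -cats1 free_mul_cat /=.
by rewrite -{2}(letter_invK a) pushK ?free_mul_reduced.
Qed.

Record freeGroup := FreeGroup { free_word :> seq (X * bool); _ : reduced free_word }.

HB.instance Definition _ := [isSub for free_word].
HB.instance Definition _ := [Choice of freeGroup by <:].

Implicit Types v w : freeGroup.

Definition fg_one := @FreeGroup [::] isT.
Definition fg_mul v w := FreeGroup (free_mul_reduced v (valP w)).
Definition fg_inv w := FreeGroup (free_inv_reduced (valP w)).

Fact fg_mulA : associative fg_mul.
Proof. by move=> v w z; apply: val_inj; rewrite /= free_mulA // (valP z). Qed.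

Fact fg_mul1 : left_id fg_one fg_mul.
Proof. by move=> w; exact: val_inj. Qed.

Fact fg_mulr1 : right_id fg_one fg_mul.
Proof. by move=> w; apply: val_inj; rewrite /= free_mulr1 // (valP w). Qed.

Fact fg_mulV : left_inverse fg_one fg_inv fg_mul.
Proof.
move=> w; apply: val_inj => /=.
by rewrite -{2}(free_mulr1 (valP w)) free_mulVl.
Qed.

Fact fg_mulrV : right_inverse fg_one fg_inv fg_mul.
Proof.
move=> w; rewrite -[LHS]fg_mul1 -{1}(fg_mulV (fg_inv w)) -fg_mulA.
by rewrite (fg_mulA (fg_inv w)) fg_mulV fg_mul1 fg_mulV.
Qed.

HB.instance Definition _ :=
  isGroup.Build freeGroup fg_mulA fg_mul1 fg_mulr1 fg_mulV fg_mulrV.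

Definition fg_gen (x : X) : freeGroup := @FreeGroup [:: (x, false)] isT.

(* The image of w under the homomorphism freeGroup -> G extending g. *)
Definition fg_eval (G : groupType) (g : X -> G) (w : freeGroup) : G :=
  foldr (fun a y => (if a.2 then (g a.1)^-1 else g a.1) * y) 1 (free_word w).

End FreeGroup.

Section NormalClosure.
Local Open Scope quotient_scope.
Variables (G : groupType) (R : G -> Prop).

Definition normal_subgroup (N : G -> Prop) : Prop :=
  [/\ N 1, forall x y, N x -> N y -> N (x * y),
      forall x, N x -> N x^-1 & forall x y, N x -> N (x ^ y)].

Definition normal_closure (x : G) : Prop :=
  forall N : G -> Prop,
    normal_subgroup N -> (forall r, R r -> N r) -> N x.

Lemma normal_closureP : normal_subgroup normal_closure.
Proof.
split=> [N [] //|x y Hx Hy N HN HR|x Hx N HN HR|x y Hx N HN HR].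
- by case: (HN) => _ + _ _; apply; [apply: Hx|apply: Hy].
- by case: (HN) => _ _ + _; apply; apply: Hx.
- by case: (HN) => _ _ _; apply; apply: Hx.
Qed.

Definition ncl_rel (x y : G) : bool := `[< normal_closure (x^-1 * y) >].

Lemma ncl_rel_refl : reflexive ncl_rel.
Proof. by move=> x; apply/asboolP; rewrite mulVg; case: normal_closureP. Qed.

Lemma ncl_rel_sym : symmetric ncl_rel.
Proof.
have [_ _ HV _] := normal_closureP.
by move=> x y; apply/asboolP/asboolP => /HV; rewrite invgM invgK.
Qed.

Lemma ncl_rel_trans : transitive ncl_rel.
Proof.
have [_ HM _ _] := normal_closureP.
move=> y x z /asboolP Hxy /asboolP Hyz; apply/asboolP.
by have := HM _ _ Hxy Hyz; rewrite -mulgA mulVKg.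
Qed.

Canonical ncl_equiv := EquivRel ncl_rel ncl_rel_refl ncl_rel_sym ncl_rel_trans.

Definition ncl_quot := {eq_quot ncl_equiv}.
HB.instance Definition _ := Choice.on ncl_quot.
HB.instance Definition _ := EqQuotient.on ncl_quot.

Lemma ncl_relM x x' y y' :
  ncl_rel x x' -> ncl_rel y y' -> ncl_rel (x * y) (x' * y').
Proof.
have [_ HM _ HJ] := normal_closureP.
move=> /asboolP Hx /asboolP Hy; apply/asboolP.
have := HM _ _ (HJ _ y Hx) Hy.
by rewrite conjgE invgM !mulgA mulgK.
Qed.

Lemma ncl_relV x x' : ncl_rel x x' -> ncl_rel x^-1 x'^-1.
Proof.
have [_ _ HV HJ] := normal_closureP.
move=> /asboolP Hx; apply/asboolP.
have := HV _ (HJ _ x^-1 Hx).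
by rewrite conjgE -!mulgA mulKg invgM invgK.
Qed.

Definition nq_one : ncl_quot := \pi_ncl_quot 1.
Definition nq_mul (a b : ncl_quot) : ncl_quot := \pi_ncl_quot (repr a * repr b).
Definition nq_inv (a : ncl_quot) : ncl_quot := \pi_ncl_quot ((repr a)^-1).

Lemma ncl_rel_repr x : ncl_rel (repr (\pi_ncl_quot x)) x.
Proof. by rewrite -[ncl_rel _ _]/(ncl_equiv _ _) -eqmodE reprK. Qed.

Lemma nq_ind (P : ncl_quot -> Prop) :
  (forall x, P (\pi_ncl_quot x)) -> forall a, P a.
Proof. by move=> HP a; rewrite -[a]reprK. Qed.

Lemma nq_mulE x y : nq_mul (\pi_ncl_quot x) (\pi_ncl_quot y) = \pi_ncl_quot (x * y).
Proof. by apply/eqP; rewrite eqmodE; apply: ncl_relM; exact: ncl_rel_repr. Qed.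

Lemma nq_invE x : nq_inv (\pi_ncl_quot x) = \pi_ncl_quot (x^-1).
Proof. by apply/eqP; rewrite eqmodE; apply: ncl_relV; exact: ncl_rel_repr. Qed.

Fact nq_mulA : associative nq_mul.
Proof.
elim/nq_ind=> x; elim/nq_ind=> y; elim/nq_ind=> z.
by rewrite (nq_mulE y z) (nq_mulE x (y * z)) (nq_mulE x y) (nq_mulE (x * y) z) mulgA.
Qed.

Fact nq_mul1 : left_id nq_one nq_mul.
Proof. by elim/nq_ind=> x; rewrite nq_mulE mul1g. Qed.

Fact nq_mulr1 : right_id nq_one nq_mul.
Proof. by elim/nq_ind=> x; rewrite nq_mulE mulg1. Qed.

Fact nq_mulV : left_inverse nq_one nq_inv nq_mul.
Proof. by elim/nq_ind=> x; rewrite nq_invE nq_mulE mulVg. Qed.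

Fact nq_mulrV : right_inverse nq_one nq_inv nq_mul.
Proof. by elim/nq_ind=> x; rewrite nq_invE nq_mulE mulgV. Qed.

HB.instance Definition _ :=
  isGroup.Build ncl_quot nq_mulA nq_mul1 nq_mulr1 nq_mulV nq_mulrV.

End NormalClosure.

Definition presentedGroup (X : choiceType) (R : freeGroup X -> Prop) : groupType :=
  ncl_quot R.

Definition presents_on (X : choiceType) (R : freeGroup X -> Prop)
    (G : groupType) (g : X -> G) : Prop :=
  forall w, normal_closure R w <-> fg_eval g w = 1.

Inductive Sn_letter := Sn_U | Sn_V.

Definition Sn_code l := if l is Sn_U then true else false.
Definition Sn_decode b := if b then Sn_U else Sn_V.
Fact Sn_codeK : cancel Sn_code Sn_decode. Proof. by case. Qed.
HB.instance Definition _ := Choice.copy Sn_letter (can_type Sn_codeK).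

(* Permutations of 'I_n are 0-based: U = (1,2), V = (1,2,...,n).  Products of
   {perm _} compose from left to right. *)
Definition Sn_gen (n : nat) (n_gt2 : 2 < n) (l : Sn_letter) : {perm 'I_n} :=
  match l with
  | Sn_U => tperm (Ordinal (ltnW (ltnW n_gt2))) (Ordinal (ltnW n_gt2))
  | Sn_V => perm (@ordS_inj n)
  end.

Inductive SL2_letter := SL2_sigma | SL2_Delta | SL2_U.

Definition SL2_code l : 'I_3 :=
  match l with SL2_sigma => inord 0 | SL2_Delta => inord 1 | SL2_U => inord 2 end.
Definition SL2_decode (i : 'I_3) :=
  match val i with 0 => SL2_sigma | 1 => SL2_Delta | _ => SL2_U end.
Fact SL2_codeK : cancel SL2_code SL2_decode.
Proof. by case; rewrite /SL2_decode /SL2_code /= inordK. Qed.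
HB.instance Definition _ := Choice.copy SL2_letter (can_type SL2_codeK).

Section SL2.
Local Open Scope ring_scope.
Variables (F : finFieldType) (omega : {unit F}).

Definition mx2 (a b c d : F) : 'M[F]_2 :=
  \matrix_(i, j) if i == 0 then if j == 0 then a else b
                 else if j == 0 then c else d.

Definition SL2_mx (l : SL2_letter) : 'M[F]_2 :=
  match l with
  | SL2_sigma => mx2 1 1
                     0 1
  | SL2_Delta => mx2 (val omega)^-1 0
                     0              (val omega)
  | SL2_U     => mx2 0 1
                     1 0
  end.

Fact SL2_mx_unit l : SL2_mx l \is a GRing.unit.
Proof.
rewrite -[_ \is a _]/(_ \in unitmx) unitmxE.
rewrite (expand_det_row _ 0) !big_ord_recl big_ord0 addr0 /cofactor !det_mx11.
have w_unit := valP omega.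
case: l; rewrite !mxE /= !(mulr0, mul0r, mul1r, mulr1, addr0, add0r).
- exact: unitr1.
- by rewrite ?expr0 ?mul1r mulVr ?unitr1.
- by rewrite unitrX ?unitrN1.
Qed.

Definition SL2_gen (l : SL2_letter) : {'GL_2[F]} := FinRing.unit _ (SL2_mx_unit l).

End SL2.

Section OmegaPlus.
Local Open Scope ring_scope.
Variables (n : nat) (F : finFieldType).

(* Row vectors of length n + n hold the coordinates with respect to
   e_1, ..., e_n, f_1, ..., f_n; matrices act on the right. *)
Definition Qplus (v : 'rV[F]_(n + n)) : F :=
  \sum_(i < n) v 0 (lshift n i) * v 0 (rshift n i).

Definition Oplus : {set 'M[F]_(n + n)} :=
  [set A in unitmx | [forall v : 'rV[F]_(n + n), Qplus (v *m A) == Qplus v]].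

(* In characteristic 2, the Dickson invariant of an isometry A is the parity of
   the rank of A - 1. *)
Definition dickson (A : 'M[F]_(n + n)) : bool := odd (\rank (A - 1%:M)).

Definition Omegaplus : {set 'M[F]_(n + n)} := [set A in Oplus | ~~ dickson A].

End OmegaPlus.

Definition isog_mxgroup (G : groupType) (F : finFieldType) (m : nat)
    (H : {set 'M[F]_m}) : Prop :=
  exists f : G -> 'M[F]_m,
    [/\ forall x y, f (x * y) = (f x *m f y)%R,
        injective f & forall A, A \in H <-> exists x, f x = A].

Inductive Om_letter := Om_sigma | Om_delta | Om_Z | Om_U | Om_V.

Definition Om_code l : 'I_5 :=
  match l with
  | Om_sigma => inord 0 | Om_delta => inord 1 | Om_Z => inord 2
  | Om_U => inord 3 | Om_V => inord 4
  end.
Definition Om_decode (i : 'I_5) :=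
  match val i with
  | 0 => Om_sigma | 1 => Om_delta | 2 => Om_Z | 3 => Om_U | _ => Om_V
  end.
Fact Om_codeK : cancel Om_code Om_decode.
Proof. by case; rewrite /Om_decode /Om_code /= inordK. Qed.
HB.instance Definition _ := Choice.copy Om_letter (can_type Om_codeK).

Section Relations.
Variables (n q : nat).
Variables (R_Sn : freeGroup Sn_letter -> Prop).
Variables (R_SL2 : freeGroup SL2_letter -> Prop).

Let sigma := fg_gen Om_sigma.
Let delta := fg_gen Om_delta.
Let Z := fg_gen Om_Z.
Let U := fg_gen Om_U.
Let V := fg_gen Om_V.
Let Delta := [~ U, delta].
Let W := U ^ (V * U).

Let Sn_subst (l : Sn_letter) := match l with Sn_U => U | Sn_V => V end.
Let SL2_subst (l : SL2_letter) :=
  match l with SL2_sigma => sigma | SL2_Delta => Delta | SL2_U => U end.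

(* A relation x = y is encoded as the relator x * y^-1, and "sigma is
   centralised by y" as [~ sigma, y]. *)
Inductive relators : freeGroup Om_letter -> Prop :=
| rel_Sn r of R_Sn r                 : relators (fg_eval Sn_subst r)
| rel_Z_UVV of 3 < n                 : relators [~ Z, U ^ (V ^+ 2)]
| rel_Z_VUUV of 4 < n                : relators [~ Z, V * U * U ^ V]
| rel_ZZ                             : relators (Z ^+ 2)
| rel_Z_ZVV of 3 < n                 : relators [~ Z, Z ^ (V ^+ 2)]
| rel_ZZV                            : relators (Z * Z ^ V * (Z ^ (U ^ V))^-1)
| rel_Z_U                            : relators [~ Z, U]
| rel_Z_ZV                           : relators [~ Z, Z ^ V]
| rel_delta_UV                       : relators [~ delta, U ^ V]
| rel_delta_VU of 3 < n              : relators [~ delta, V * U]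
| rel_delta_deltaU                   : relators [~ delta, delta ^ U]
| rel_delta_order                    : relators (delta ^+ (q - 1))
| rel_deltaZ                         : relators (delta ^ Z * (delta^-1)^-1)
| rel_delta_ZV                       : relators [~ delta, Z ^ V]
| rel_sigma_UVV of 3 < n             : relators [~ sigma, U ^ (V ^+ 2)]
| rel_sigma_VUUV of 4 < n            : relators [~ sigma, V * U * U ^ V]
| rel_sigma_ZVV of 3 < n             : relators [~ sigma, Z ^ (V ^+ 2)]
| rel_sigma_deltaVV                  : relators [~ sigma, delta ^ (V ^+ 2)]
| rel_sigma_ZU                       : relators [~ sigma, Z * U]
| rel_sigma_deltadeltaU              : relators [~ sigma, delta * delta ^ U]
| rel_SL2 r of R_SL2 r               : relators (fg_eval SL2_subst r)
| rel_sigma_sigmaV     : relators ([~ sigma, sigma ^ V] * (sigma ^ (V * U))^-1)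
| rel_sigma_sigmaVU                  : relators [~ sigma, sigma ^ (V * U)]
| rel_sigma_sigmaW                   : relators [~ sigma, sigma ^ W]
| rel_sigma_sigmaVV of 3 < n         : relators [~ sigma, sigma ^ (V ^+ 2)]
| rel_sigma_sigmaZV                  : relators [~ sigma, sigma ^ (Z ^ V)]
| rel_sigma_sigmaZVVV of n = 4       : relators [~ sigma, sigma ^ (Z ^ V * V ^+ 2)].

End Relations.

(* Main.v *)
From HB Require Import structures.
Require Import Defs.
From mathcomp Require Import all_boot all_order all_algebra all_fingroup.
From mathcomp Require Import all_solvable all_field boolp generic_quotient zify ring.
Set Implicit Arguments.
Unset Strict Implicit.
Unset Printing Implicit Defensive.
Import Order.TTheory GRing.Theory Num.Theory.
Import GroupScope.

(** The given matrices satisfy the relations, so the presented group G maps to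
    the isometry group by a homomorphism pi; the theorem says that pi is
    injective and that its image is the kernel of the Dickson invariant.

    _Injectivity._  The proof recovers the Steinberg relations inside G.  The
    relations among U, V, Z and delta give a subgroup N of G whose elements have
    a normal form: a product of conjugates of delta, an even product of sign
    changes and a permutation.  Matrices separate these normal forms
    ([NG_inj]).  The elements of N that centralise the matrix sigma also
    centralise the element sigma of G ([sigma_cent]).  Hence a root element of
    the orthogonal group has exactly one lift to G that is conjugate to sigma
    under N ([lift_uniq]), and N permutes these lifts as the matrices do.  The
    relations of SL(2,q) give their addition law and express X_r(t) w_r
    through the opposite root -r ([XGD], [weyl_base]).

    The commutator relations of sigma with some of its conjugates spread under
    N.  The group N contains only the even sign changes, so two roots that
    involve three indices can be moved to a standard position only if a parity
    is right; if it is wrong, the other description X(-b,-a) of X(a,b) is used,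
    since it changes the parity.  Two roots on four indices are moved with the
    help of a fifth index; when there is no fifth index there are two orbits,
    and the last relation treats the second ([disjoint_roots]).

    With the Steinberg relations at hand the classical argument applies.  Let P
    be generated by the lifts of the positive roots.  The set P N P is closed
    under right multiplication by the generators ([absorbs_simple]), so it is
    all of G.  If u m v in P N P maps to 1, then m maps to a unitriangular
    monomial matrix and is trivial; and P is mapped injectively, because root
    elements can be split off in the order of increasing height
    ([Uroots_step]).

    _Image._  Elimination writes an isometry as a product of root elements,
    permutations, diagonal matrices, even sign changes and at most one sign
    change of a single hyperbolic pair.  A reflection changes the parity of the
    rank of g - 1 ([dickson_refl]).  The sign change of one pair is a
    reflection, and all the other factors are products of an even number of
    reflections, so the single sign change does not occur exactly when the
    Dickson invariant vanishes ([dickson_kernel_sub]). *)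

(** * Words and presentations *)

Section Words.
Variables (X : choiceType) (G : groupType) (g : X -> G).

Let letter (a : X * bool) : G := if a.2 then (g a.1)^-1 else g a.1.
Let evals (s : seq (X * bool)) : G := foldr (fun a y => letter a * y) 1 s.

Lemma evals_push a s : evals (push a s) = letter a * evals s.
Proof.
case: s => [|b s] //=; case: eqP => [->|_] //=.
by case: a => x [] /=; rewrite /letter /= ?mulKg ?mulVKg.
Qed.

Lemma evals_mul s t : evals (free_mul s t) = evals s * evals t.
Proof.
elim: s => [|a s IHs] /=; first by rewrite mul1g.
by rewrite evals_push IHs mulgA.
Qed.

Lemma fg_evalM v w : fg_eval g (v * w) = fg_eval g v * fg_eval g w.
Proof. exact: evals_mul. Qed.

Lemma fg_eval1 : fg_eval g 1 = 1.
Proof. by []. Qed.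

Lemma fg_evalV w : fg_eval g w^-1 = (fg_eval g w)^-1.
Proof.
by apply/(mulgI (fg_eval g w)); rewrite -fg_evalM !mulgV fg_eval1.
Qed.

Lemma fg_evalX w m : fg_eval g (w ^+ m) = fg_eval g w ^+ m.
Proof. by elim: m => [|m IHm]; rewrite ?expg0 // !expgS fg_evalM IHm. Qed.

Lemma fg_evalJ v w : fg_eval g (v ^ w) = fg_eval g v ^ fg_eval g w.
Proof. by rewrite !conjgE !fg_evalM fg_evalV. Qed.

Lemma fg_evalR v w : fg_eval g [~ v, w] = [~ fg_eval g v, fg_eval g w].
Proof. by rewrite !commgEl fg_evalM fg_evalV fg_evalJ. Qed.

Lemma fg_eval_gen x : fg_eval g (fg_gen x) = g x.
Proof. exact: mulg1. Qed.

Definition fg_evalE :=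
  (fg_evalR, fg_evalJ, fg_evalX, fg_evalV, fg_evalM, fg_eval_gen, fg_eval1).

Lemma fg_eval_ind (P : G -> Prop) :
    P 1 -> (forall x y, P y -> P (g x * y)) ->
    (forall x y, P y -> P ((g x)^-1 * y)) ->
  forall w, P (fg_eval g w).
Proof.
move=> P1 PM PV [s Hs]; rewrite /fg_eval /= {Hs}.
by elim: s => [|[x []] s IHs] //=; [apply: PV | apply: PM].
Qed.

End Words.

Lemma fg_eval_morph (X : choiceType) (G H : groupType) (f : G -> H)
    (g : X -> G) (h : X -> H) :
    (forall x y, f (x * y) = f x * f y) -> (forall x, f (g x) = h x) ->
  forall w, f (fg_eval g w) = fg_eval h w.
Proof.
move=> fM fg.
have f1 : f 1 = 1 by apply/(mulgI (f 1)); rewrite -fM !mulg1.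
have fV x : f x^-1 = (f x)^-1 by apply/(mulgI (f x)); rewrite -fM !mulgV.
case=> s Hs; rewrite /fg_eval /= {Hs}.
by elim: s => [|[x []] s IHs] //=; rewrite fM IHs ?fV fg.
Qed.

Lemma fg_eval_self (X : choiceType) (w : freeGroup X) :
  fg_eval (@fg_gen X) w = w.
Proof.
apply: val_inj; case: w => s Hs /=; rewrite /fg_eval /=.
elim: s Hs => [|[x b] s IHs] Hs //=.
rewrite IHs; last exact: path_sorted Hs.
by case: b Hs => Hs /=; exact: push_id.
Qed.

Section Presented.
Local Open Scope quotient_scope.
Variables (X : choiceType) (R : freeGroup X -> Prop).
Let G := presentedGroup R.

Definition pres_gen (x : X) : G := \pi_(ncl_quot R) (fg_gen x).

Lemma pres_evalE (w : freeGroup X) :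
  fg_eval pres_gen w = \pi_(ncl_quot R) w :> G.
Proof.
rewrite -[in RHS](fg_eval_self w); symmetry.
pose f (u : freeGroup X) : G := \pi_(ncl_quot R) u.
apply: (@fg_eval_morph X _ G f) => // x y.
exact/esym/nq_mulE.
Qed.

Lemma pres_rel w : R w -> fg_eval pres_gen w = 1.
Proof.
move=> Rw; rewrite pres_evalE.
apply/eqP; rewrite eqmodE; apply/asboolP => N [_ _ NV _] NR.
by rewrite mulg1; apply: NV; exact: NR.
Qed.

Lemma pres_wordP (x : G) : exists w, x = fg_eval pres_gen w.
Proof. by elim/nq_ind: x => w; exists w; rewrite pres_evalE. Qed.

Lemma pres_ind (P : G -> Prop) :
    P 1 -> (forall x y, P y -> P (pres_gen x * y)) ->
    (forall x y, P y -> P ((pres_gen x)^-1 * y)) ->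
  forall x, P x.
Proof. by move=> P1 PM PV x; have [w ->] := pres_wordP x; apply: fg_eval_ind. Qed.

Variables (H : groupType) (h : X -> H).
Hypothesis h_rel : forall w, R w -> fg_eval h w = 1.

Lemma normal_closure_eval w : normal_closure R w -> fg_eval h w = 1.
Proof.
move=> /(_ (fun w => fg_eval h w = 1)); apply=> //.
split=> [//|x y hx hy|x hx|x y hx].
- by rewrite fg_evalM hx hy mulg1.
- by rewrite fg_evalV hx invg1.
- by rewrite fg_evalJ hx conj1g.
Qed.

Definition pres_lift (x : G) : H := fg_eval h (repr x).

Lemma pres_liftE w : pres_lift (\pi_(ncl_quot R) w) = fg_eval h w.
Proof.
have /asboolP/normal_closure_eval := ncl_rel_repr R w.
by rewrite fg_evalM fg_evalV => /mulg1_eq; rewrite invgK.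
Qed.

Lemma pres_liftM x y : pres_lift (x * y) = pres_lift x * pres_lift y.
Proof.
elim/nq_ind: x => x; elim/nq_ind: y => y.
have -> : (\pi_(ncl_quot R) x : G) * (\pi_(ncl_quot R) y : G)
   = \pi_(ncl_quot R) (x * y) by exact: nq_mulE.
by rewrite !pres_liftE fg_evalM.
Qed.

Lemma pres_lift_gen x : pres_lift (pres_gen x) = h x.
Proof. by rewrite pres_liftE fg_eval_gen. Qed.

End Presented.

(** * Generating pointwise stabilisers in the symmetric group *)

Section PermGeneration.
Variables (n k : nat) (P : {perm 'I_n} -> Prop).
Hypothesis P1 : P 1.
Hypothesis PM : forall s t, P s -> P t -> P (s * t).

Lemma perm_stab_ind :
    (forall i j : 'I_n, k <= i -> j = i.+1 :> nat -> P (tperm i j)) ->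
  forall s : {perm 'I_n}, (forall i : 'I_n, i < k -> s i = i) -> P s.
Proof.
move=> Padj.
have Ptperm (d : nat) (i j : 'I_n) : k <= i -> j = i.+1 + d :> nat ->
    P (tperm i j).
  elim: d j => [|d IHd] j ki ej; first by apply: Padj; rewrite ?ej ?addn0.
  have jn : i.+1 + d < n by move: (ltn_ord j); lia.
  pose j' := Ordinal jn.
  have -> : tperm i j = tperm j' j * tperm i j' * tperm j' j.
    rewrite -{1}(tpermV j' j) -mulgA -conjgE tpermJ tpermL.
    by rewrite tpermD // -val_eqE /=; lia.
  have PJ : P (tperm j' j) by apply: Padj => /=; lia.
  by apply: PM => //; apply: PM => //; apply: IHd.
suff main m : forall k', n - k' <= m -> k <= k' ->
    forall s : {perm 'I_n}, (forall i : 'I_n, i < k' -> s i = i) -> P s.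
  by move=> s; apply: (main (n - k)).
elim: m => [|m IHm] k' nk kk' s sfix.
  suff -> : s = 1 by [].
  by apply/permP=> i; rewrite perm1 sfix //; move: (ltn_ord i); lia.
case: (ltnP k' n) => [ltk|gek]; last first.
  by apply: (IHm k') => //; lia.
pose a := Ordinal ltk.
have sage : k' <= s a.
  rewrite leqNgt; apply/negP => /[dup] /sfix /perm_inj /(congr1 val) /= ->.
  by rewrite ltnn.
have -> : s = s * tperm a (s a) * tperm a (s a).
  by rewrite -mulgA tperm2 mulg1.
apply: PM; last first.
  have [->|ne] := eqVneq (s a) a; first by rewrite tperm1.
  apply: (Ptperm (s a - k'.+1)) => //=.
  have : k' != s a by rewrite eq_sym.
  lia.
apply: (IHm k'.+1); [by lia | by lia | move=> i].
rewrite ltnS leq_eqVlt permM => /orP[/eqP ei|lti].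
  by have -> : i = a; [apply: val_inj | rewrite tpermR].
by rewrite (sfix i) // tpermD // -val_eqE /=; lia.
Qed.

Hypothesis PV : forall s, P s -> P s^-1.

(** The pointwise stabiliser of the first k points is generated by its first
    transposition and one cycle c of the remaining points, because c
    conjugates each adjacent transposition to the next one. The hypothesis on
    c is only asked for when there are more than two remaining points: the
    relations for G are stated only in this case. *)
Lemma perm_stab_cycle_ind (c : {perm 'I_n}) :
    (forall i j : 'I_n, i = k :> nat -> j = k.+1 :> nat -> P (tperm i j)) ->
    (k.+2 < n -> P c) ->
    (forall i j : 'I_n, k <= i -> j = i.+1 :> nat -> c i = j) ->
  forall s : {perm 'I_n}, (forall i : 'I_n, i < k -> s i = i) -> P s.
Proof.
move=> Pk Pc cE; apply: perm_stab_ind => i j ki ej.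
have [d ed] : exists d, i = k + d :> nat by exists (i - k); lia.
elim: d i j ki ej ed => [|d IHd] i j ki ej ed.
  by apply: Pk; lia.
have i'n : k + d < n by move: (ltn_ord i); lia.
pose i' := Ordinal i'n.
have -> : tperm i j = tperm i' i ^ c.
  by rewrite tpermJ (cE i' i) ?(cE i j) //=; lia.
have {}Pc : P c by apply: Pc; move: (ltn_ord j); lia.
rewrite conjgE; apply: PM; first exact: PV.
by apply: PM => //; apply: IHd => /=; lia.
Qed.

End PermGeneration.

(** * Isometries of the split quadratic form *)

(** Signed indices label the hyperbolic basis: (i, false) stands for e_i and
    (i, true) for f_i, so that [neg] exchanges the members of a hyperbolic
    pair. *)
Notation sidx n := ('I_n * bool)%type.

Section SignedIndices.
Variable n : nat.
Implicit Types a b : sidx n.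

Definition neg a : sidx n := (a.1, ~~ a.2).

Lemma negK : involutive neg.
Proof. by case=> i b; rewrite /neg negbK. Qed.

Lemma neg_inj : injective neg. Proof. exact: inv_inj negK. Qed.

Lemma eq_neg a b : (neg a == neg b) = (a == b).
Proof. exact: inj_eq neg_inj _ _. Qed.

Lemma eq_negl a b : (neg a == b) = (a == neg b).
Proof. by rewrite -{1}(negK b) eq_neg. Qed.

Lemma neg_neq a : (neg a == a) = false.
Proof. by case: a => i [] /=; apply/eqP; case. Qed.

Lemma neq_neg a : (a == neg a) = false.
Proof. by rewrite eq_sym neg_neq. Qed.

Lemma eq_fst a b : (a.1 == b.1) = (a == b) || (a == neg b).
Proof.
by case: a b => i x [j y]; rewrite /neg !xpair_eqE /=; case: eqP => //; case: x y => [] [].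
Qed.

Definition ix a : 'I_(n + n) := if a.2 then rshift n a.1 else lshift n a.1.
Definition ixinv (i : 'I_(n + n)) : sidx n :=
  match split i with inl j => (j, false) | inr j => (j, true) end.

Lemma ixK : cancel ix ixinv.
Proof.
case=> i []; rewrite /ix /ixinv /=.
  by rewrite (unsplitK (inr _ i)).
by rewrite (unsplitK (inl _ i)).
Qed.

Lemma ixinvK : cancel ixinv ix.
Proof.
by move=> i; rewrite /ixinv; case: splitP => j e; apply: val_inj; rewrite /= e.
Qed.

Lemma ix_inj : injective ix. Proof. exact: can_inj ixK. Qed.

End SignedIndices.

Section Isometries.
Local Open Scope ring_scope.
Variables (n : nat) (F : finFieldType).
Notation vec := 'rV[F]_(n + n).
Implicit Types (a b : sidx n) (u v x y : vec) (t : F).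

Definition bv a : vec := delta_mx 0 (ix a).
Definition co v a : F := v 0 (ix a).

Lemma coD u v a : co (u + v) a = co u a + co v a.
Proof. by rewrite /co mxE. Qed.
Lemma coZ t v a : co (t *: v) a = t * co v a.
Proof. by rewrite /co mxE. Qed.
Lemma co0 a : co 0 a = 0.
Proof. by rewrite /co mxE. Qed.
Lemma co_bv a b : co (bv a) b = (a == b)%:R.
Proof. by rewrite /co mxE eqxx /= (inj_eq (@ix_inj n)) eq_sym. Qed.
Lemma co_sum I r (P : pred I) (f : I -> vec) a :
  co (\sum_(i <- r | P i) f i) a = \sum_(i <- r | P i) co (f i) a.
Proof. by rewrite /co summxE. Qed.

Definition coE := (coD, coZ, co0, co_bv).

Lemma vecP u v : (forall a, co u a = co v a) <-> u = v.
Proof.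
split=> [uv|-> //]; apply/rowP => i.
by rewrite -(ixinvK i); exact: uv.
Qed.

Lemma sum_co (g : sidx n -> F) a : \sum_c g c * (c == a)%:R = g a.
Proof.
rewrite (bigD1 a) //= eqxx mulr1 big1 ?addr0 // => c /negPf->.
by rewrite mulr0.
Qed.

Lemma vec_expand v : v = \sum_a co v a *: bv a.
Proof.
apply/vecP => a; rewrite co_sum.
by under eq_bigr do rewrite coZ co_bv; rewrite sum_co.
Qed.

(** The polar form in coordinates: [neg] pairs e_i with f_i. *)
Definition bil x y : F := \sum_a co x a * co y (neg a).

Lemma bilDl x y z : bil (x + y) z = bil x z + bil y z.
Proof. by rewrite -big_split; apply: eq_bigr => a _; rewrite coD mulrDl. Qed.
Lemma bilDr x y z : bil x (y + z) = bil x y + bil x z.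
Proof. by rewrite -big_split; apply: eq_bigr => a _; rewrite coD mulrDr. Qed.
Lemma bilZl t x y : bil (t *: x) y = t * bil x y.
Proof. by rewrite /bil mulr_sumr; apply: eq_bigr => a _; rewrite coZ mulrA. Qed.
Lemma bilZr t x y : bil x (t *: y) = t * bil x y.
Proof. by rewrite /bil mulr_sumr; apply: eq_bigr => a _; rewrite coZ mulrCA. Qed.
Lemma bil0l x : bil 0 x = 0.
Proof. by rewrite -(scale0r 0) bilZl mul0r. Qed.
Lemma bil0r x : bil x 0 = 0.
Proof. by rewrite -(scale0r 0) bilZr mul0r. Qed.
Lemma bilC x y : bil x y = bil y x.
Proof.
rewrite /bil (reindex_inj (@neg_inj n)).
by apply: eq_bigr => a _; rewrite negK mulrC.
Qed.
Lemma bil_bvr x a : bil x (bv a) = co x (neg a).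
Proof.
rewrite /bil; under eq_bigr do rewrite co_bv -eq_negl eq_sym.
exact: sum_co.
Qed.
Lemma bil_bv a b : bil (bv a) (bv b) = (a == neg b)%:R.
Proof. by rewrite bil_bvr co_bv. Qed.
Definition bilE := (bilDl, bilDr, bilZl, bilZr, bil_bv, bil0l, bil0r).
Lemma bil_suml I r (P : pred I) (f : I -> vec) y :
  bil (\sum_(i <- r | P i) f i) y = \sum_(i <- r | P i) bil (f i) y.
Proof.
by apply: (big_morph (bil^~ y)) => [? ?|]; rewrite ?bilDl ?bil0l.
Qed.

Lemma QplusE v : Qplus v = \sum_(i < n) co v (i, false) * co v (i, true).
Proof. by []. Qed.
Lemma QplusD x y : Qplus (x + y) = Qplus x + Qplus y + bil x y.
Proof.
rewrite !QplusE /bil.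
rewrite -(pair_bigA _ (fun i z => co x (i, z) * co y (neg (i, z)))) /=.
rewrite -!big_split; apply: eq_bigr => i _ /=.
by rewrite big_bool !coD /neg /=; ring.
Qed.
Lemma QplusZ t x : Qplus (t *: x) = t ^+ 2 * Qplus x.
Proof. by rewrite !QplusE mulr_sumr; apply: eq_bigr => i _; rewrite !coZ; ring. Qed.
Lemma Qplus0 : Qplus (0 : vec) = 0.
Proof. by rewrite -(scale0r 0) QplusZ expr2 !mul0r. Qed.
Lemma Qplus_bv a : Qplus (bv a) = 0.
Proof.
rewrite QplusE big1 // => i _; rewrite !co_bv.
by case: a => j [] /=; rewrite !xpair_eqE andbF ?mulr0 ?mul0r.
Qed.

Lemma bil_nondeg x : (forall y, bil x y = 0) -> x = 0.
Proof. by move=> x0; apply/vecP => a; rewrite co0 -[a]negK -bil_bvr x0. Qed.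

(** Preserving the form already forces invertibility, since the polar form is
    nondegenerate. *)
Lemma Oplus_presQ (A : 'M[F]_(n + n)) :
  (forall v, Qplus (v *m A) = Qplus v) -> A \in Oplus n F.
Proof.
move=> QA; rewrite inE; apply/andP; split; last by apply/forallP => v; rewrite QA.
have BA x y : bil (x *m A) (y *m A) = bil x y.
  have := QA (x + y); rewrite mulmxDl !QplusD !QA.
  exact: addrI.
rewrite -row_free_unit -kermx_eq0; apply/rowV0P => v /sub_kermxP vA.
by apply: bil_nondeg => y; rewrite -BA vA bil0l.
Qed.

Record ogroup := OGroup { omx :> 'M[F]_(n + n); _ : omx \in Oplus n F }.
HB.instance Definition _ := [isSub for omx].
HB.instance Definition _ := [Choice of ogroup by <:].
Implicit Types g h : ogroup.

Lemma og_unit g : omx g \in unitmx.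
Proof. by have := valP g; rewrite inE => /andP[]. Qed.

Lemma og_Q g v : Qplus (v *m g) = Qplus v.
Proof. by have := valP g; rewrite inE => /andP[_ /forallP/(_ v)/eqP]. Qed.

Lemma og_bil g x y : bil (x *m g) (y *m g) = bil x y.
Proof. have := og_Q g (x + y); rewrite mulmxDl !QplusD !og_Q; exact: addrI. Qed.

Fact og_one_subproof : (1%:M : 'M[F]_(n + n)) \in Oplus n F.
Proof. by apply: Oplus_presQ => v; rewrite mulmx1. Qed.
Fact og_mul_subproof g h : (g *m h) \in Oplus n F.
Proof. by apply: Oplus_presQ => v; rewrite mulmxA !og_Q. Qed.
Fact og_inv_subproof g : invmx g \in Oplus n F.
Proof.
by apply: Oplus_presQ => v; rewrite -(og_Q g) mulmxKV // og_unit.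
Qed.
Definition og_one := OGroup og_one_subproof.
Definition og_mul g h := OGroup (og_mul_subproof g h).
Definition og_inv g := OGroup (og_inv_subproof g).
Fact og_mulA : associative og_mul.
Proof. by move=> g h k; apply: val_inj; rewrite /= mulmxA. Qed.
Fact og_mul1 : left_id og_one og_mul.
Proof. by move=> g; apply: val_inj; rewrite /= mul1mx. Qed.
Fact og_mulr1 : right_id og_one og_mul.
Proof. by move=> g; apply: val_inj; rewrite /= mulmx1. Qed.
Fact og_mulV : left_inverse og_one og_inv og_mul.
Proof. by move=> g; apply: val_inj; rewrite /= mulVmx // og_unit. Qed.
Fact og_mulrV : right_inverse og_one og_inv og_mul.
Proof. by move=> g; apply: val_inj; rewrite /= mulmxV // og_unit. Qed.
HB.instance Definition _ :=
  isGroup.Build ogroup og_mulA og_mul1 og_mulr1 og_mulV og_mulrV.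

Lemma omxM g h : omx (g * h)%g = g *m h. Proof. by []. Qed.
Lemma vmulM v g h : v *m omx (g * h)%g = v *m g *m h.
Proof. by rewrite omxM mulmxA. Qed.
Lemma vmul1 v : v *m omx 1%g = v.
Proof. exact: mulmx1. Qed.
Lemma vmulK v g : v *m g *m omx g^-1%g = v.
Proof. by rewrite -vmulM mulgV vmul1. Qed.

Lemma og_vecP g h : (forall v, v *m g = v *m h) -> g = h.
Proof.
by move=> gh; apply: val_inj; apply/row_matrixP => i; rewrite !rowE gh.
Qed.
Lemma og_bvP g h : (forall a, bv a *m g = bv a *m h) -> g = h.
Proof.
move=> gh; apply: og_vecP => v.
by rewrite (vec_expand v) !mulmx_suml; apply: eq_bigr => a _; rewrite -!scalemxAl gh.
Qed.

Definition rowsmx (f : sidx n -> vec) : 'M[F]_(n + n) := \matrix_i f (ixinv i).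

Lemma bv_rowsmx f a : bv a *m rowsmx f = f a.
Proof. by rewrite -rowE rowK ixK. Qed.
Lemma mul_rowsmx f v : v *m rowsmx f = \sum_a co v a *: f a.
Proof.
rewrite {1}(vec_expand v) mulmx_suml; apply: eq_bigr => a _.
by rewrite -scalemxAl bv_rowsmx.
Qed.

Lemma rowsmx_Oplus f :
    (forall a, Qplus (f a) = 0) ->
    (forall a b, bil (f a) (f b) = (a == neg b)%:R) ->
  rowsmx f \in Oplus n F.
Proof.
move=> Qf Bf; apply: Oplus_presQ => v; rewrite mul_rowsmx [in RHS](vec_expand v).
elim: (index_enum _) => [|a s IHs]; first by rewrite !big_nil.
rewrite !big_cons !QplusD !QplusZ Qf Qplus_bv IHs; congr (_ + _).
rewrite bilC [RHS]bilC !bil_suml; apply: eq_bigr => c _.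
by rewrite !bilE Bf.
Qed.

(** Total in A, with the identity as default, so that matrices can be defined
    before they are shown to be isometries. *)
Definition mkO (A : 'M[F]_(n + n)) : ogroup := insubd (1%g : ogroup) A.
Lemma mkOE A : A \in Oplus n F -> omx (mkO A) = A.
Proof. by move=> OA; rewrite -[omx _]/(val _) val_insubd OA. Qed.

(** ** Monomial isometries *)

Definition mono (g : ogroup) (w : sidx n -> sidx n) (c : sidx n -> F) :=
  forall a, bv a *m g = c a *: bv (w a).

Definition monog w c : ogroup := mkO (rowsmx (fun a => c a *: bv (w a))).

Lemma monogP (w : sidx n -> sidx n) (c : sidx n -> F) :
    injective w -> (forall a, w (neg a) = neg (w a)) ->
    (forall a, c a * c (neg a) = 1) ->
  mono (monog w c) w c.
Proof.
move=> w_inj wN cN a; rewrite mkOE ?bv_rowsmx //.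
apply: rowsmx_Oplus => [x|x y]; first by rewrite QplusZ Qplus_bv mulr0.
rewrite !bilE -wN (inj_eq w_inj) mulrA.
by case: eqP => [->|_]; rewrite ?mulr0 ?mulr1 // mulrC cN.
Qed.

Lemma mono1 : mono 1%g id (fun=> 1).
Proof. by move=> a; rewrite vmul1 scale1r. Qed.

Section MonoTheory.
Variables (g : ogroup) (w : sidx n -> sidx n) (c : sidx n -> F).
Hypothesis gm : mono g w c.

Lemma mono_pair a : c a * c (neg a) = 1 /\ w (neg a) = neg (w a).
Proof.
have := og_bil g (bv a) (bv (neg a)); rewrite !gm !bilE negK eqxx.
case: eqP => [e|_]; last by rewrite !mulr0 => /eqP; rewrite eq_sym oner_eq0.
by rewrite mulrA mulr1; split; [ | rewrite e negK].
Qed.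
Lemma mono_neg a : w (neg a) = neg (w a).
Proof. by case: (mono_pair a). Qed.
Lemma mono_neq0 a : c a != 0.
Proof.
apply/eqP => c0; have [] := mono_pair a.
by rewrite c0 mul0r => /eqP; rewrite eq_sym oner_eq0.
Qed.
Lemma mono_cneg a : c (neg a) = (c a)^-1.
Proof.
apply: (mulfI (mono_neq0 a)); rewrite divff ?mono_neq0 //.
by case: (mono_pair a).
Qed.
Lemma mono_inj : injective w.
Proof.
move=> a b wab; apply/eqP.
have := og_bil g (bv a) (bv (neg b)); rewrite !gm !bilE negK mono_neg negK wab eqxx.
case: (a == b) => //= /eqP.
by rewrite !mulf_eq0 !(negPf (mono_neq0 _)) oner_eq0.
Qed.
Lemma mono_eq a b : (w a == w b) = (a == b).
Proof. exact: inj_eq mono_inj _ _. Qed.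
Lemma mono_fst a b : ((w a).1 == (w b).1) = (a.1 == b.1).
Proof. by rewrite !eq_fst -mono_neg !mono_eq. Qed.
Lemma monoZ t a : (t *: bv a) *m g = (t * c a) *: bv (w a).
Proof. by rewrite -scalemxAl gm scalerA. Qed.
End MonoTheory.

Lemma monoM g h w c w' c' : mono g w c -> mono h w' c' ->
  mono (g * h)%g (w' \o w) (fun a => c a * c' (w a)).
Proof. by move=> gm hm a; rewrite vmulM gm (monoZ hm). Qed.

Lemma mono_inv g w c : mono g w c ->
  exists w', [/\ cancel w w', cancel w' w &
                 mono g^-1%g w' (fun a => (c (w' a))^-1)].
Proof.
move=> gm; have [w' wK w'K] := injF_bij (mono_inj gm).
exists w'; split=> // a.
rewrite -{1}(w'K a) -[bv _]scale1r -(mulVf (mono_neq0 gm (w' a))) -scalerA -gm.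
by rewrite -scalemxAl vmulK.
Qed.

Lemma mono_sound g w (c c' : sidx n -> F) w' : mono g w c -> mono g w' c' -> w =1 w' /\ c =1 c'.
Proof.
move=> gm gm'.
have e a : c a * (w a == w' a)%:R = c' a.
  by have := congr1 (fun v => co v (w' a)) (gm a); rewrite gm' !coE eqxx mulr1.
have ww a : w a = w' a.
  apply/eqP; have := mono_neq0 gm' a; rewrite -e mulf_eq0 negb_or.
  by case: (w a == w' a); rewrite // eqxx andbF.
by split=> // a; rewrite -e ww eqxx mulr1.
Qed.

Lemma mono_eqg g h w c : mono g w c -> mono h w c -> g = h.
Proof. by move=> gm hm; apply: og_bvP => a; rewrite gm hm. Qed.

Lemma mono_ext g w c w' c' : mono g w c -> w =1 w' -> c =1 c' -> mono g w' c'.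
Proof. by move=> gm ew ec a; rewrite gm ew ec. Qed.

End Isometries.

(** * Root elements *)

Section RootElements.
Local Open Scope ring_scope.
Variables (n : nat) (F : finFieldType).
Hypothesis pchar2 : 2%N \in [pchar F].
Notation vec := 'rV[F]_(n + n).
Notation bv := (@bv n F).
Implicit Types (a b d e : sidx n) (v x y : vec) (t u : F) (g h : ogroup n F).

(** The pairs of signed indices on different indices label the roots of type
    D_n, where (a, b) and (neg b, neg a) label the same root ([XN]). *)
Definition root a b := a.1 != b.1.

Lemma rootE a b : root a b = (a != b) && (a != neg b).
Proof. by rewrite /root eq_fst negb_or. Qed.

Lemma rootC a b : root a b = root b a.
Proof. by rewrite /root eq_sym. Qed.

(** In characteristic 2 the long root element maps e_a to e_a + t e_b and
    e_(-b) to e_(-b) + t e_(-a), where -a stands for [neg a]. *)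
Definition Xfun a b t (e : sidx n) : vec :=
  bv e + (t * (e == a)%:R) *: bv b + (t * (e == neg b)%:R) *: bv (neg a).
Definition X a b t : ogroup n F := mkO (rowsmx (Xfun a b t)).

Lemma addrr2 (x : F) : x + x = 0.
Proof. exact: addrr_pchar2 pchar2 x. Qed.

Lemma addrrv (v : vec) : v + v = 0.
Proof. by apply/vecP => a; rewrite !coE addrr2. Qed.

Lemma eq_negr a b : (a == neg b) = (b == neg a).
Proof. by rewrite eq_sym eq_negl. Qed.

Lemma root_neqs a b : root a b ->
  [/\ (a == b) = false, (b == a) = false, (a == neg b) = false & (b == neg a) = false].
Proof.
rewrite rootE => /andP[/negPf ab /negPf anb].
by rewrite (eq_sym b) ab (eq_negr b) anb.
Qed.

Lemma X_Oplus a b t : root a b -> rowsmx (Xfun a b t) \in Oplus n F.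
Proof.
case/root_neqs=> ab ba anb bna.
apply: rowsmx_Oplus => [e|d e].
  rewrite !QplusD !QplusZ !Qplus_bv !bilE !negK ba.
  by have [->|_] := eqVneq e a; rewrite ?anb /=; ring.
rewrite !bilE !negK !eq_neg !neq_neg !neg_neq ab ba.
rewrite (eq_sym a e) (eq_negr b e) /=.
set A := (d == a)%:R; set B := (e == neg b)%:R.
set C := (d == neg b)%:R; set D := (e == a)%:R.
transitivity ((d == neg e)%:R + (t * A * B + t * A * B) + (t * C * D + t * C * D)).
  by ring.
by rewrite !addrr2 !addr0.
Qed.

Lemma actX a b t v : root a b ->
  v *m X a b t = v + (t * co v a) *: bv b + (t * co v (neg b)) *: bv (neg a).
Proof.
move=> ab; rewrite mkOE ?X_Oplus // mul_rowsmx; apply/vecP => e.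
rewrite co_sum !coE -(sum_co (co v) e) -(sum_co (co v) a) -(sum_co (co v) (neg b)) !mulr_sumr !mulr_suml -!big_split.
by apply: eq_bigr => d _ /=; rewrite !coE; ring.
Qed.

Lemma X0 a b : root a b -> X a b 0 = 1%g.
Proof.
by move=> ab; apply: og_vecP => v; rewrite actX // mulmx1 !mul0r !scale0r !addr0.
Qed.

Lemma XD a b t u : root a b -> (X a b t * X a b u)%g = X a b (t + u).
Proof.
move=> ab; have [e1 e2 e3 e4] := root_neqs ab.
apply: og_vecP => v; rewrite vmulM !actX //; apply/vecP => e.
by rewrite !coE !eq_neg ?neq_neg ?neg_neq ?e1 ?e2 ?e3 ?e4 /=; ring.
Qed.

Lemma XN a b t : X (neg b) (neg a) t = X a b t.
Proof.
congr mkO; congr rowsmx; apply: funext => e.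
by rewrite /Xfun !negK addrAC.
Qed.

Lemma X_comm a b d e t u : root a b -> root d e ->
    a != e -> a != neg d -> b != d -> b != neg e ->
  commute (X a b t) (X d e u).
Proof.
move=> ab de /negPf ae /negPf ad /negPf bd /negPf be.
apply: og_vecP => v; rewrite !vmulM !actX //; apply/vecP => c.
rewrite !coE !eq_neg !eq_negl (eq_sym d b) (eq_sym e a) (eq_negr e b) (eq_negr d a).
by rewrite ae ad bd be /=; ring.
Qed.

(** All signs of the commutator formula disappear in characteristic 2. *)
Lemma X_chevalley a b d t u : root a b -> root b d -> root a d ->
  (X a b t * X b d u = X b d u * X a b t * X a d (t * u)%R)%g.
Proof.
move=> ab bd ad.
have [ab1 ab2 ab3 ab4] := root_neqs ab.
have [bd1 bd2 bd3 bd4] := root_neqs bd.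
have [ad1 ad2 ad3 ad4] := root_neqs ad.
apply: og_vecP => v; rewrite !vmulM !actX //; apply/vecP => c.
rewrite !coE !eq_neg !eq_negl !eqxx.
rewrite ?ab1 ?ab2 ?ab3 ?ab4 ?bd1 ?bd2 ?bd3 ?bd4 ?ad1 ?ad2 ?ad3 ?ad4 !neq_neg /=.
set C := (a == neg c)%:R; set w := co v (neg d).
have e0 : (t * u * w + t * u * w) * C = 0 by rewrite addrr2 mul0r.
rewrite -[LHS]addr0 -e0; ring.
Qed.

Lemma mono_XJ g w k a b t : mono g w k -> root a b ->
  (X a b t ^ g)%g = X (w a) (w b) ((k a)^-1 * k b * t).
Proof.
move=> gm ab; have wab : root (w a) (w b) by rewrite /root (mono_fst gm).
apply: (mulgI g); rewrite -conjgC.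
apply: og_bvP => e; rewrite !vmulM !actX // gm !mulmxDl -!scalemxAl !gm.
rewrite !coE -!(mono_neg gm) !(mono_eq gm) (mono_cneg gm) !scalerA.
have ka := mono_neq0 gm a.
congr (_ + _ *: _ + _ *: _).
  have [->|] := eqVneq e a; last by rewrite ?mulr0 ?mul0r.
  by field.
have [->|] := eqVneq e (neg b); last by rewrite ?mulr0 ?mul0r.
by rewrite (mono_cneg gm); field; rewrite ?ka ?(mono_neq0 gm).
Qed.

Lemma X_inj a b d e t u : root a b -> root d e -> t != 0 -> X a b t = X d e u ->
  t = u /\ ((d, e) = (a, b) \/ (d, e) = (neg b, neg a)).
Proof.
move=> ab de t0 eqX.
have := congr1 (fun g : ogroup n F => co (bv a *m g) b) eqX.
rewrite /= !actX // !coE !eqxx; have [-> _ -> _] := root_neqs ab.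
rewrite (eq_negl d) !(mulr0, mul0r, addr0, add0r, mulr1).
have [_ _ anb _] := root_neqs ab.
have [da|_] := eqVneq a d.
  rewrite -da anb mulr0 addr0 mulr1.
  have [->|_] := eqVneq e b; rewrite ?mulr1 ?mulr0 => et; first by split; [|left].
  by rewrite et eqxx in t0.
have [ea|_] := eqVneq a (neg e); rewrite !(mulr0, mul0r, addr0, add0r, mulr1) => et.
  move: et; have [eb|_] := eqVneq d (neg b); rewrite ?mulr1 ?mulr0 => et.
    by split=> //; right; rewrite eb ea negK.
  by rewrite et eqxx in t0.
by rewrite et eqxx in t0.
Qed.

End RootElements.

(** * The Dickson invariant *)

Local Open Scope ring_scope.
(** N is the sum of M and the line of z; the second hypothesis states this on
    vectors, the form in which it comes out of kernels. *)
Lemma mxrank_addv (F : fieldType) m (M : 'M[F]_m) (N : 'M[F]_m) (z : 'rV[F]_m) :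
    ~~ (z <= M)%MS ->
    (forall x : 'rV[F]_m, (x <= N)%MS <-> exists c, ((x + c *: z)%R <= M)%MS) ->
  \rank N = (\rank M).+1.
Proof.
move=> zM NE.
have eN : (N :=: M + z)%MS.
  apply/eqmxP/andP; split; apply/rV_subP => x.
    case/NE => c xc; rewrite -(addrK (c *: z) x).
    apply: addmx_sub; first exact: submx_trans xc (addsmxSl _ _).
    by rewrite -scaleNr scalemx_sub // addsmxSr.
  case/sub_addsmxP => -[p r] /= ->; apply/NE; exists (- (r 0 0)).
  have -> : r *m z = r 0 0 *: z by rewrite [r]mx11_scalar mul_scalar_mx !mxE eqxx.
  by rewrite scaleNr addrK submxMl.
have z0 : z != 0 by apply: contraNneq zM => ->; exact: sub0mx.
rewrite eN mxrank_disjoint_sum ?rank_rV ?z0 ?addn1 //.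
apply/eqP; rewrite -submx0; apply/rV_subP => x; rewrite sub_capmx.
case/andP => xM /sub_rVP[c xc]; rewrite submx0 xc scaler_eq0.
apply/orP; left; apply: contraNT zM => c0.
by rewrite -(scalerK c0 z) -xc scalemx_sub.
Qed.

Local Close Scope ring_scope.

Section Dickson.
Local Open Scope ring_scope.
Variables (n : nat) (F : finFieldType).
Hypothesis pchar2 : 2%N \in [pchar F].
Notation vec := 'rV[F]_(n + n).
Notation bv := (@bv n F).
Implicit Types (a b d e : sidx n) (v x y : vec) (t u : F) (g h : ogroup n F).

Lemma bil_self v : bil v v = 0.
Proof.
have := QplusD v v; rewrite (addrrv pchar2) Qplus0.
by rewrite (addrr2 pchar2) add0r.
Qed.

Lemma vec_opp v : - v = v.
Proof. by apply/rowP => i; rewrite mxE (oppr_pchar2 pchar2). Qed.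

Lemma mulmx_sub1 g x : x *m (omx g - 1%:M) = x *m g + x.
Proof. by rewrite mulmxBr mulmx1 vec_opp. Qed.

Lemma vecD_eq0 x v : x + v = 0 <-> x = v.
Proof.
split=> [|->]; last exact: addrrv.
by move/(congr1 (+%R^~ v)); rewrite -addrA (addrrv pchar2) addr0 add0r.
Qed.

Definition refl v : ogroup n F := mkO (rowsmx (fun a => bv a + bil (bv a) v *: v)).

Lemma act_refl v x : Qplus v = 1 -> x *m refl v = x + bil x v *: v.
Proof.
move=> Qv; rewrite mkOE.
  rewrite mul_rowsmx [in RHS](vec_expand x) bil_suml scaler_suml -big_split.
  by apply: eq_bigr => a _; rewrite scalerDr bilZl scalerA.
apply: rowsmx_Oplus => [a|a b].
  by rewrite QplusD QplusZ Qplus_bv Qv bilZr mulr1 add0r expr2 (addrr2 pchar2).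
rewrite !bilDl !bilDr !bilZl !bilZr bil_bv bil_self !mulr0 addr0 -addrA.
by rewrite (bilC v) [X in _ + X](_ : _ = 0) ?addr0 // mulrC (addrr2 pchar2).
Qed.

(** The image of g - 1 and the space fixed by g are orthogonal, because g is
    an isometry, and their dimensions add up to that of the whole space; so
    each is the orthogonal complement of the other. *)
Lemma fixed_perp g v :
  (forall x, x *m g = x -> bil x v = 0) -> (v <= omx g - 1%:M)%MS.
Proof.
move=> v_perp; pose D := omx g - 1%:M; pose K := kermx D.
pose J := rowsmx (fun a => bv (neg a)).
have JE x a : co (x *m J) a = co x (neg a).
  rewrite mul_rowsmx co_sum; under eq_bigr do rewrite coZ co_bv eq_negl.
  exact: sum_co.
have JJ : J *m J = 1%:M.
  apply/row_matrixP => i; rewrite !rowE mulmxA mulmx1.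
  by apply/vecP => a; rewrite !JE negK.
have bilJ x y : x *m (y *m J)^T = (bil x y)%:M.
  rewrite [LHS]mx11_scalar; congr (_%:M); rewrite mxE /bil.
  rewrite (reindex (@ix n)) /=; last by exists (@ixinv n) => ? _; rewrite ?ixK ?ixinvK.
  by apply: eq_bigr => a _; rewrite -JE /co mxE.
pose N := kermx (K *m J)^T.
have NP x : (x <= N)%MS <-> forall y, y *m g = y -> bil x y = 0.
  split=> [/sub_kermxP xN y yg|xP].
    have /submxP[p yK] : (y <= K)%MS.
      by apply/sub_kermxP; rewrite mulmx_sub1 yg (addrrv pchar2).
    have := bilJ x y; rewrite yK -mulmxA trmx_mul mulmxA xN mul0mx => /esym.
    by move/(congr1 (fun M : 'M_1 => M 0 0)); rewrite !mxE eqxx.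
  apply/sub_kermxP; apply: trmx_inj; rewrite trmx0 trmx_mul trmxK.
  apply/row_matrixP => i; rewrite row_mul row0 row_mul.
  apply: trmx_inj; rewrite trmx_mul trmxK trmx0 bilJ xP ?raddf0 //.
  have /sub_kermxP : (row i K <= K)%MS by exact: row_sub.
  by rewrite mulmx_sub1 => /vecD_eq0.
have DN : (D <= N)%MS.
  apply/rV_subP => _ /submxP[x ->]; apply/NP => y yg.
  by rewrite mulmx_sub1 bilDl -{1}yg og_bil (addrr2 pchar2).
have [_ /esym] := mxrank_leqif_sup DN.
rewrite mxrank_ker mxrank_tr mxrankMfree; last first.
  by rewrite row_free_unit; case/mulmx1_unit: JJ.
rewrite mxrank_ker subKn ?rank_leq_row // eqxx => ND.
by apply: submx_trans ND; apply/NP => y yg; rewrite bilC v_perp.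
Qed.

(** Compare the fixed spaces of g and of g r_v. If v lies in the image of g -
    1, say v = y g + y, then y has product 1 with v and the fixed space grows
    by the line of y. If not, some vector z fixed by g is not orthogonal to v,
    and the fixed space shrinks to the vectors orthogonal to v. In both cases
    the dimension changes by 1. *)
Lemma dickson_refl g v : Qplus v = 1 -> dickson (omx (g * refl v)%g) = ~~ dickson g.
Proof.
move=> Qv; pose D := omx g - 1%:M; pose D' := omx (g * refl v)%g - 1%:M.
have DE x : x *m D = x *m g + x.
  exact: mulmx_sub1.
have D'E x : x *m D' = x *m D + bil (x *m g) v *: v.
  by rewrite DE mulmx_sub1 vmulM act_refl // addrAC.
have v0 : v != 0.
  by apply/eqP => v0; move: Qv; rewrite v0 Qplus0 => /eqP; rewrite eq_sym oner_eq0.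
have fixE x : (x <= kermx D)%MS <-> x *m g = x.
  split=> [/sub_kermxP|xg]; last by apply/sub_kermxP; rewrite DE xg (addrrv pchar2).
  by rewrite DE => /vecD_eq0.
have rk (A : 'M[F]_(n + n)) : \rank A = (n + n - \rank (kermx A))%N.
  by rewrite mxrank_ker subKn // rank_leq_row.
rewrite /dickson -/D -/D' (rk D) (rk D').
have [vD|vD] := boolP (v <= D)%MS.
  have /submxP[y vy] := vD.
  have yg : y *m g = y + v by rewrite vy DE addrCA (addrrv pchar2) addr0.
  have byv : bil y v = 1.
    have := og_Q g y; rewrite yg QplusD Qv -addrA -[RHS]addr0 => /addrI e.
    by have := congr1 (+%R 1) e; rewrite addrA (addrr2 pchar2) add0r addr0.
  have -> : \rank (kermx D') = (\rank (kermx D)).+1.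
    apply: (mxrank_addv (z := y)).
      by apply/negP => /sub_kermxP yD; move: v0; rewrite vy yD eqxx.
    move=> x; split=> [/sub_kermxP|[c]].
      rewrite D'E => xD; exists (bil (x *m g) v); apply/sub_kermxP.
      by rewrite mulmxDl -scalemxAl -vy.
    move=> xK; apply/sub_kermxP; move/fixE: (xK) => xg; move/sub_kermxP: xK.
    rewrite mulmxDl -scalemxAl -vy D'E => xD.
    have -> : bil (x *m g) v = c; last by [].
    have : bil (x + c *: y) v = 0.
      rewrite vy DE bilDr -{1}xg og_bil; exact: addrr2.
    rewrite bilDl bilZl byv mulr1 => /eqP; rewrite addr_eq0 => /eqP bx.
    have -> : x *m g = (x + c *: y) *m g + c *: (y *m g).
      by rewrite mulmxDl scalemxAl -addrA (addrrv pchar2) addr0.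
    by rewrite xg yg !(bilDl, bilZl) byv bil_self addr0 mulr1 bx addNr add0r.
  have lt : (\rank (kermx D) < n + n)%N.
    rewrite mxrank_ker ltn_subrL; apply/andP; split.
      rewrite lt0n mxrank_eq0; apply: contraTneq vD => ->.
      by rewrite submx0.
    by rewrite (leq_trans _ (rank_leq_col v)) // rank_rV v0.
  by rewrite -[in RHS](subnSK lt) /= negbK.
have [z zg bz] : exists2 z, z *m g = z & bil z v != 0.
  apply: contrapT => no; move/negP: vD; apply; apply: fixed_perp => x xg.
  by apply/eqP; apply: contrapT => /negP bx; apply: no; exists x.
have eK : \rank (kermx D) = (\rank (kermx D')).+1.
  apply: (mxrank_addv (z := z)).
    apply/negP => /sub_kermxP; rewrite D'E DE zg (addrrv pchar2) add0r => /eqP.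
    by rewrite scaler_eq0 (negPf bz) (negPf v0).
  move=> x; split=> [/fixE xg|[c]].
    exists (- (bil x v / bil z v)); apply/sub_kermxP.
    rewrite D'E DE mulmxDl -scalemxAl xg zg (addrrv pchar2) add0r.
    by rewrite bilDl bilZl mulNr divfK // subrr scale0r.
  move/sub_kermxP; rewrite D'E => xD.
  have b0 : bil ((x + c *: z) *m g) v = 0.
    apply: contraNeq vD => b0; rewrite -(scalerK b0 v) scalemx_sub //.
    by move/eqP: xD; rewrite addrC addr_eq0 => /eqP ->; rewrite -mulNmx submxMl.
  move: xD; rewrite b0 scale0r addr0 => xD; apply/sub_kermxP.
  by rewrite -[x](addrK (c *: z)) mulmxBl xD -scalemxAl DE zg (addrrv pchar2) scaler0 subrr.
have lt : (\rank (kermx D') < n + n)%N by rewrite -eK rank_leq_row.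
by rewrite eK -(subnSK lt).
Qed.

End Dickson.

(** * Monomial generators and their Dickson invariants *)

Section MonomialGenerators.
Local Open Scope ring_scope.
Variables (n : nat) (F : finFieldType).
Hypothesis pchar2 : 2%N \in [pchar F].
Notation vec := 'rV[F]_(n + n).
Notation bv := (@bv n F).
Notation og := (ogroup n F).
Implicit Types (a b d e : sidx n) (v x y : vec) (t u : F) (g h : og).
Implicit Types (i j : 'I_n) (s : {perm 'I_n}) (A : {set 'I_n}).

Definition perm_ix s a : sidx n := (s a.1, a.2).
Definition flip_ix A a : sidx n := (a.1, a.2 (+) (a.1 \in A)).
(** The coefficients of diag(t^-1 on e_i, t on f_i), which is delta for the
    first index and t = omega. *)
Definition torus_co i t a : F := if a.1 == i then (if a.2 then t else t^-1) else 1.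
Definition unit_co a : F := 1.

Definition perm_og s : og := monog (perm_ix s) unit_co.
Definition flip_og A : og := monog (flip_ix A) unit_co.
Definition torus_og i t : og := monog id (torus_co i t).

Lemma perm_og_mono s : mono (perm_og s) (perm_ix s) unit_co.
Proof.
apply: monogP => [[i x] [j y] [/perm_inj -> ->] //|[i x] //|a].
exact: mulr1.
Qed.

Lemma flip_og_mono A : mono (flip_og A) (flip_ix A) unit_co.
Proof.
apply: monogP => [[i x] [j y] [-> /addIb ->] //|[i x]|a]; last exact: mulr1.
by rewrite /flip_ix /neg /= addNb.
Qed.

Lemma torus_og_mono i t : t != 0 -> mono (torus_og i t) id (torus_co i t).
Proof.
move=> t0; apply: monogP => // -[j x]; rewrite /torus_co /=.
by case: eqP => _; [case: x => /=; rewrite ?mulVf ?divff | rewrite mulr1].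
Qed.

Lemma perm_ogM s s' : perm_og (s * s')%g = (perm_og s * perm_og s')%g.
Proof.
apply: mono_eqg (perm_og_mono _) _; apply: mono_ext (monoM (perm_og_mono s) (perm_og_mono s')) _ _.
  by move=> a; rewrite /perm_ix /= permM.
by move=> a; rewrite /unit_co mulr1.
Qed.

Lemma perm_og1 : perm_og 1 = 1%g.
Proof. by apply/(mulgI (perm_og 1)); rewrite -perm_ogM !mulg1. Qed.

Lemma perm_ogV s : perm_og s^-1 = (perm_og s)^-1%g.
Proof. by apply/(mulgI (perm_og s)); rewrite -perm_ogM !mulgV perm_og1. Qed.

Lemma perm_ogJ s s' : (perm_og s ^ perm_og s')%g = perm_og (s ^ s')%g.
Proof. by rewrite !conjgE !perm_ogM perm_ogV. Qed.

Lemma flip_ogM A B : (flip_og A * flip_og B)%g = flip_og [set i | (i \in A) (+) (i \in B)].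
Proof.
apply: mono_eqg (flip_og_mono _).
apply: mono_ext (monoM (flip_og_mono A) (flip_og_mono B)) _ _ => a /=.
  by rewrite /flip_ix /= inE addbA.
by rewrite /unit_co mulr1.
Qed.

Lemma flip_og0 : flip_og set0 = 1%g.
Proof.
apply: (mono_eqg _ (@mono1 n F)); apply: mono_ext (flip_og_mono _) _ _ => // a.
by rewrite /flip_ix inE addbF; case: a.
Qed.

Lemma flip_ogE A : (flip_og A * flip_og A)%g = 1%g.
Proof. by rewrite flip_ogM -flip_og0; congr flip_og; apply/setP => i; rewrite !inE addbb. Qed.

Lemma flip_ogC A B : commute (flip_og A) (flip_og B).
Proof. by rewrite /commute !flip_ogM; congr flip_og; apply/setP => i; rewrite !inE addbC. Qed.

Lemma flip_ogJ A s : (flip_og A ^ perm_og s)%g = flip_og (s @: A).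
Proof.
apply: (mulgI (perm_og s)); rewrite -conjgC.
apply: mono_eqg (monoM (flip_og_mono _) (perm_og_mono _)) _.
apply: mono_ext (monoM (perm_og_mono _) (flip_og_mono _)) _ _ => a //=.
by rewrite /perm_ix /flip_ix /= (mem_imset _ _ (@perm_inj _ s)).
Qed.

Lemma torus_ogM i t u : t != 0 -> u != 0 -> (torus_og i t * torus_og i u)%g = torus_og i (t * u).
Proof.
move=> t0 u0; apply: mono_eqg (torus_og_mono i (mulf_neq0 t0 u0)).
apply: mono_ext (monoM (torus_og_mono i t0) (torus_og_mono i u0)) _ _ => // -[j x] /=.
by rewrite /torus_co /=; case: ifP; case: x; rewrite ?mulr1 // invfM.
Qed.

Lemma torus_og1 i : torus_og i 1 = 1%g.
Proof.
apply: (mono_eqg _ (@mono1 n F)); apply: mono_ext (torus_og_mono i (oner_neq0 _)) _ _ => //.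
by move=> a; rewrite /torus_co invr1; case: ifP => // _; case: ifP.
Qed.

Lemma torus_ogX i t m : t != 0 -> (torus_og i t ^+ m)%g = torus_og i (t ^+ m).
Proof.
move=> t0; elim: m => [|m IHm]; first by rewrite torus_og1.
by rewrite expgS IHm torus_ogM ?expf_neq0 // exprS.
Qed.

Lemma torus_ogV i t : t != 0 -> ((torus_og i t)^-1)%g = torus_og i t^-1.
Proof. by move=> t0; apply: mulg1_eq; rewrite torus_ogM ?invr_eq0 // divff ?torus_og1. Qed.

Lemma torus_ogC i j t u : t != 0 -> u != 0 -> commute (torus_og i t) (torus_og j u).
Proof.
move=> t0 u0; apply: mono_eqg (monoM (torus_og_mono i t0) (torus_og_mono j u0)) _.
by apply: mono_ext (monoM (torus_og_mono j u0) (torus_og_mono i t0)) _ _ => // a; rewrite mulrC.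
Qed.

Lemma torus_ogJP i t s : t != 0 -> (torus_og i t ^ perm_og s)%g = torus_og (s i) t.
Proof.
move=> t0; apply: (mulgI (perm_og s)); rewrite -conjgC.
apply: mono_eqg (monoM (torus_og_mono _ t0) (perm_og_mono _)) _.
apply: mono_ext (monoM (perm_og_mono _) (torus_og_mono _ t0)) _ _ => a //=.
by rewrite /torus_co /perm_ix /= (inj_eq perm_inj) /unit_co mul1r mulr1.
Qed.

Lemma torus_ogJE i t A : t != 0 -> (torus_og i t ^ flip_og A)%g = torus_og i (if i \in A then t^-1 else t).
Proof.
move=> t0; apply: (mulgI (flip_og A)); rewrite -conjgC.
have t0' : (if i \in A then t^-1 else t) != 0 by case: ifP; rewrite ?invr_eq0.
apply: mono_eqg (monoM (torus_og_mono _ t0) (flip_og_mono _)) _.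
apply: mono_ext (monoM (flip_og_mono _) (torus_og_mono _ t0')) _ _ => -[j x] //=.
rewrite /torus_co /flip_ix /= /unit_co mul1r mulr1; case: eqP => [->|//].
by case: (i \in A); case: x => //=; rewrite invrK.
Qed.

Lemma XJP a b t s : root a b -> (X a b t ^ perm_og s)%g = X (perm_ix s a) (perm_ix s b) t.
Proof. by move=> ab; rewrite (mono_XJ pchar2 _ (perm_og_mono s)) // invr1 !mul1r. Qed.
Lemma XJE a b t A : root a b -> (X a b t ^ flip_og A)%g = X (flip_ix A a) (flip_ix A b) t.
Proof. by move=> ab; rewrite (mono_XJ pchar2 _ (flip_og_mono A)) // invr1 !mul1r. Qed.
Lemma XJD a b t i u : root a b -> u != 0 ->
  (X a b t ^ torus_og i u)%g = X a b ((torus_co i u a)^-1 * torus_co i u b * t).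
Proof. by move=> ab u0; rewrite (mono_XJ pchar2 _ (torus_og_mono i u0)). Qed.

(** ** Parity *)

(** This condition is stronger than a vanishing Dickson invariant, and it is
    closed under products for formal reasons. *)
Definition even_og g := forall h, dickson (omx (h * g)%g) = dickson (omx h).

Lemma even1 : even_og 1%g. Proof. by move=> h; rewrite mulg1. Qed.
Lemma evenM g h : even_og g -> even_og h -> even_og (g * h)%g.
Proof. by move=> ge he k; rewrite mulgA he ge. Qed.
Lemma evenV g : even_og g -> even_og g^-1%g.
Proof. by move=> ge h; rewrite -ge mulgVK. Qed.
Lemma even_refl2 v x : Qplus v = 1 -> Qplus x = 1 ->
  even_og (refl v * refl x)%g.
Proof. by move=> Qv Qx h; rewrite mulgA !(dickson_refl pchar2) ?negbK. Qed.
Lemma even_dickson g : even_og g -> dickson (omx g) = false.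
Proof. by move=> ge; rewrite -[g]mul1g ge /dickson subrr mxrank0. Qed.

(** A vector v with form 1 orthogonal to the totally singular plane spanned by
    p and q makes the Siegel transformation of p and q a product of four
    reflections. *)
Lemma even_siegel (p q v : vec) g :
    Qplus p = 0 -> Qplus q = 0 -> bil p q = 0 ->
    Qplus v = 1 -> bil p v = 0 -> bil q v = 0 ->
    (forall x, x *m g = x + bil x p *: q + bil x q *: p) ->
  even_og g.
Proof.
move=> Qp Qq pq Qv pv qv gact.
have vp : bil v p = 0 by rewrite bilC.
have vq : bil v q = 0 by rewrite bilC.
have qp : bil q p = 0 by rewrite bilC.
have Qqv : Qplus (q + v) = 1 by rewrite QplusD Qq Qv qv add0r addr0.
have Qqvp : Qplus (q + v + p) = 1.
  by rewrite QplusD Qqv Qp bilDl qp vp !addr0.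
have Qvp : Qplus (v + p) = 1 by rewrite QplusD Qv Qp vp !addr0.
have -> : g = (refl (q + v) * refl (q + v + p) * (refl v * refl (v + p)))%g.
  apply: og_vecP => x; rewrite gact !vmulM !act_refl //.
  rewrite !(bilDl, bilDr, bilZl, bilZr) !bil_self // ?pq ?qp ?pv ?vp ?qv ?vq.
  rewrite !(mulr0, addr0, add0r); apply/vecP => e; rewrite !coE.
  set P := bil x p; set Q := bil x q; set V := bil x v.
  set cp := co p e; set cq := co q e; set cv := co v e.
  transitivity (co x e + P * cq + Q * cp +
     ((Q + V) + (Q + V)) * cq + ((Q + V + P + V) + (Q + V + P + V)) * cv
     + ((V + P) + (V + P)) * cp).
    by rewrite !(addrr2 pchar2) !mul0r !addr0.
  by ring.
by apply: evenM; apply: even_refl2.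
Qed.

Hypothesis n_gt2 : (2 < n)%N.

Lemma third_index i j : exists k, (k != i) && (k != j).
Proof.
apply/existsP; apply: contraLR n_gt2 => /existsPn no.
rewrite -leqNgt -[n]card_ord -cardsT.
suff /subset_leq_card/leq_trans : [set: 'I_n] \subset [set i; j].
  by apply; rewrite cards2; case: eqP.
apply/subsetP => k _; rewrite !inE; move: (no k).
by rewrite negb_and !negbK.
Qed.

(** A vector with form 1: the reflection in it is the sign change of the i-th
    hyperbolic pair ([flip1_refl]). *)
Definition hv i : vec := bv (i, false) + bv (i, true).

Lemma Qplus_hv i : Qplus (hv i) = 1.
Proof. by rewrite QplusD !Qplus_bv bil_bv eqxx !add0r. Qed.

Lemma bil_hv a i : i != a.1 -> bil (bv a) (hv i) = 0.
Proof.
move=> ia; rewrite bilDr !bil_bv /neg /=.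
by case: a ia => j x /=; rewrite !xpair_eqE (eq_sym j) => /negPf ->; rewrite addr0.
Qed.

(** The third index provides the vector with form 1 that is orthogonal to the
    plane of the root element. *)
Lemma even_X a b t : root a b -> even_og (X a b t).
Proof.
move=> ab; have [k /andP[ka kb]] := third_index a.1 b.1.
have [_ ba anb _] := root_neqs ab.
apply: (@even_siegel (t *: bv (neg a)) (bv b) (hv k)).
- by rewrite QplusZ Qplus_bv mulr0.
- exact: Qplus_bv.
- by rewrite bilZl bil_bv eq_neg (eq_sym a) ba mulr0.
- exact: Qplus_hv.
- by rewrite bilZl bil_hv ?mulr0.
- exact: bil_hv.
move=> x; rewrite (actX pchar2) // bilZr !bil_bvr negK; congr (_ + _).
by rewrite scalerA mulrC.
Qed.

(** A transposition (i j) is the Siegel transformation of e_i + e_j and f_i +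
    f_j, in characteristic 2. *)
Lemma even_perm_og s : even_og (perm_og s).
Proof.
apply: (@perm_stab_ind n 0 (fun s => even_og (perm_og s))) => //.
- by rewrite perm_og1; exact: even1.
- by move=> s1 s2 e1 e2; rewrite perm_ogM; exact: evenM.
move=> i j _ ij.
have ne : (i == j) = false by apply/negP => /eqP e; move: ij; rewrite e; lia.
have [k /andP[ki kj]] := third_index i j.
apply: (@even_siegel (bv (i, false) + bv (j, false)) (bv (i, true) + bv (j, true)) (hv k)).
- by rewrite QplusD !Qplus_bv bil_bv xpair_eqE andbF !addr0.
- by rewrite QplusD !Qplus_bv bil_bv xpair_eqE andbF !addr0.
- by rewrite !bilE /neg !xpair_eqE /= !eqxx (eq_sym j) ne add0r addr0 (addrr2 pchar2).
- exact: Qplus_hv.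
- by rewrite bilDl !bil_hv ?addr0.
- by rewrite bilDl !bil_hv ?addr0.
move=> x; rewrite (vec_expand x) mulmx_suml !bil_suml !scaler_suml -!big_split.
apply: eq_bigr => -[k' z] _ /=; rewrite -scalemxAl perm_og_mono /unit_co /perm_ix /= scale1r.
rewrite !bilZl !bilDr !bil_bv /neg !xpair_eqE /= -!scalerA -!scalerDr; congr (_ *: _).
apply/vecP => e; rewrite !coE.
case: tpermP => [->|->|].
- rewrite eqxx ne; case: z => /=; rewrite !(mul0r, mul1r, add0r, addr0).
    by rewrite addrA (addrr2 pchar2) add0r.
  by rewrite addrA (addrr2 pchar2) add0r.
- rewrite eqxx (eq_sym j) ne; case: z => /=; rewrite !(mul0r, mul1r, add0r, addr0).
    by rewrite addrCA (addrr2 pchar2) addr0.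
  by rewrite addrCA (addrr2 pchar2) addr0.
by move=> /eqP/negPf -> /eqP/negPf ->; rewrite !(mul0r, addr0).
Qed.

Lemma flip1_refl i : flip_og [set i] = refl (hv i).
Proof.
apply: og_bvP => -[j x]; rewrite act_refl ?Qplus_hv // flip_og_mono /unit_co scale1r.
rewrite /flip_ix /= inE; apply/vecP => e; rewrite /hv !coE bilDr !bil_bv /neg /= !xpair_eqE.
have [->|ji] := eqVneq j i; last by rewrite /= addr0 mul0r addr0 addbF.
case: x => /=; rewrite ?(addr0, add0r, mul1r).
  by rewrite addrCA (addrr2 pchar2) addr0.
by rewrite addrA (addrr2 pchar2) add0r.
Qed.

Lemma dickson_flip1 i g : dickson (omx (g * flip_og [set i])%g) = ~~ dickson (omx g).
Proof. by rewrite flip1_refl dickson_refl ?Qplus_hv. Qed.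

Lemma even_flip2 i j : i != j -> even_og (flip_og [set i; j]).
Proof.
move=> ij; have -> : flip_og [set i; j] = (flip_og [set i] * flip_og [set j])%g.
  rewrite flip_ogM; congr flip_og; apply/setP => k; rewrite !inE.
  by have [->|//] := eqVneq k i; rewrite (negPf ij).
by rewrite !flip1_refl; apply: even_refl2; exact: Qplus_hv.
Qed.

Lemma sqrt_pchar2 t : exists u, u ^+ 2 = t.
Proof.
have : bijective (fun u : F => u ^+ 2).
  apply: injF_bij => x y xy; apply/eqP.
  have : (x + y) ^+ 2 == 0.
    by rewrite sqrrD mulr2n (addrr2 pchar2) addr0 xy (addrr2 pchar2).
  by rewrite expf_eq0 /= addr_eq0 (oppr_pchar2 pchar2).
by case=> r _ rK; exists (r t).
Qed.

(** The product of the reflections in e_i + f_i and in u^-1 e_i + u f_i is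
    diagonal with entries u^-2 and u^2, and u^2 can be any nonzero t. *)
Lemma even_torus i t : t != 0 -> even_og (torus_og i t).
Proof.
move=> t0; have [u u2] := sqrt_pchar2 t.
have u0 : u != 0 by apply: contraNneq t0 => u0; rewrite -u2 u0 expr2 mul0r.
pose v := u^-1 *: bv (i, false) + u *: bv (i, true).
have Qv : Qplus v = 1.
  rewrite QplusD !QplusZ !Qplus_bv !mulr0 !add0r !bilE.
  by rewrite eqxx mulr1 mulfV.
have -> : torus_og i t = (refl (hv i) * refl v)%g.
  apply: og_bvP => -[j x]; rewrite torus_og_mono // -flip1_refl vmulM flip_og_mono /unit_co scale1r.
  rewrite act_refl // /flip_ix /= inE /torus_co /=; apply/vecP => e.
  rewrite /v !coE !bilE /neg !xpair_eqE /= -u2.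
  have [->|ji] := eqVneq j i; last by rewrite /= !mulr0 !addr0 mul0r addr0 mul1r addbF.
  case: x => /=; rewrite ?(mulr0, addr0, add0r, mulr1).
    by rewrite mulrDr !mulrA mulfV // mul1r addrA (addrr2 pchar2) add0r expr2.
  by rewrite mulrDr !mulrA mulVf // mul1r addrC -addrA (addrr2 pchar2) addr0 expr2 invfM.
by apply: even_refl2 => //; exact: Qplus_hv.
Qed.

End MonomialGenerators.

(** * Generation of the kernel of the Dickson invariant *)

Section Elimination.
Local Open Scope ring_scope.
Variables (n : nat) (F : finFieldType).
Hypothesis pchar2 : 2%N \in [pchar F].
Hypothesis n_gt2 : (2 < n)%N.
Notation vec := 'rV[F]_(n + n).
Notation bv := (@bv n F).
Notation og := (ogroup n F).
Implicit Types (a b d e : sidx n) (v x y : vec) (t u : F) (g h : og).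
Implicit Types (i j : 'I_n) (s : {perm 'I_n}) (A : {set 'I_n}).

Variable Im : og -> Prop.
Hypothesis Im1 : Im 1%g.
Hypothesis ImM : forall g h, Im g -> Im h -> Im (g * h)%g.
Hypothesis ImV : forall g, Im g -> Im g^-1%g.
Hypothesis ImX : forall a b t, root a b -> Im (X a b t).
Hypothesis ImP : forall s, Im (perm_og F s).
Hypothesis ImE : forall i j, i != j -> Im (flip_og F [set i; j]).
Hypothesis ImD : forall i t, t != 0 -> Im (torus_og i t).

(** Root elements X b c t with c outside of the hyperbolic pair of b clear the
    coordinate c of v with the pivot b, and only spoil the coordinate at the
    negative of b. The last clause says which basis vectors survive, for use
    after some basis vectors have already been fixed. *)
Lemma clear_coords v b (l : seq (sidx n)) :
    co v b != 0 -> all (fun d => root b d) l ->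
  exists g, [/\ Im g, forall d, d \in l -> co (v *m g) d = 0,
    forall d, d \notin l -> d != neg b -> co (v *m g) d = co v d &
    forall d, d = neg b \/ (root b d /\ co v d = 0 /\ co v (neg d) = 0) ->
      bv d *m g = bv d].
Proof.
move=> vb; elim: l => [_|c l IHl /= /andP[bc bl]].
  by exists 1%g; split=> // *; rewrite vmul1.
have [g [Ig gl gnl gfix]] := IHl bl.
have nbl : b \notin l.
  by apply/negP => /(allP bl); rewrite /root eqxx.
have [bc1 bc2 bc3 bc4] := root_neqs bc.
pose v1 := v *m g; pose t := co v1 c / co v b.
have v1b : co v1 b = co v b by rewrite /v1 gnl // neq_neg.
have tb : t * co v b = co v1 c by rewrite /t divfK.
exists (g * X b c t)%g; split.
- exact/ImM/ImX.
- move=> d; rewrite inE vmulM actX // -/v1 !coE v1b tb => dl.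
  have nd : (neg b == d) = false.
    apply/negP => /eqP nbd; move: dl; rewrite -nbd eq_sym bc4 /=.
    by move/(allP bl); rewrite /root eqxx.
  rewrite nd mulr0 addr0 eq_sym; case: eqP dl => [->|_] /=.
    by rewrite mulr1 (addrr2 pchar2).
  by move=> dl; rewrite mulr0 addr0 /v1 gl.
- move=> d; rewrite inE negb_or => /andP[dc dl] db.
  rewrite vmulM actX // -/v1 !coE (eq_sym c) (negPf dc) (eq_sym (neg b)) (negPf db).
  by rewrite !mulr0 !addr0 /v1 gnl.
move=> d dfix; rewrite vmulM gfix // actX // !coE.
have -> : (d == b) = false.
  by case: dfix => [->|[+ _]]; [rewrite neg_neq | case/root_neqs].
rewrite mulr0 scale0r addr0.
have [dc|] := eqVneq d (neg c); last by rewrite mulr0 scale0r addr0.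
suff -> : t = 0 by rewrite mul0r scale0r addr0.
rewrite /t; suff -> : co v1 c = 0 by rewrite mul0r.
have [cl|cl] := boolP (c \in l); first exact: gl.
rewrite /v1 gnl //; last by rewrite bc4.
case: dfix => [e|[_ [_ <-]]]; last by rewrite dc negK.
by move: bc; rewrite -(negK c) -dc e negK /root eqxx.
Qed.

(** After all coordinates outside of the pair of b are cleared, the form of v
    is the product of its coordinates at b and at the negative of b; as v is
    singular, the latter vanishes. *)
Lemma clear_vec v b : Qplus v = 0 -> co v b != 0 ->
  exists g, [/\ Im g, v *m g = co v b *: bv b, bv (neg b) *m g = bv (neg b) &
    forall d, root b d -> co v d = 0 -> co v (neg d) = 0 -> bv d *m g = bv d].
Proof.
move=> Qv vb; pose l := enum [pred d | root b d].
have [|g [Ig gl gnl gfix]] := @clear_coords v b l vb; first by apply/allP => d; rewrite mem_enum.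
exists g; split=> // [||d bd vd vnd]; last 1 first.
- by apply: gfix; right.
- have vg : v *m g = co v b *: bv b + co (v *m g) (neg b) *: bv (neg b).
    apply/vecP => d; rewrite !coE.
    have [bd|nbd] := boolP (root b d).
      rewrite gl ?mem_enum //.
      by case/root_neqs: bd => -> _ _ bd; rewrite (eq_sym (neg b)) bd !mulr0 addr0.
    move: nbd; rewrite rootE negb_and !negbK => /orP[] /eqP e.
      rewrite -e eqxx neg_neq mulr1 mulr0 addr0 gnl //; last by rewrite neq_neg.
      by rewrite mem_enum inE /root eqxx.
    by rewrite -[d]negK -e eqxx neq_neg mulr0 mulr1 add0r.
  move: vg; set y := co _ (neg b) => vg.
  suff y0 : y = 0 by rewrite vg y0 scale0r addr0.
  have := og_Q g v; rewrite Qv vg QplusD !QplusZ !Qplus_bv !mulr0 !add0r.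
  rewrite !bilE negK eqxx mulr1 => /eqP.
  by rewrite mulf_eq0 (negPf vb) ?orbF => /eqP.
by apply: gfix; left.
Qed.

Definition fixes (k : nat) g := forall d, (d.1 < k)%N -> bv d *m g = bv d.

Lemma fixesM k g h : fixes k g -> fixes k h -> fixes k (g * h)%g.
Proof. by move=> gf hf d dk; rewrite vmulM gf // hf. Qed.

Lemma fixes_co k g d e : fixes k g -> (d.1 < k)%N -> e.1 != d.1 ->
  co (bv e *m g) d = 0.
Proof.
move=> gf dk ed; rewrite -[d]negK -bil_bvr -(gf (neg d)) // og_bil bil_bv negK.
by have [e'|//] := eqVneq e d; rewrite e' eqxx in ed.
Qed.

(** Once g maps e_k to a multiple of itself, a diagonal matrix makes the
    multiple 1. Then the image of f_k has coordinate 1 at f_k, and clearing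
    with this pivot fixes e_k and the earlier pairs. *)
Lemma complete_pair g (k : 'I_n) t : fixes k g -> t != 0 ->
    bv (k, false) *m g = t *: bv (k, false) ->
  exists2 h, Im h & fixes k.+1 (g * h)%g.
Proof.
move=> gf t0 gk; pose a : sidx n := (k, false).
pose g1 := (g * torus_og k t)%g.
have g1k : bv a *m g1 = bv a.
  rewrite vmulM gk -scalemxAl (torus_og_mono k t0) scalerA /torus_co /= eqxx mulfV //.
  exact: scale1r.
have g1f : fixes k g1.
  apply: fixesM => // d dk; rewrite (torus_og_mono k t0) /torus_co.
  by case: eqP dk => [->|_ _]; rewrite ?ltnn // scale1r.
have w1 : co (bv (neg a) *m g1) (neg a) = 1.
  by rewrite -bil_bvr -{1}g1k og_bil bil_bv eqxx.
have [||h [Ih ha hna hf]] := @clear_vec (bv (neg a) *m g1) (neg a).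
- by rewrite og_Q Qplus_bv.
- by rewrite w1 oner_eq0.
exists (torus_og k t * h)%g; first exact/ImM/Ih/ImD.
rewrite mulgA -/g1 => d; rewrite ltnS leq_eqVlt => /orP[/eqP dk|dk].
  have {dk} -> : d = (k, d.2) by case: d dk => i z /= /val_inj ->.
  case: (d.2); rewrite vmulM; first by rewrite ha w1 scale1r.
  by rewrite -/a g1k -[a]negK.
rewrite vmulM g1f //.
have kd : k != d.1 by apply: contraTneq dk => <-; rewrite ltnn.
by apply: hf => //=; apply: (fixes_co g1f).
Qed.

Lemma pivot g (k : 'I_n) : fixes k g ->
  exists h, [/\ Im h, fixes k h & exists b t,
    [/\ (k <= b.1)%N, t != 0 & bv (k, false) *m (g * h)%g = t *: bv b]].
Proof.
move=> gf; pose v := bv (k, false) *m g.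
have [b vb] : exists b, co v b != 0.
  apply: contrapT => no; have : v = 0.
    apply/vecP => b; rewrite co0; apply/eqP; apply: contrapT => /negP vb.
    by apply: no; exists b.
  move/(congr1 (fun x => co (x *m g^-1%g) (k, false))); rewrite /v vmulK mul0mx.
  by rewrite !coE eqxx => /eqP; rewrite oner_eq0.
have kb : (k <= b.1)%N.
  rewrite leqNgt; apply: contra vb => bk; apply/eqP; apply: (fixes_co gf bk) => /=.
  by apply: contraTneq bk => <-; rewrite ltnn.
have [|//|h [Ih hb hnb hf]] := @clear_vec v b; first by rewrite og_Q Qplus_bv.
exists h; split=> //; last by exists b, (co v b); rewrite vmulM.
move=> d dk; apply: hf; first by rewrite /root neq_ltn (leq_trans dk kb) orbT.
  by apply: (fixes_co gf dk); rewrite /= neq_ltn dk orbT.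
by apply: (fixes_co (d := neg d) gf dk); rewrite /= neq_ltn dk orbT.
Qed.

(** The image of e_k is brought to a multiple of a basis vector e_b, and then
    to e_k by a transposition and, if necessary, the sign change of the pairs
    k and k + 1. The latter exists only while k is not the last index. *)
Lemma eliminate k : (k < n)%N -> forall g, exists2 h, Im h & fixes k (g * h)%g.
Proof.
elim: k => [|k IHk] kn g; first by exists 1%g.
have [h1 Ih1 f1] := IHk (ltnW kn) g.
pose i := Ordinal (ltnW kn); pose i' := Ordinal kn.
have [h2 [Ih2 f2 [b [t [kb t0 gb]]]]] := @pivot _ i f1.
have ii' : i != i' by rewrite -val_eqE /= ltn_eqF.
pose z := b.2; pose h3 := (perm_og F (tperm b.1 i) * (if z then flip_og F [set i; i'] else 1))%g.
have Ih3 : Im h3 by apply: ImM => //; case: (z); [exact: ImE|exact: Im1].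
have f3 : fixes i h3.
  move=> d dk; rewrite vmulM perm_og_mono /unit_co scale1r /perm_ix.
  have -> : tperm b.1 i d.1 = d.1.
    by rewrite tpermD // neq_ltn ?dk ?(leq_trans dk kb) orbT.
  case: (z); last by rewrite vmul1 -surjective_pairing.
  rewrite flip_og_mono /unit_co scale1r /flip_ix !inE /=.
  have -> : d.1 == i = false by apply: contraTF dk => /eqP ->; rewrite ltnn.
  have -> : d.1 == i' = false.
    by apply: contraTF dk => /eqP ->; rewrite -leqNgt /= leqW.
  by rewrite addbF -surjective_pairing.
have e3 : bv b *m h3 = bv (i, false).
  rewrite vmulM perm_og_mono /unit_co scale1r /perm_ix tpermL -/z; case: (z); last by rewrite vmul1.
  by rewrite flip_og_mono /unit_co scale1r /flip_ix !inE /= eqxx.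
have [||h4 Ih4 f4] := @complete_pair (g * h1 * h2 * h3)%g i t _ t0.
- exact: fixesM (fixesM f1 f2) f3.
- by rewrite vmulM gb -scalemxAl e3.
exists (h1 * h2 * h3 * h4)%g; first exact: (ImM (ImM (ImM Ih1 Ih2) Ih3) Ih4).
by move: f4; rewrite -!mulgA.
Qed.

Hypothesis Im_even : forall g, Im g -> even_og g.

Lemma fixes_all g : fixes n g -> g = 1%g.
Proof. by move=> gf; apply: og_bvP => d; rewrite gf // vmul1. Qed.

(** Elimination may end with a sign change of the last pair. This is a
    reflection, so it would make the Dickson invariant of g nonzero. *)
Lemma dickson_kernel_sub g : dickson (omx g) = false -> Im g.
Proof.
move=> gd; have n0 : (0 < n)%N by exact: leq_trans n_gt2.
have kn : (n.-1 < n)%N by rewrite prednK.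
pose k := Ordinal kn.
have [h1 Ih1 f1] := eliminate kn g.
have [h2 [Ih2 f2 [b [t [kb t0 gb]]]]] := @pivot _ k f1.
have bk : b.1 = k.
  by apply: val_inj; apply/eqP; rewrite eqn_leq kb andbT -ltnS /= prednK.
have f12 : fixes k (g * h1 * h2)%g := fixesM f1 f2.
case ez: b.2.
  have fE : fixes k (flip_og F [set k]).
    move=> d dk; rewrite flip_og_mono /unit_co scale1r /flip_ix inE.
    have -> : d.1 == k = false by apply: contraTF dk => /eqP ->; rewrite ltnn.
    by rewrite addbF -surjective_pairing.
  have [||h4 Ih4 f4] := @complete_pair (g * h1 * h2 * flip_og F [set k])%g k t _ t0.
  - exact: fixesM.
  - rewrite vmulM gb -scalemxAl flip_og_mono /unit_co scale1r /flip_ix bk ez.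
    by rewrite inE eqxx.
  move: f4; rewrite prednK // => /fixes_all e.
  have := even_dickson (@even1 n F); rewrite -e Im_even // dickson_flip1 //.
  by rewrite !Im_even // gd.
have [|h4 Ih4] := @complete_pair (g * h1 * h2)%g k t f12 t0.
  by rewrite gb; case: (b) bk ez => i z /= -> ->.
rewrite prednK // => /fixes_all e.
have -> : g = (h1 * h2 * h4)^-1%g.
  by apply/eqP; rewrite -mulg_eq1 !mulgA; apply/eqP.
by apply/ImV/ImM => //; exact: ImM.
Qed.

End Elimination.

(** * The matrices satisfy the relations *)

Definition idx0 n (n_gt2 : 2 < n) : 'I_n := Ordinal (ltnW (ltnW n_gt2)).
Definition idx1 n (n_gt2 : 2 < n) : 'I_n := Ordinal (ltnW n_gt2).
Definition idx2 n (n_gt2 : 2 < n) : 'I_n := Ordinal n_gt2.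

Section RelationsHold.
Local Open Scope ring_scope.
Variables (n : nat) (F : finFieldType).
Hypothesis n_gt2 : (2 < n)%N.
Hypothesis pchar2 : 2%N \in [pchar F].
Variable omega : {unit F}.
Notation vec := 'rV[F]_(n + n).
Notation bv := (@bv n F).
Notation og := (ogroup n F).
Implicit Types (a b d e : sidx n) (v x y : vec) (t u : F) (g h : og).
Implicit Types (i j : 'I_n) (s : {perm 'I_n}) (A : {set 'I_n}).

Local Notation i0 := (idx0 n_gt2).
Local Notation i1 := (idx1 n_gt2).
Local Notation i2 := (idx2 n_gt2).
Local Notation u_ := (tperm i0 i1).
Local Notation v_ := (perm (@ordS_inj n)).
Local Notation om := (FinRing.uval omega).

Definition og_gen (l : Om_letter) : og :=
  match l with
  | Om_sigma => X (i0, false) (i1, false) 1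
  | Om_delta => torus_og i0 om
  | Om_Z => flip_og F [set i0; i1]
  | Om_U => perm_og F u_
  | Om_V => perm_og F v_
  end.

Lemma om_neq0 : om != 0.
Proof. by rewrite -unitfE; exact: (valP omega). Qed.

Lemma cycleE i : v_ i = (i.+1 %% n)%N :> nat.
Proof. by rewrite permE. Qed.

Lemma cycle0 : v_ i0 = i1.
Proof. by apply: val_inj; rewrite /= cycleE modn_small // ltnW. Qed.
Lemma cycle1 : v_ i1 = i2.
Proof. by apply: val_inj; rewrite /= cycleE modn_small. Qed.
Lemma cycle2 : (3 < n)%N -> v_ i2 = 3%N :> nat.
Proof. by move=> n3; rewrite cycleE modn_small. Qed.

Lemma cycle2_neq : (3 < n)%N ->
  [/\ (i0 == v_ i2) = false, (i1 == v_ i2) = false & (i2 == v_ i2) = false].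
Proof. by move=> n3; rewrite -!val_eqE /= cycle2. Qed.

Lemma transp_cycle : (u_ ^ v_)%g = tperm i1 i2.
Proof. by rewrite /u_ tpermJ cycle0 cycle1. Qed.

Lemma transp_cycle2 : (u_ ^ (v_ ^+ 2))%g = tperm i2 (v_ i2).
Proof. by rewrite expg2 conjgM transp_cycle tpermJ cycle1. Qed.

Lemma ne01 : (i0 == i1) = false. Proof. by []. Qed.
Lemma ne02 : (i0 == i2) = false. Proof. by []. Qed.
Lemma ne12 : (i1 == i2) = false. Proof. by []. Qed.
Lemma ne10 : (i1 == i0) = false. Proof. by []. Qed.
Lemma ne20 : (i2 == i0) = false. Proof. by []. Qed.
Lemma ne21 : (i2 == i1) = false. Proof. by []. Qed.

Lemma cycle_transp0 : (v_ * u_)%g i0 = i0.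
Proof. by rewrite permM cycle0 tpermR. Qed.
Lemma cycle_transp1 : (v_ * u_)%g i1 = i2.
Proof. by rewrite permM cycle1 tpermD. Qed.
Lemma long_cycle0 : (v_ * u_ * u_ ^ v_)%g i0 = i0.
Proof. by rewrite permM cycle_transp0 transp_cycle tpermD. Qed.
Lemma long_cycle1 : (v_ * u_ * u_ ^ v_)%g i1 = i1.
Proof. by rewrite permM cycle_transp1 transp_cycle tpermR. Qed.

Lemma transp23_fix : (3 < n)%N ->
  (u_ ^ (v_ ^+ 2))%g i0 = i0 /\ (u_ ^ (v_ ^+ 2))%g i1 = i1.
Proof.
move=> n3; rewrite transp_cycle2.
by split; rewrite tpermD // -val_eqE /= cycle2.
Qed.

Lemma imset2 s i j : s @: [set i; j] = [set s i; s j].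
Proof. by rewrite imsetU !imset_set1. Qed.

Lemma perm_ogX s m : perm_og F (s ^+ m)%g = (perm_og F s ^+ m)%g.
Proof. by elim: m => [|m IHm]; rewrite ?expg0 ?perm_og1 // !expgS perm_ogM IHm. Qed.

Lemma comm_conj (G : groupType) (x y : G) : (x ^ y)%g = x -> [~ x, y]%g = 1%g.
Proof. by move=> xy; apply/eqP; rewrite -conjg_fix xy. Qed.

Lemma comm_commute (G : groupType) (x y : G) : commute x y -> [~ x, y]%g = 1%g.
Proof. by move=> /commgP/eqP. Qed.

Lemma X_comm_orth a b t u : root a b -> commute (X a b t : og) (X a (neg b) u).
Proof.
move=> ab; have anb : root a (neg b) by [].
have [e1 e2 e3 e4] := root_neqs ab.
apply: og_vecP => v; rewrite !vmulM !(actX pchar2) // !negK.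
apply/vecP => c; rewrite !coE !eq_neg ?eq_negl ?neq_neg ?neg_neq ?e1 ?e2 ?e3 ?e4 ?eqxx /=; ring.
Qed.

Lemma ZJP s : (flip_og F [set i0; i1] ^ perm_og F s)%g = flip_og F [set s i0; s i1].
Proof. by rewrite flip_ogJ imset2. Qed.

Lemma XJPe i j t s : i != j ->
  (X (i, false) (j, false) t ^ perm_og F s)%g = X (s i, false) (s j, false) t.
Proof. by move=> ij; rewrite XJP. Qed.

(** ** The embedded special linear group *)

Local Notation jj k := (if k == 0 then i0 else i1).
Local Notation Emx := (\matrix_(k < 2) bv (jj k, false)).
Local Notation Fmx := (\matrix_(k < 2) bv (jj k, true)).

(** A matrix of degree 2 acts on the span of e_1 and e_2, and contragrediently
    on the span of f_1 and f_2. *)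
Definition levi_rep (M : 'M[F]_2) h :=
  [/\ Emx *m h = M *m Emx, M^T *m Fmx *m h = Fmx &
      forall d, d.1 != i0 -> d.1 != i1 -> bv d *m h = bv d].

Lemma levi_rep1 : levi_rep 1%:M 1%g.
Proof. by split=> [||d _ _]; rewrite ?trmx1 ?mul1mx ?mulmx1. Qed.

Lemma levi_repM M N g h : levi_rep M g -> levi_rep N h -> levi_rep (M *m N) (g * h)%g.
Proof.
move=> [Mg Fg fg] [Nh Fh fh]; rewrite /levi_rep omxM; split.
- by rewrite mulmxA Mg -!mulmxA Nh.
- by rewrite trmx_mul mulmxA -(mulmxA _ _ Fmx) -(mulmxA _ _ g) Fg.
by move=> d d0 d1; rewrite mulmxA fg // fh.
Qed.

Lemma levi_repV M g : M \in unitmx -> levi_rep M g -> levi_rep (invmx M) g^-1%g.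
Proof.
move=> uM [Mg Fg fg]; split.
- rewrite -{1}(mulKmx uM Emx) -Mg -!mulmxA -omxM mulgV.
  by rewrite mulmx1.
- rewrite -{1}Fg trmx_inv -!mulmxA -omxM mulgV mulmx1 mulKmx //.
  by rewrite unitmx_tr.
by move=> d d0 d1; rewrite -{1}(fg d) // vmulK.
Qed.

Lemma levi_rep_eq1 g : levi_rep 1%:M g -> g = 1%g.
Proof.
move=> [Mg Fg fg]; apply: og_bvP => -[i z]; rewrite vmul1.
have [i0E|/= ni0] := eqVneq i i0; last have [i1E|ni1] := eqVneq i i1.
- rewrite i0E; case: z.
    by have := congr1 (row 0) Fg; rewrite trmx1 mul1mx row_mul rowK.
  by have := congr1 (row 0) Mg; rewrite mul1mx row_mul rowK.
- rewrite i1E; case: z.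
    by have := congr1 (row 1) Fg; rewrite trmx1 mul1mx row_mul rowK.
  by have := congr1 (row 1) Mg; rewrite mul1mx row_mul rowK.
exact: fg.
Qed.

Lemma levi_rep1_eq (M : 'M[F]_2) : levi_rep M 1%g -> M = 1%:M.
Proof.
case=> + _ _; rewrite mulmx1 => EM.
have rowE2 k l : co (row k Emx) (jj l, false) = (k == l)%:R.
  rewrite rowK co_bv xpair_eqE andbT.
  by case: k l => [[|[|k]] ?] [[|[|l]] ?].
apply/matrixP => k l; rewrite !mxE -rowE2 EM row_mul mulmx_sum_row co_sum.
under eq_bigr do rewrite coZ rowE2.
rewrite (bigD1 l) //= eqxx mulr1 big1 ?addr0 ?mxE // => j /negPf->.
by rewrite mulr0.
Qed.

Lemma levi_rep_sl2 (M : 'M[F]_2) g :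
    (forall k, bv (jj k, false) *m g = M k 0 *: bv (i0, false) + M k 1 *: bv (i1, false)) ->
    (forall k, M 0 k *: (bv (i0, true) *m g) + M 1 k *: (bv (i1, true) *m g) = bv (jj k, true)) ->
    (forall d, d.1 != i0 -> d.1 != i1 -> bv d *m g = bv d) ->
  levi_rep M g.
Proof.
have sum2 (f : 'I_2 -> vec) : \sum_k f k = f 0 + f 1.
  by rewrite !big_ord_recl big_ord0 addr0; congr (_ + f _); apply: val_inj.
move=> gact gF gfix; split=> //; apply/row_matrixP => k; rewrite !row_mul !rowK.
  by rewrite gact mulmx_sum_row sum2 !rowK !mxE.
rewrite (mulmx_sum_row (row k M^T)) sum2 mulmxDl !rowK !mxE -!scalemxAl.
exact: gF.
Qed.

Definition og_SL2 (l : SL2_letter) : og :=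
  match l with
  | SL2_sigma => og_gen Om_sigma
  | SL2_Delta => [~ og_gen Om_U, og_gen Om_delta]
  | SL2_U => og_gen Om_U
  end.

Lemma og_Delta : og_SL2 SL2_Delta = (torus_og i1 om^-1%R * torus_og i0 om)%g.
Proof.
have om0 := om_neq0.
by rewrite /= commgEr torus_ogV // torus_ogJP ?invr_eq0 // tpermL.
Qed.

Lemma levi_rep_gen l : levi_rep (SL2_mx omega l) (og_SL2 l).
Proof.
have om0 := om_neq0.
apply: levi_rep_sl2.
- move=> k; case: l.
  + rewrite actX //= !mxE /=; apply/vecP => c; rewrite !coE /neg /=.
    by case: (k == 0); rewrite ?xpair_eqE ?eqxx ?ne10 ?ne01 /=; ring.
  + rewrite og_Delta vmulM !torus_og_mono ?invr_eq0 // -scalemxAl torus_og_mono // !mxE /torus_co /=.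
    by case: (k == 0); rewrite ?eqxx ?ne10 ?ne01 ?invrK !scale0r ?scale1r ?add0r ?addr0.
  + rewrite /= perm_og_mono /perm_ix /unit_co scale1r !mxE /=.
    by case: (k == 0); rewrite ?tpermL ?tpermR !scale0r ?scale1r ?add0r ?addr0.
- move=> k; case: l.
  + rewrite !actX //= !mxE /=; apply/vecP => c; rewrite !coE /neg /=.
    case: (k == 0); rewrite ?xpair_eqE ?eqxx ?ne10 ?ne01 /=;
      rewrite !(mulr0, mul0r, mul1r, mulr1, addr0, add0r) //.
    by rewrite addrCA (addrr2 pchar2) addr0.
  + rewrite og_Delta !vmulM !torus_og_mono ?invr_eq0 // -!scalemxAl !torus_og_mono // !mxE /torus_co /=.
    by case: (k == 0); rewrite ?eqxx ?ne10 ?ne01 ?invrK !scale0r ?scale1r ?add0r ?addr0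
       scalerA ?mulVf ?mulfV // scale1r.
  + rewrite /= !perm_og_mono /perm_ix /unit_co !scale1r !mxE /=.
    by case: (k == 0); rewrite ?tpermL ?tpermR !scale0r ?scale1r ?add0r ?addr0.
move=> d /negPf d0 /negPf d1; case: l.
+ rewrite actX // /= !coE; case: d d0 d1 => i z /= d0 d1.
  by rewrite /neg ?xpair_eqE /= d0 d1 !mulr0 !scale0r !addr0.
+ rewrite og_Delta !vmulM !torus_og_mono ?invr_eq0 // -!scalemxAl !torus_og_mono // /torus_co d0 d1.
  by rewrite !scale1r.
rewrite /= perm_og_mono /perm_ix /unit_co scale1r tpermD 1?eq_sym ?d0 ?d1 //.
Qed.

Lemma fg_eval_levi w :
  levi_rep (GLval (fg_eval (SL2_gen omega) w)) (fg_eval og_SL2 w).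
Proof.
case: w => s Hs; rewrite /fg_eval /= {Hs}.
elim: s => [|[l b] s IHs] /=; first exact: levi_rep1.
apply: levi_repM => //; case: b; last exact: levi_rep_gen.
apply: levi_repV; last exact: levi_rep_gen.
exact: (SL2_mx_unit omega l).
Qed.

Variables (R_Sn : freeGroup Sn_letter -> Prop) (R_SL2 : freeGroup SL2_letter -> Prop).
Hypothesis R_Sn_ok : forall r, R_Sn r -> fg_eval (Sn_gen n_gt2) r = 1%g.
Hypothesis R_SL2_ok : forall r, R_SL2 r -> fg_eval (SL2_gen omega) r = 1%g.

(** Each relation is checked on the images of the basis vectors: conjugation
    acts on permutations, sign changes, diagonal matrices and root elements
    through the signed indices. The relations of S_n and of SL(2,q) hold
    because permutation matrices and the maps of [levi_rep] are
    representations. *)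
Lemma relators_og r : relators n #|F| R_Sn R_SL2 r -> fg_eval og_gen r = 1%g.
Proof.
have om0 := om_neq0.
have XT : X (i0, false) (i1, false) 1 = og_gen Om_sigma by [].
case=> {r}.
- move=> r /R_Sn_ok r1.
  pose h l := perm_og F (Sn_gen n_gt2 l).
  rewrite (@fg_eval_morph _ _ _ (fg_eval og_gen) _ h).
  + rewrite -(@fg_eval_morph _ _ _ (perm_og F) (Sn_gen n_gt2)) ?r1 ?perm_og1 //.
    exact: perm_ogM.
  + exact: fg_evalM.
  + by case; rewrite fg_eval_gen.
- move=> n3; rewrite !fg_evalE /= -perm_ogX perm_ogJ; apply: comm_conj.
  by rewrite ZJP; have [-> ->] := transp23_fix n3.
- move=> n4; rewrite !fg_evalE /= perm_ogJ -!perm_ogM; apply: comm_conj.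
  by rewrite ZJP long_cycle0 long_cycle1.
- by rewrite !fg_evalE expg2 flip_ogE.
- by move=> n3; rewrite !fg_evalE /= -perm_ogX ZJP; apply/comm_commute/flip_ogC.
- rewrite !fg_evalE /= perm_ogJ !ZJP cycle0 cycle1 transp_cycle tpermL tpermD // flip_ogM.
  apply/eqP; rewrite divg_eq1; apply/eqP; congr flip_og; apply/setP => i.
  rewrite !inE; have [->|] := eqVneq i i1; first by rewrite ne10 ne12.
  by rewrite orbF /= => i1'; have [->|] := eqVneq i i0; rewrite ?ne02.
- rewrite !fg_evalE /=; apply: comm_conj.
  by rewrite ZJP tpermL tpermR setUC.
- by rewrite !fg_evalE /= ZJP; apply/comm_commute/flip_ogC.
- rewrite !fg_evalE /= perm_ogJ transp_cycle; apply: comm_conj.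
  by rewrite torus_ogJP // tpermD.
- move=> n3; rewrite !fg_evalE /= -perm_ogM; apply: comm_conj.
  by rewrite torus_ogJP // cycle_transp0.
- by rewrite !fg_evalE /= torus_ogJP //; apply/comm_commute/torus_ogC.
- rewrite !fg_evalE /= torus_ogX // -[om ^+ _]mulr1 -[X in _ * X](mulfV om0) mulrA -exprSr.
  by rewrite subn1 prednK ?expf_card ?mulfV ?torus_og1 // (cardD1 0) inE.
- by rewrite !fg_evalE /= torus_ogJE // !inE eqxx invgK torus_ogM ?invr_eq0 // mulVf // torus_og1.
- rewrite !fg_evalE /= ZJP cycle0 cycle1; apply: comm_conj.
  by rewrite torus_ogJE // !inE ne01 ne02.
- move=> n3; rewrite !fg_evalE /= -perm_ogX perm_ogJ; apply: comm_conj.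
  by rewrite XJPe //; have [-> ->] := transp23_fix n3.
- move=> n4; rewrite !fg_evalE /= perm_ogJ -!perm_ogM; apply: comm_conj.
  by rewrite XJPe // long_cycle0 long_cycle1.
- move=> n3; rewrite !fg_evalE /= -perm_ogX ZJP expg2 !permM cycle0 cycle1.
  apply: comm_conj; rewrite XJE // /flip_ix /= !inE ne02 ne12.
  by rewrite -!val_eqE /= cycle2.
- rewrite !fg_evalE /= -perm_ogX torus_ogJP // expg2 permM cycle0 cycle1.
  apply: comm_conj; rewrite XJD // /torus_co /= ?ne02 ?ne12.
  by rewrite invr1 !mul1r.
- rewrite !fg_evalE /=; apply: comm_conj.
  rewrite conjgM XJE // /flip_ix /= !inE !eqxx ne10 ne01 /= XJP // /perm_ix /= tpermL tpermR.
  by rewrite -XN.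
- rewrite !fg_evalE /= torus_ogJP // tpermL; apply: comm_conj.
  rewrite conjgM XJD // XJD // /torus_co /= ?ne01 ?ne10 ?eqxx /= invr1 invrK.
  by rewrite !mulr1 mul1r mulVf.
- move=> r /R_SL2_ok r1; rewrite (@fg_eval_morph _ _ _ (fg_eval og_gen) _ og_SL2).
  + by apply: levi_rep_eq1; have := fg_eval_levi r; rewrite r1.
  + exact: fg_evalM.
  + by case; rewrite !fg_evalE.
- rewrite !fg_evalE /= -perm_ogM !XJPe // cycle0 cycle1 cycle_transp0 cycle_transp1.
  apply/eqP; rewrite divg_eq1; apply/eqP.
  apply: (mulgI (X (i1, false) (i2, false) 1%R * X (i0, false) (i1, false) 1%R)%g).
  by rewrite -commgC X_chevalley // mul1r.
- rewrite !fg_evalE /= -perm_ogM XJPe // cycle_transp0 cycle_transp1.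
  by apply/comm_commute/X_comm.
- rewrite !fg_evalE /= -perm_ogM perm_ogJ tpermJ cycle_transp0 cycle_transp1 XJPe // tpermL tpermD //.
  by apply/comm_commute/X_comm.
- move=> n3; rewrite !fg_evalE /= -perm_ogX XJPe // expg2 !permM cycle0 cycle1.
  have [e0 e1 e2] := cycle2_neq n3.
  by apply/comm_commute/X_comm; rewrite // /root /neg ?xpair_eqE /= ?e0 ?e1 ?e2.
- rewrite !fg_evalE /= ZJP cycle0 cycle1 XJE // /flip_ix /= !inE ne01 ne02 eqxx /=.
  by apply/comm_commute/X_comm_orth.
move=> n4; have n3 : (3 < n)%N by rewrite n4.
rewrite !fg_evalE /= -perm_ogX ZJP cycle0 cycle1 conjgM XJE // /flip_ix /= !inE ne01 ne02 eqxx /=.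
rewrite XJP // /perm_ix /= expg2 !permM cycle0 cycle1.
have [e0 e1 e2] := cycle2_neq n3.
  by apply/comm_commute/X_comm; rewrite // /root /neg ?xpair_eqE /= ?e0 ?e1 ?e2.
Qed.

End RelationsHold.

(** * The monomial subgroup of the presented group *)

Section CommutingFamily.
Variables (n : nat) (G : groupType) (f : 'I_n -> G).
Hypothesis fC : forall i j, commute (f i) (f j).

(** A product of powers of a commuting family, with exponents in nat: both
    delta and the sign changes have finite order, so negative exponents do not
    occur. *)
Definition powprod (k : 'I_n -> nat) : G := \prod_(i < n) f i ^+ k i.

Lemma powprodM k k' : powprod k * powprod k' = powprod (fun i => (k i + k' i)%N).
Proof.
rewrite /powprod -prodgM_commute; last by move=> i j *; exact/commuteX2/fC.
by apply: eq_bigr => i _; rewrite expgnDr.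
Qed.

Lemma eq_powprod k k' : (forall i, f i ^+ k i = f i ^+ k' i) -> powprod k = powprod k'.
Proof. by move=> kk; apply: eq_bigr. Qed.

Lemma powprod1 k : (forall i, f i ^+ k i = 1) -> powprod k = 1.
Proof. by move=> k1; apply: big1. Qed.

Lemma powprod_single j m : powprod (fun i => if i == j then m else 0%N) = f j ^+ m.
Proof.
rewrite /powprod -[RHS](big_pred1_eq *%g j (fun i => f i ^+ m)) [RHS]big_mkcond.
by apply: eq_bigr => i _; case: ifP.
Qed.

End CommutingFamily.

Section Generated.
Variable G : groupType.

(** Products of elements of S, without inverses; in the cases below the
    inverses of elements of S are products again, and induction only has to
    follow multiplication on the right. *)
Inductive gen (S : G -> Prop) : G -> Prop :=
| gen1 : gen S 1
| genMr x y of gen S x & S y : gen S (x * y).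

Lemma gen_in (S : G -> Prop) x : S x -> gen S x.
Proof. by move=> Sx; rewrite -[x]mul1g; apply: genMr => //; exact: gen1. Qed.

Lemma genM (S : G -> Prop) x y : gen S x -> gen S y -> gen S (x * y).
Proof.
move=> gx; elim=> [|y' z gy IHy Sz]; first by rewrite mulg1.
by rewrite mulgA; apply: genMr.
Qed.

Lemma genV (S : G -> Prop) : (forall x, S x -> gen S x^-1) ->
  forall x, gen S x -> gen S x^-1.
Proof.
move=> SV x; elim=> [|y z gy IHy Sz]; first by rewrite invg1; exact: gen1.
by rewrite invgM; apply: genM => //; exact: SV.
Qed.

Lemma genX (S : G -> Prop) x m : gen S x -> gen S (x ^+ m).
Proof.
by move=> gx; elim: m => [|m IHm]; rewrite ?expg0 ?expgS; [exact: gen1 | exact: genM].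
Qed.

Lemma gen_sub (S T : G -> Prop) :
  (forall x, S x -> gen T x) -> forall x, gen S x -> gen T x.
Proof.
move=> ST x; elim=> [|y z _ IHy /ST Tz]; [exact: gen1 | exact: genM].
Qed.

End Generated.

Section PermWitnesses.
Variables (n : nat) (n_gt2 : 2 < n).
Local Notation i0 := (idx0 n_gt2).
Local Notation i1 := (idx1 n_gt2).
Local Notation i2 := (idx2 n_gt2).

Lemma perm2_ex (i j : 'I_n) : i != j ->
  exists s : {perm 'I_n}, s i0 = i /\ s i1 = j.
Proof.
move=> ij; exists (tperm i0 i * tperm (tperm i0 i i1) j); rewrite !permM tpermL tpermL.
split=> //; apply: tpermD; last by rewrite eq_sym.
by rewrite -{2}[i](tpermL i0 i) (inj_eq perm_inj).
Qed.

Lemma perm3_ex (i j k : 'I_n) : i != j -> i != k -> j != k ->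
  exists s : {perm 'I_n}, [/\ s i0 = i, s i1 = j & s i2 = k].
Proof.
move=> ij ik jk; have [s [si sj]] := perm2_ex ij.
exists (s * tperm (s i2) k); rewrite !permM tpermL.
by split=> //; rewrite tpermD ?si ?sj 1?eq_sym // -?si -?sj (inj_eq perm_inj).
Qed.

Lemma perm_fix01_ex (i j k : 'I_n) : i2 < k -> 1 < i -> 1 < j -> i != j ->
  exists s : {perm 'I_n}, [/\ s i0 = i0, s i1 = i1, s i2 = i & s k = j].
Proof.
move=> k2 igt jgt ij.
have ne (x : 'I_n) : 1 < x -> (x != i0) && (x != i1).
  by rewrite -!val_eqE /=; case: (val x) => [|[]].
have fixk (x y : 'I_n) : 1 < x -> 1 < y -> tperm x y i0 = i0 /\ tperm x y i1 = i1.
  move=> /ne/andP[x0 x1] /ne/andP[y0 y1].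
  by split; apply: tpermD.
have kgt : 1 < k by exact: ltn_trans k2.
pose t := tperm i2 i; have [t0 t1] : t i0 = i0 /\ t i1 = i1 by exact: fixk.
have tk : 1 < t k.
  by rewrite /t; case: tpermP => // _.
have [u0 u1] := fixk _ _ tk jgt.
exists (t * tperm (t k) j); rewrite !permM t0 t1; split=> //; last exact: tpermL.
have ti2 : t i2 = i by exact: tpermL.
rewrite ti2 tpermD 1?eq_sym //.
by rewrite -[X in X == _]ti2 (inj_eq perm_inj) -val_eqE /= ltn_eqF.
Qed.

Lemma transpE (i j : 'I_n) : i = 1%N :> nat -> j = 2 :> nat ->
  tperm i j = tperm i0 i1 ^ perm (@ordS_inj n).
Proof.
move=> e1 e2; rewrite transp_cycle.
by congr tperm; apply: val_inj.
Qed.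

Lemma cycle_transpE (i j : 'I_n) : 0 < i -> j = i.+1 :> nat ->
  (perm (@ordS_inj n) * tperm i0 i1) i = j.
Proof.
move=> i1' ij; rewrite permM.
have -> : perm (@ordS_inj n) i = j.
  by apply: val_inj; rewrite /= cycleE -ij modn_small.
by rewrite tpermD // -val_eqE /= ij; case: (val i) i1'.
Qed.

Lemma long_cycleE (i j : 'I_n) : 1 < i -> j = i.+1 :> nat ->
  (perm (@ordS_inj n) * tperm i0 i1 * tperm i0 i1 ^ perm (@ordS_inj n)) i = j.
Proof.
move=> i1' ij; rewrite permM (cycle_transpE (ltnW i1') ij) transp_cycle.
by rewrite tpermD // -val_eqE /= ij; case: (val i) i1' => [|[]].
Qed.

Lemma transp2E (i j : 'I_n) : i = 2 :> nat -> j = 3 :> nat ->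
  tperm i j = tperm i0 i1 ^ (perm (@ordS_inj n) ^+ 2).
Proof.
move=> e2 e3; have n3 : 3 < n by rewrite -e3.
rewrite transp_cycle2.
by congr tperm; apply: val_inj; rewrite /= ?cycle2.
Qed.

End PermWitnesses.

(** ** The copy of the symmetric group *)

Section MonomialSubgroup.
Variables (n : nat) (F : finFieldType).
Hypothesis n_gt2 : 2 < n.
Hypothesis pchar2 : 2%N \in [pchar F]%R.
Variable omega : {unit F}.
Hypothesis omega_prim : <[omega]> = [set: {unit F}].
Variables (R_Sn : freeGroup Sn_letter -> Prop) (R_SL2 : freeGroup SL2_letter -> Prop).
Hypothesis R_Sn_ok : presents_on R_Sn (Sn_gen n_gt2).
Variables (G : groupType) (gG : Om_letter -> G).
Hypothesis gG_rel : forall w, relators n #|F| R_Sn R_SL2 w -> fg_eval gG w = 1.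
Variable pi : G -> ogroup n F.
Hypothesis piM : forall x y, pi (x * y) = pi x * pi y.
Hypothesis pi_gen : forall l, pi (gG l) = og_gen n_gt2 omega l.
Implicit Types (s : {perm 'I_n}) (i j : 'I_n) (x y : G).

Local Notation i0 := (idx0 n_gt2).
Local Notation i1 := (idx1 n_gt2).
Local Notation i2 := (idx2 n_gt2).
Local Notation u_ := (tperm i0 i1).
Local Notation v_ := (perm (@ordS_inj n)).
Local Notation om := (FinRing.uval omega).
Local Notation sigma := (gG Om_sigma).
Local Notation delta := (gG Om_delta).
Local Notation Z := (gG Om_Z).
Local Notation U := (gG Om_U).
Local Notation V := (gG Om_V).

Lemma pi1 : pi 1 = 1.
Proof. by apply: (mulgI (pi 1)); rewrite -piM !mulg1. Qed.
Lemma piV x : pi x^-1 = (pi x)^-1.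
Proof. by apply: (mulgI (pi x)); rewrite -piM !mulgV pi1. Qed.
Lemma piX x m : pi (x ^+ m) = pi x ^+ m.
Proof. by elim: m => [|m IHm]; rewrite ?expg0 ?pi1 // !expgS piM IHm. Qed.
Lemma piJ x y : pi (x ^ y) = pi x ^ pi y.
Proof. by rewrite !conjgE !piM piV. Qed.

Let gSn (l : Sn_letter) : G := match l with Sn_U => U | Sn_V => V end.

Lemma Sn_word s : exists w, fg_eval (Sn_gen n_gt2) w = s.
Proof.
pose P s := exists w, fg_eval (Sn_gen n_gt2) w = s.
have PM s1 s2 : P s1 -> P s2 -> P (s1 * s2).
  by move=> [w1 <-] [w2 <-]; exists (w1 * w2); rewrite fg_evalM.
have PV s1 : P s1 -> P s1^-1 by move=> [w1 <-]; exists w1^-1; rewrite fg_evalV.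
have PU : P u_ by exists (fg_gen Sn_U); rewrite fg_eval_gen.
have PV' : P v_ by exists (fg_gen Sn_V); rewrite fg_eval_gen.
apply: (@perm_stab_cycle_ind n 0 P _ PM PV v_) => //.
- by exists 1.
- move=> i j ei ej; have -> : i = i0 by exact: val_inj.
  by have -> : j = i1 by exact: val_inj.
- move=> i j _ ij; apply: val_inj; rewrite /= cycleE -ij modn_small //.
Qed.

Lemma Sn_eval_eq w w' : fg_eval (Sn_gen n_gt2) w = fg_eval (Sn_gen n_gt2) w' ->
  fg_eval gSn w = fg_eval gSn w'.
Proof.
move=> ww'; apply: divg1_eq; rewrite -fg_evalV -fg_evalM.
apply: (@normal_closure_eval _ R_Sn).
  move=> r Rr; have := gG_rel (rel_Sn n #|F| R_SL2 Rr).
  by rewrite (@fg_eval_morph _ _ _ (fg_eval gG) _ gSn) //; [exact: fg_evalM | case; rewrite fg_eval_gen].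
by apply/R_Sn_ok; rewrite fg_evalM fg_evalV ww' mulgV.
Qed.

(** The homomorphism from S_n to G with (1,2) and (1,2,...,n) mapped to U and
    V; it is well defined because R_Sn presents S_n. *)
Definition PS s : G := fg_eval gSn (projT1 (cid (Sn_word s))).

Lemma PSE w : PS (fg_eval (Sn_gen n_gt2) w) = fg_eval gSn w.
Proof. by apply: Sn_eval_eq; rewrite /PS; case: cid. Qed.

Lemma PSM s s' : PS (s * s') = PS s * PS s'.
Proof.
have [w <-] := Sn_word s; have [w' <-] := Sn_word s'.
by rewrite -fg_evalM !PSE fg_evalM.
Qed.
Lemma PS1 : PS 1 = 1.
Proof. by rewrite -(fg_eval1 (Sn_gen n_gt2)) PSE. Qed.
Lemma PSV s : PS s^-1 = (PS s)^-1.
Proof. by apply: (mulgI (PS s)); rewrite -PSM !mulgV PS1. Qed.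
Lemma PSX s m : PS (s ^+ m) = PS s ^+ m.
Proof. by elim: m => [|m IHm]; rewrite ?expg0 ?PS1 // !expgS PSM IHm. Qed.
Lemma PSJ s s' : PS (s ^ s') = PS s ^ PS s'.
Proof. by rewrite !conjgE !PSM PSV. Qed.
Lemma PS_U : PS u_ = U.
Proof. by rewrite -[u_](fg_eval_gen (Sn_gen n_gt2) Sn_U) PSE fg_eval_gen. Qed.
Lemma PS_V : PS v_ = V.
Proof. by rewrite -[v_](fg_eval_gen (Sn_gen n_gt2) Sn_V) PSE fg_eval_gen. Qed.

Lemma pi_PS s : pi (PS s) = perm_og F s.
Proof.
have [w <-] := Sn_word s; rewrite PSE.
rewrite (@fg_eval_morph _ _ _ (perm_og F) (Sn_gen n_gt2) (fun l => pi (gSn l))) //.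
- by apply: fg_eval_morph.
- exact: perm_ogM.
by case=> /=; rewrite pi_gen.
Qed.

(** An element commuting with the images of the generators of a pointwise
    stabiliser is fixed by the whole stabiliser; the relations give these
    commutations for delta, Z and sigma. *)
Lemma PS_fix_stab (x : G) :
    [~ x, U ^ V] = 1 -> (3 < n -> [~ x, V * U] = 1) ->
  forall s, s i0 = i0 -> x ^ PS s = x.
Proof.
move=> xU xV s s0.
apply: (@perm_stab_cycle_ind n 1 (fun s => x ^ PS s = x) _ _ _ (v_ * u_)).
- by rewrite PS1 conjg1.
- by move=> s1 s2 e1 e2; rewrite PSM conjgM e1.
- by move=> s1 e1; rewrite PSV -{1}e1 conjgK.
- move=> i j ei ej /=; rewrite (transpE n_gt2 ei ej) PSJ PS_U PS_V.
  by apply/eqP; rewrite conjg_fix xU.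
- by move=> n3 /=; rewrite PSM PS_U PS_V; apply/eqP; rewrite conjg_fix xV.
- by move=> i j; exact: cycle_transpE.
by move=> i; rewrite ltnS leqn0 => /eqP ei; have -> : i = i0 by exact: val_inj.
Qed.

Lemma PS_fix_stab2 (x : G) :
    (3 < n -> [~ x, U ^ (V ^+ 2)] = 1) -> (4 < n -> [~ x, V * U * U ^ V] = 1) ->
  forall s, s i0 = i0 -> s i1 = i1 -> x ^ PS s = x.
Proof.
move=> xU xV s s0 s1.
apply: (@perm_stab_cycle_ind n 2 (fun s => x ^ PS s = x) _ _ _ (v_ * u_ * u_ ^ v_)).
- by rewrite PS1 conjg1.
- by move=> s' s2 e1 e2; rewrite PSM conjgM e1.
- by move=> s' e1; rewrite PSV -{1}e1 conjgK.
- move=> i j ei ej /=; rewrite (transp2E n_gt2 ei ej) PSJ PSX PS_U PS_V.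
  by apply/eqP; rewrite conjg_fix xU // -ej.
- by move=> n4 /=; rewrite PSM PSM PSJ PS_U PS_V; apply/eqP; rewrite conjg_fix xV.
- by move=> i j; exact: long_cycleE.
case=> [[|[|i]] ilt] //= _.
  by have -> : Ordinal ilt = i0 by exact: val_inj.
by have -> : Ordinal ilt = i1 by exact: val_inj.
Qed.

(** ** The torus *)

Definition delta_at i : G := delta ^ PS (tperm i0 i).

(** The relations [delta, U^V] = 1 and [delta, V U] = 1 say that delta
    commutes with generators of the stabiliser of the first index, so its
    conjugate by s depends only on the image of this index. *)
Lemma delta_atP s : delta ^ PS s = delta_at (s i0).
Proof.
apply: (conjg_inj (PS (tperm i0 (s i0)))^-1).
rewrite /delta_at conjgK -PSV -conjgM -PSM tpermV; apply: PS_fix_stab.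
- by have := gG_rel (rel_delta_UV n #|F| R_Sn R_SL2); rewrite !fg_evalE.
- by move=> n3; have := gG_rel (rel_delta_VU #|F| R_Sn R_SL2 n3); rewrite !fg_evalE.
by rewrite permM tpermR.
Qed.

Lemma delta_atJ i s : delta_at i ^ PS s = delta_at (s i).
Proof. by rewrite /delta_at -conjgM -PSM delta_atP permM tpermL. Qed.

Lemma delta_at0 : delta_at i0 = delta.
Proof. by rewrite /delta_at tperm1 PS1 conjg1. Qed.

Lemma delta_atC i j : commute (delta_at i) (delta_at j).
Proof.
have [->|ij] := eqVneq i j; first exact: commute_refl.
have [s [<- <-]] := perm2_ex n_gt2 ij.
rewrite -!delta_atJ /commute -!conjMg; congr (_ ^ _).
have := gG_rel (rel_delta_deltaU n #|F| R_Sn R_SL2); rewrite !fg_evalE /=.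
by rewrite -PS_U -delta_at0 delta_atJ tpermL => /eqP/commgP.
Qed.

Lemma delta_at_order i : delta_at i ^+ (#|F| - 1) = 1.
Proof.
have := gG_rel (rel_delta_order n #|F| R_Sn R_SL2); rewrite !fg_evalE.
by rewrite -conjXg => ->; rewrite conj1g.
Qed.

Lemma pi_delta_at i : pi (delta_at i) = torus_og i om.
Proof. by rewrite piJ pi_PS pi_gen /= torus_ogJP ?om_neq0 // tpermL. Qed.

Lemma card_gt1 : 1 < #|F|.
Proof. by rewrite (cardD1 (1%R : F)) (cardD1 (0%R : F)) !inE eq_sym oner_eq0. Qed.

Lemma delta_atV i : (delta_at i)^-1 = delta_at i ^+ (#|F| - 2).
Proof.
apply: (mulgI (delta_at i)); rewrite mulgV -expgS -(delta_at_order i); congr (_ ^+ _).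
by have := card_gt1; lia.
Qed.

(** As omega is primitive, delta has no larger order than its matrix. *)
Lemma om_order m : (om ^+ m = 1)%R -> (#|F| - 1) %| m.
Proof.
move=> omm; have : omega ^+ m = 1.
  by apply: val_inj; rewrite FinRing.val_unitX.
move/eqP; rewrite -order_dvdn /order omega_prim card_finField_unit.
by rewrite subn1.
Qed.

Lemma delta_at_om i m : (om ^+ m = 1)%R -> delta_at i ^+ m = 1.
Proof. by move=> /om_order/dvdnP[k ->]; rewrite mulnC expgnA delta_at_order expg1n. Qed.

(** ** Even sign changes *)

(** For i distinct from the first index, the sign change of the first index and
    of i; the value at the first index makes [Z_atP] uniform. *)
Definition Z_at i : G := if i == i0 then 1 else Z ^ PS (tperm i1 i).

(** The relations on Z give generators of the stabiliser of the first two
    indices. *)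
Lemma ZP_fix s : s i0 = i0 -> s i1 = i1 -> Z ^ PS s = Z.
Proof.
apply: PS_fix_stab2 => n3.
  by have := gG_rel (rel_Z_UVV #|F| R_Sn R_SL2 n3); rewrite !fg_evalE.
by have := gG_rel (rel_Z_VUUV #|F| R_Sn R_SL2 n3); rewrite !fg_evalE.
Qed.

Lemma ZP_eq s s' : s i0 = s' i0 -> s i1 = s' i1 -> Z ^ PS s = Z ^ PS s'.
Proof.
move=> e0 e1; apply: (conjg_inj (PS s')^-1).
by rewrite conjgK -PSV -conjgM -PSM ZP_fix // permM ?e0 ?e1 permK.
Qed.

Lemma ZZ : Z * Z = 1.
Proof. by have := gG_rel (rel_ZZ n #|F| R_Sn R_SL2); rewrite !fg_evalE expg2. Qed.

Lemma ZU : Z ^ U = Z.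
Proof.
have := gG_rel (rel_Z_U n #|F| R_Sn R_SL2); rewrite !fg_evalE.
by move/eqP; rewrite -conjg_fix => /eqP.
Qed.

Lemma Z_at0 : Z_at i0 = 1. Proof. by rewrite /Z_at eqxx. Qed.
Lemma Z_at1 : Z_at i1 = Z. Proof. by rewrite /Z_at tperm1 PS1 conjg1. Qed.

Lemma Z_at_sqr i : Z_at i * Z_at i = 1.
Proof. by rewrite /Z_at; case: eqP => _; rewrite ?mulg1 // -conjMg ZZ conj1g. Qed.

Lemma Z_atP0 s : s i0 = i0 -> Z ^ PS s = Z_at (s i1).
Proof.
move=> s0; have s1 : s i1 != i0 by rewrite -{1}s0 (inj_eq perm_inj).
rewrite /Z_at (negPf s1); apply: ZP_eq; rewrite ?tpermL //.
by rewrite s0 tpermD.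
Qed.

(** The relation Z Z^V = Z^(U^V): the sign change of the indices 2 and 3 is
    the product of those of 1, 2 and of 1, 3. *)
Lemma ZVE : Z ^ V = Z_at i1 * Z_at i2.
Proof.
have := gG_rel (rel_ZZV n #|F| R_Sn R_SL2); rewrite !fg_evalE => /divg1_eq.
have -> : Z ^ (U ^ V) = Z_at i2.
  rewrite -PS_U -PS_V -PSJ transp_cycle Z_atP0; first by rewrite tpermL.
  by rewrite tpermD.
by move=> <-; rewrite Z_at1 mulgA ZZ mul1g.
Qed.

Lemma Z_atJ0 i s : s i0 = i0 -> Z_at i ^ PS s = Z_at (s i).
Proof.
move=> s0; rewrite {1}/Z_at; case: eqP => [->|/eqP i0'].
  by rewrite conj1g s0 Z_at0.
by rewrite -conjgM -PSM Z_atP0 ?permM ?tpermL // tpermD // eq_sym.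
Qed.

Lemma Z_atC i j : commute (Z_at i) (Z_at j).
Proof.
have [->|ij] := eqVneq i j; first exact: commute_refl.
have [->|ni] := eqVneq i i0; first by rewrite Z_at0; exact/commute_sym/commute1.
have [->|nj] := eqVneq j i0; first by rewrite Z_at0; exact/commute1.
have [|||s [s0 <- <-]] := @perm3_ex _ n_gt2 i0 i j; rewrite ?(eq_sym i0) //.
rewrite -!(Z_atJ0 _ s0) /commute -!conjMg; congr (_ ^ _).
have := gG_rel (rel_Z_ZV n #|F| R_Sn R_SL2); rewrite !fg_evalE => /eqP/commgP.
rewrite /= ZVE -Z_at1 => c; apply: (mulgI (Z_at i1)).
by rewrite [RHS]mulgA; exact: c.
Qed.

(** Every conjugate of Z is a product of two of the elements [Z_at]; this is
    the relation of [ZVE] moved by a permutation that fixes the first index. *)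
Lemma Z_atP s : Z ^ PS s = Z_at (s i0) * Z_at (s i1).
Proof.
have [s0|s0] := eqVneq (s i0) i0; first by rewrite Z_atP0 // s0 Z_at0 mul1g.
have [s1|s1] := eqVneq (s i1) i0.
  rewrite s1 Z_at0 mulg1 -{1}ZU -PS_U -conjgM -PSM Z_atP0 permM ?tpermL //.
  by rewrite tpermR.
have s01 : s i0 != s i1 by rewrite (inj_eq perm_inj).
have [|||r [r0 r1 r2]] := @perm3_ex _ n_gt2 i0 (s i0) (s i1); rewrite ?(eq_sym i0) //.
rewrite (@ZP_eq s (v_ * r)); last 2 first.
- by rewrite permM cycle0.
- by rewrite permM cycle1.
by rewrite PSM conjgM PS_V ZVE conjMg !Z_atJ0 // r1 r2.
Qed.

Lemma pi_Z_at i : pi (Z_at i) = flip_og F [set i0] * flip_og F [set i].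
Proof.
rewrite /Z_at; case: eqP => [->|/eqP ni]; first by rewrite pi1 flip_ogE.
rewrite piJ pi_PS pi_gen ZJP tpermL tpermD //.
rewrite flip_ogM; congr flip_og; apply/setP => j; rewrite !inE.
by have [->|] := eqVneq j i0; rewrite ?(eq_sym i0) ?(negPf ni).
Qed.

(** At the first index this is a relation, and U carries it to the second
    index; at the others it is the relation [delta, Z^V] = 1 moved by a
    permutation. *)
Lemma delta_atZ i : delta_at i ^ Z = if (i == i0) || (i == i1) then (delta_at i)^-1 else delta_at i.
Proof.
have d0 : delta_at i0 ^ Z = (delta_at i0)^-1.
  have := gG_rel (rel_deltaZ n #|F| R_Sn R_SL2); rewrite !fg_evalE delta_at0.
  by move/divg1_eq.
have [-> //|ni0] := eqVneq i i0.
have [->|ni1] /= := eqVneq i i1.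
  have -> : delta_at i1 = delta_at i0 ^ U by rewrite -PS_U delta_atJ tpermL.
  by rewrite -{1}ZU -conjJg d0 conjVg.
have [|||r [<- r1 r2]] := @perm3_ex _ n_gt2 i i0 i1; rewrite // -delta_atP.
have {1}<- : Z ^ PS (v_ * r) = Z.
  by rewrite Z_atP !permM cycle0 cycle1 r1 r2 Z_at0 Z_at1 mul1g.
rewrite PSM PS_V conjgM -conjJg; congr (_ ^ _).
have := gG_rel (rel_delta_ZV n #|F| R_Sn R_SL2); rewrite !fg_evalE.
by move/eqP; rewrite -conjg_fix => /eqP.
Qed.

Lemma delta_at_Z_at i j : delta_at i ^ Z_at j = delta_at i \/ delta_at i ^ Z_at j = (delta_at i)^-1.
Proof.
rewrite /Z_at; case: eqP => _; first by rewrite conjg1; left.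
set s := tperm i1 j.
have -> : delta_at i = delta_at (s^-1 i) ^ PS s by rewrite delta_atJ permKV.
by rewrite -conjJg delta_atZ; case: ifP => _; [right; rewrite conjVg | left].
Qed.

(** ** Normal form *)

(** The exponent at the first index, where Z_at is trivial, can be chosen so
    that the sum is even. Then pi maps the middle factor to the sign change of
    exactly the indices with odd exponent. *)
Definition NF x := exists k m s,
  odd (\sum_i m i) = false /\ x = powprod delta_at k * powprod Z_at m * PS s.

Lemma NF1 : NF 1.
Proof.
exists (fun=> 0%N), (fun=> 0%N), 1; split; first by rewrite big1.
by rewrite !powprod1 ?PS1 ?mulg1.
Qed.

Lemma NF_PS x s : NF x -> NF (x * PS s).
Proof.
by move=> [k [m [s' [em ->]]]]; exists k, m, (s' * s); rewrite PSM mulgA.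
Qed.

Lemma NF_Z x : NF x -> NF (x * Z).
Proof.
move=> [k [m [s [em ->]]]].
exists k, (fun i => m i + ((if i == s^-1 i0 then 1 else 0) + (if i == s^-1 i1 then 1 else 0)))%N, s.
split.
  by rewrite !big_split /= oddD em -!big_mkcond !big_pred1_eq.
rewrite -mulgA (conjgCV (PS s)) -PSV Z_atP -!(powprodM Z_atC) !(powprod_single Z_at) !expg1 !mulgA.
by [].
Qed.

Lemma powprod_Z_sqr m : powprod Z_at m * powprod Z_at m = 1.
Proof. by rewrite (powprodM Z_atC) powprod1 // => i; rewrite addnn -mul2n expgnA expg2 Z_at_sqr expg1n. Qed.

Lemma delta_powprod_Z i m : delta_at i ^ powprod Z_at m = delta_at i \/ delta_at i ^ powprod Z_at m = (delta_at i)^-1.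
Proof.
rewrite /powprod; elim: (index_enum _) => [|j r IHr]; first by rewrite big_nil conjg1; left.
rewrite big_cons conjgM.
have : delta_at i ^ (Z_at j ^+ m j) = delta_at i \/ delta_at i ^ (Z_at j ^+ m j) = (delta_at i)^-1.
  elim: (m j) => [|q IHq]; first by rewrite expg0 conjg1; left.
  rewrite expgS conjgM.
  case: (delta_at_Z_at i j) => ->; first exact: IHq.
  by rewrite conjVg; case: IHq => ->; [right | left; rewrite invgK].
case=> -> //; rewrite conjVg.
by case: IHr => ->; [right | left; rewrite invgK].
Qed.

Lemma NF_delta x : NF x -> NF (x * delta).
Proof.
move=> [k [m [s [em ->]]]].
rewrite -mulgA (conjgCV (PS s)) -PSV delta_atP; set j := s^-1 i0.
have [c dj] : exists c, delta_at j ^ (powprod Z_at m)^-1 = delta_at j ^+ c.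
  have -> : (powprod Z_at m)^-1 = powprod Z_at m by apply: mulg1_eq; exact: powprod_Z_sqr.
  by case: (delta_powprod_Z j m) => ->; [exists 1%N | exists (#|F| - 2); exact: delta_atV].
exists (fun i => k i + (if i == j then c else 0))%N, m, s; split=> //.
rewrite -(powprodM delta_atC) (powprod_single delta_at) -dj -(mulgA (powprod delta_at k) _ (powprod Z_at m)) -conjgCV.
by move: (powprod delta_at k) (powprod Z_at m) (delta_at j) (PS s) => a b d e; rewrite !mulgA.
Qed.

(** ** Faithfulness of the matrices on the monomial subgroup *)

Lemma pi_powprod (f : 'I_n -> G) k : pi (powprod f k) = powprod (fun i => pi (f i)) k.
Proof.
by rewrite /powprod (big_morph pi piM pi1); apply: eq_bigr => i _; exact: piX.
Qed.

Lemma pi_powprod_delta k : mono (pi (powprod delta_at k)) id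
  (fun a => if a.2 then om ^+ k a.1 else om ^- k a.1)%R.
Proof.
rewrite pi_powprod; have : forall r, uniq r ->
    mono (\prod_(i <- r) pi (delta_at i) ^+ k i) id
     (fun a => if a.1 \in r then if a.2 then om ^+ k a.1 else om ^- k a.1 else 1)%R.
  elim=> [_|i r IHr /= /andP[ir ur]]; first by rewrite big_nil; exact: mono1.
  rewrite big_cons pi_delta_at torus_ogX ?om_neq0 //.
  have omk := expf_neq0 (k i) (om_neq0 omega).
  apply: mono_ext (monoM (torus_og_mono i omk) (IHr ur)) _ _ => // a /=.
  rewrite /torus_co inE; have [ai|_] := eqVneq a.1 i.
    by rewrite ai (negPf ir) mulr1.
  by rewrite mul1r.
move/(_ (index_enum _) (index_enum_uniq _)) => /mono_ext; apply=> // a.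
by rewrite mem_index_enum.
Qed.

Lemma pi_powprod_Z m : odd (\sum_i m i) = false ->
  pi (powprod Z_at m) = flip_og F [set i | odd (m i)].
Proof.
move=> em; rewrite pi_powprod.
have -> : powprod (fun i => pi (Z_at i)) m = flip_og F [set i0] ^+ (\sum_i m i) * powprod (fun i => flip_og F [set i]) m.
  rewrite /powprod; elim: (index_enum _) => [|j r IHr]; first by rewrite !big_nil mulg1.
  rewrite !big_cons IHr pi_Z_at expgMn; last exact: flip_ogC.
  rewrite expgnDr -!mulgA; congr (_ * _); rewrite !mulgA; congr (_ * _).
  exact/commuteX2/flip_ogC.
have -> : flip_og F [set i0] ^+ (\sum_i m i) = 1.
  by rewrite -(odd_double_half (\sum_i m i)) em add0n -mul2n expgnA expg2 flip_ogE expg1n.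
rewrite mul1g /powprod.
have : forall r, uniq r -> \prod_(i <- r) flip_og F [set i] ^+ m i = flip_og F [set i in r | odd (m i)].
  elim=> [_|j r IHr /= /andP[jr ur]].
    by rewrite big_nil -(flip_og0 n F); congr flip_og; apply/setP => i; rewrite !inE.
  rewrite big_cons (IHr ur).
  have -> : flip_og F [set j] ^+ m j = flip_og F [set i in [set j] | odd (m i)].
    rewrite -{1}(odd_double_half (m j)) expgnDr -mul2n expgnA expg2 flip_ogE expg1n mulg1.
    rewrite expgb; case: ifP => oj; last rewrite -(flip_og0 n F); congr flip_og; apply/setP => i; rewrite !inE.
      by case: eqP => // ->.
    by case: eqP => // ->.
  rewrite flip_ogM; congr flip_og; apply/setP => i; rewrite !inE.
  by have [->|] := eqVneq i j; rewrite ?(negPf jr) ?addbF.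
move/(_ (index_enum _) (index_enum_uniq _)) => ->.
by congr flip_og; apply/setP => i; rewrite !inE mem_index_enum.
Qed.

Lemma pi_NF k m s : odd (\sum_i m i) = false ->
  mono (pi (powprod delta_at k * powprod Z_at m * PS s)) (fun a => (s a.1, a.2 (+) odd (m a.1)))
       (fun a => if a.2 then om ^+ k a.1 else om ^- k a.1)%R.
Proof.
move=> em; rewrite !piM pi_PS pi_powprod_Z //.
apply: mono_ext (monoM (monoM (pi_powprod_delta k) (flip_og_mono _ _)) (perm_og_mono _ _)) _ _ => a /=.
  by rewrite /perm_ix /flip_ix /= inE.
by rewrite /unit_co !mulr1.
Qed.

(** The monomial matrix determines the permutation, the parities of the
    exponents of the sign changes, and the exponents of delta modulo q - 1. *)
Lemma NF_inj x : NF x -> pi x = 1 -> x = 1.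
Proof.
move=> [k [m [s [em ->]]]] px.
have xm := pi_NF k s em; rewrite px in xm.
have [weq ceq] := mono_sound xm (@mono1 n F).
have s1 : s = 1.
  by apply/permP => i; rewrite perm1; case: (weq (i, true)).
rewrite s1 PS1 mulg1 !powprod1 ?mulg1 // => i.
  have := weq (i, false); case=> _ /= om_.
  by rewrite -(odd_double_half (m i)) om_ add0n -mul2n expgnA expg2 Z_at_sqr expg1n.
by apply: delta_at_om; exact: (ceq (i, true)).
Qed.

(** The monomial subgroup N; right multiplication by its generators preserves
    the normal form [NF]. *)
Definition NG : G -> Prop :=
  gen (fun x => x = Z \/ x = delta \/ exists s, x = PS s).

Lemma NG_Z : NG Z. Proof. by apply: gen_in; left. Qed.
Lemma NG_delta : NG delta. Proof. by apply: gen_in; right; left. Qed.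
Lemma NG_PS s : NG (PS s). Proof. by apply: gen_in; right; right; exists s. Qed.
Lemma NG1 : NG 1. Proof. exact: gen1. Qed.
Lemma NGM x y : NG x -> NG y -> NG (x * y). Proof. exact: genM. Qed.
Lemma NGX x m : NG x -> NG (x ^+ m). Proof. exact: genX. Qed.

Lemma NGV x : NG x -> NG x^-1.
Proof.
apply: genV => {}x [->|[->|[s ->]]]; last by rewrite -PSV; exact: NG_PS.
  by rewrite (mulg1_eq ZZ); exact: NG_Z.
have -> : delta^-1 = delta ^+ (#|F| - 2) by rewrite -delta_at0 delta_atV.
by apply: NGX; exact: NG_delta.
Qed.

Lemma NGJ x y : NG x -> NG y -> NG (x ^ y).
Proof. by move=> Nx Ny; rewrite conjgE; apply: NGM (NGM _ _) => //; exact: NGV. Qed.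

Lemma NG_NF x : NG x -> NF x.
Proof.
elim=> [|y z _ NFy [->|[->|[s ->]]]]; first exact: NF1.
- exact: NF_Z.
- exact: NF_delta.
exact: NF_PS.
Qed.

Lemma NG_inj x y : NG x -> NG y -> pi x = pi y -> x = y.
Proof.
move=> Nx Ny pxy; apply: divg1_eq; apply: NF_inj.
  exact/NG_NF/NGM/NGV.
by rewrite piM piV pxy mulgV.
Qed.

Lemma NG_mono x : NG x -> exists w c, mono (pi x) w c.
Proof.
by move=> /NG_NF[k [m [s [em ->]]]]; eexists; eexists; exact: pi_NF em.
Qed.

(** ** The centraliser of sigma in the monomial subgroup *)

Lemma sigma_PS s : s i0 = i0 -> s i1 = i1 -> sigma ^ PS s = sigma.
Proof.
apply: PS_fix_stab2 => n3.
  by have := gG_rel (rel_sigma_UVV #|F| R_Sn R_SL2 n3); rewrite !fg_evalE.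
by have := gG_rel (rel_sigma_VUUV #|F| R_Sn R_SL2 n3); rewrite !fg_evalE.
Qed.

Lemma sigma_delta i : 1 < i -> sigma ^ delta_at i = sigma.
Proof.
move=> igt; have i2i : tperm i2 i i0 = i0 /\ tperm i2 i i1 = i1.
  by split; apply: tpermD => //; rewrite -val_eqE /= gtn_eqF // ltnW.
have -> : delta_at i = delta_at i2 ^ PS (tperm i2 i) by rewrite delta_atJ tpermL.
rewrite -{1}(@sigma_PS (tperm i2 i)) ?(proj1 i2i) ?(proj2 i2i) // -conjJg.
have -> : sigma ^ delta_at i2 = sigma.
  have := gG_rel (rel_sigma_deltaVV n #|F| R_Sn R_SL2); rewrite !fg_evalE.
  rewrite -PS_V -PSX delta_atP expg2 permM cycle0 cycle1 => /eqP.
  by rewrite -conjg_fix => /eqP.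
by rewrite sigma_PS ?(proj1 i2i) ?(proj2 i2i).
Qed.

Lemma sigma_Z2 i j : 1 < i -> 1 < j -> sigma ^ (Z_at i * Z_at j) = sigma.
Proof.
move=> igt jgt; have [->|ij] := eqVneq i j; first by rewrite Z_at_sqr conjg1.
have n3 : 3 < n.
  move: (ltn_ord i) (ltn_ord j) ij; rewrite -val_eqE /= => *; lia.
have k2 : i2 < v_ i2 by rewrite cycle2.
have [s [s0 s1 si sj]] := perm_fix01_ex k2 igt jgt ij.
have -> : Z_at i * Z_at j = (Z_at i2 * Z_at (v_ i2)) ^ PS s.
  by rewrite conjMg !Z_atJ0 // si sj.
rewrite -{1}(sigma_PS s0 s1) -conjJg.
have -> : sigma ^ (Z_at i2 * Z_at (v_ i2)) = sigma.
  have := gG_rel (rel_sigma_ZVV #|F| R_Sn R_SL2 n3); rewrite !fg_evalE.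
  rewrite -PS_V -PSX Z_atP expg2 !permM cycle0 cycle1 => /eqP.
  by rewrite -conjg_fix => /eqP.
exact: sigma_PS.
Qed.

(** Each sign change Z_at i with i beyond the first two indices moves sigma to the
    same conjugate, so an even number of them fixes sigma. *)
Lemma sigma_powprod_Z m : odd (\sum_i m i) = false ->
  odd (m i0) = false -> odd (m i1) = false -> sigma ^ powprod Z_at m = sigma.
Proof.
move=> em m0 m1; pose tau b := if b then sigma ^ Z_at i2 else sigma.
have ztm i : Z_at i ^+ m i = if odd (m i) then Z_at i else 1.
  rewrite -{1}(odd_double_half (m i)) expgnDr -mul2n expgnA expg2 Z_at_sqr.
  by rewrite expg1n mulg1 expgb.
have tauE b i : tau b ^ (Z_at i ^+ m i) = tau (b (+) odd (m i)).
  rewrite ztm; case oi: (odd (m i)); last by rewrite conjg1 addbF.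
  have igt : 1 < i.
    have ni0 : i != i0 by apply/eqP => e; move: oi; rewrite e m0.
    have ni1 : i != i1 by apply/eqP => e; move: oi; rewrite e m1.
    by move: ni0 ni1; rewrite -!val_eqE /=; case: (val i) => [|[]].
  case: b => /=; first by rewrite -conjgM sigma_Z2.
  rewrite -[in LHS](@sigma_Z2 i2 i) // -conjgM -mulgA.
  by rewrite Z_at_sqr mulg1.
suff main r b : tau b ^ (\prod_(i <- r) Z_at i ^+ m i) = tau (b (+) odd (\sum_(i <- r) m i)).
  by rewrite -[sigma]/(tau false) main em.
elim: r b => [|i r IHr] b; first by rewrite !big_nil conjg1 addbF.
by rewrite !big_cons conjgM tauE IHr oddD addbA.
Qed.

Lemma sigma_powprod_delta k : (om ^+ k i0 = om ^+ k i1)%R -> sigma ^ powprod delta_at k = sigma.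
Proof.
move=> k01.
have dl1 : delta_at i1 ^+ k i1 = delta_at i1 ^+ k i0.
  have wlog01 c d : c <= d -> (om ^+ c = om ^+ d)%R -> delta_at i1 ^+ c = delta_at i1 ^+ d.
    move=> cd e; rewrite -(subnK cd) expgnDr (_ : delta_at i1 ^+ (d - c) = 1) ?mul1g //.
    apply: delta_at_om; apply: (mulIf (expf_neq0 c (om_neq0 omega))).
    by rewrite -exprD subnK // mul1r.
  by case: (leqP (k i0) (k i1)) => [/wlog01|/ltnW/wlog01] e; rewrite e.
pose a i := (if i == i0 then k i0 else 0) + (if i == i1 then k i0 else 0).
pose b i := if 1 < i then k i else 0.
have -> : powprod delta_at k = powprod delta_at (fun i => a i + b i).
  apply: eq_powprod => i; rewrite /a /b -!val_eqE /=.
  case: i => [[|[|i]] ilt] /=; rewrite ?addn0 ?add0n //.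
    by have -> : Ordinal ilt = i0 by exact: val_inj.
  by have -> : Ordinal ilt = i1 by exact: val_inj.
rewrite -(powprodM delta_atC) -(powprodM delta_atC) !(powprod_single delta_at) conjgM -expgMn; last exact: delta_atC.
have -> : sigma ^ ((delta_at i0 * delta_at i1) ^+ k i0) = sigma.
  elim: (k i0) => [|q IHq]; first by rewrite expg0 conjg1.
  rewrite expgSr conjgM IHq.
  have := gG_rel (rel_sigma_deltadeltaU n #|F| R_Sn R_SL2); rewrite !fg_evalE.
  have -> : delta ^ U = delta_at i1 by rewrite -PS_U delta_atP tpermL.
  by rewrite -delta_at0 => /eqP; rewrite -conjg_fix => /eqP.
rewrite /powprod; elim: (index_enum _) => [|i r IHr]; first by rewrite big_nil conjg1.
rewrite big_cons conjgM (_ : sigma ^ (delta_at i ^+ b i) = sigma) //.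
rewrite /b; case: ifP => igt; last by rewrite expg0 conjg1.
elim: (k i) => [|q IHq]; first by rewrite expg0 conjg1.
by rewrite expgSr conjgM IHq sigma_delta.
Qed.

(** Up to scalars, an element of N that centralises the matrix sigma fixes e_1
    and e_2, or maps them to f_2 and f_1, by [X_inj]. The second case is
    reduced to the first by Z U, which centralises sigma. In the first case
    the factors of the normal form centralise sigma one by one. *)
Lemma sigma_cent x : NG x -> pi sigma ^ pi x = pi sigma -> sigma ^ x = sigma.
Proof.
have case1 y : NG y -> pi sigma ^ pi y = pi sigma ->
    (forall w c, mono (pi y) w c -> w (i0, false) = (i0, false)) -> sigma ^ y = sigma.
  move=> /NG_NF[k [m [s [em ->]]]]; rewrite pi_gen /= => sy wy.
  have mn := pi_NF k s em; have [s0 m0] := wy _ _ mn.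
  move: sy; rewrite (mono_XJ pchar2 _ mn) // => sy.
  have [|||c1 []] := X_inj pchar2 _ _ _ (esym sy) => //.
  - by rewrite /root /= (inj_eq perm_inj).
  - exact: oner_neq0.
  - move=> [_ _ s1 m1]; rewrite !conjgM sigma_powprod_delta ?sigma_powprod_Z ?sigma_PS //.
    move/esym: c1; rewrite /= invrK mulr1 => c1.
    have om1 := expf_neq0 (k i1) (om_neq0 omega).
    by apply: (mulIf (invr_neq0 om1)); rewrite c1 mulfV.
  by rewrite /neg /= s0 => -[].
move=> Nx sx; have [w [c xm]] := NG_mono Nx.
have := sx; rewrite pi_gen /= (mono_XJ pchar2 _ xm) // => sx'.
have [|||_ []] := X_inj pchar2 _ _ _ (esym sx') => //.
- by rewrite /root (mono_fst xm).
- exact: oner_neq0.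
- by case=> w0 _; apply: case1 => // w' c' /(mono_sound xm)[<- _].
case=> w0 w1; have ZUs : sigma ^ (Z * U) = sigma.
  have := gG_rel (rel_sigma_ZU n #|F| R_Sn R_SL2); rewrite !fg_evalE.
  by move=> /eqP; rewrite -conjg_fix => /eqP.
have NZU : NG (Z * U) by apply: NGM NG_Z _; rewrite -PS_U; exact: NG_PS.
rewrite -[x](mulgK (Z * U)) conjgM case1 //.
- by rewrite -{1}ZUs conjgK.
- exact: NGM.
- by rewrite piM conjgM sx -piJ ZUs.
move=> w' c'; rewrite !piM => wm; have := monoM (monoM xm (flip_og_mono F [set i0; i1])) (perm_og_mono F u_).
rewrite !pi_gen /= in wm; rewrite -mulgA => /(mono_sound wm)[-> _] /=.
by rewrite w0 /flip_ix /perm_ix /neg /= !inE eqxx orbT tpermR.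
Qed.

(** ** The special linear subgroup *)

Hypothesis R_SL2_ok : presents_on
  (fun r => R_SL2 r \/ r = fg_gen SL2_Delta ^+ (#|F| - 1)) (SL2_gen omega).

Definition gSL (l : SL2_letter) : G :=
  match l with SL2_sigma => sigma | SL2_Delta => [~ U, delta] | SL2_U => U end.

Lemma Delta_delta_at : [~ U, delta] = (delta_at i1)^-1 * delta_at i0.
Proof. by rewrite commgEr -delta_at0 conjVg -PS_U delta_atJ tpermL. Qed.

(** The relation Delta^(q-1) = 1 that completes the presentation follows from
    delta^(q-1) = 1, because Delta is a product of commuting conjugates of
    delta and of its inverse. *)
Lemma SL_eval1 w : fg_eval (SL2_gen omega) w = 1 -> fg_eval gSL w = 1.
Proof.
move=> /R_SL2_ok; apply: normal_closure_eval => r [Rr|->].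
  have := gG_rel (rel_SL2 n #|F| R_Sn Rr).
  rewrite (@fg_eval_morph _ _ _ (fg_eval gG) _ gSL) //; first exact: fg_evalM.
  by case; rewrite !fg_evalE.
rewrite !fg_evalE /= Delta_delta_at expgMn; last exact/commute_sym/commuteV/delta_atC.
by rewrite expVgn !delta_at_order invg1 mulg1.
Qed.

Definition SLG x := exists w, x = fg_eval gSL w.

Lemma SLG_gen l : SLG (gSL l).
Proof. by exists (fg_gen l); rewrite fg_eval_gen. Qed.
Lemma SLGM x y : SLG x -> SLG y -> SLG (x * y).
Proof. by move=> [w ->] [w' ->]; exists (w * w'); rewrite fg_evalM. Qed.
Lemma SLGV x : SLG x -> SLG x^-1.
Proof. by move=> [w ->]; exists w^-1; rewrite fg_evalV. Qed.
Lemma SLGX x m : SLG x -> SLG (x ^+ m).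
Proof. by move=> [w ->]; exists (w ^+ m); rewrite fg_evalX. Qed.

(** The embedding of the special linear group is faithful, so an equation between
    words in sigma, Delta and U may be checked on matrices of size 2 n. *)
Lemma SLG_inj x y : SLG x -> SLG y -> pi x = pi y -> x = y.
Proof.
move=> [w ->] [w' ->] pxy; apply: divg1_eq.
rewrite -fg_evalV -fg_evalM; apply: SL_eval1.
have pw v : pi (fg_eval gSL v) = fg_eval (og_SL2 n_gt2 omega) v.
  apply: fg_eval_morph => // l.
  by case: l; rewrite /= ?commgEl ?piM ?piV ?piJ !pi_gen.
have e1 : fg_eval (og_SL2 n_gt2 omega) (w * w'^-1) = 1.
  by rewrite -pw fg_evalM fg_evalV piM piV pxy mulgV.
have := fg_eval_levi n_gt2 pchar2 omega (w * w'^-1).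
by rewrite e1 => /levi_rep1_eq M1; apply: val_inj.
Qed.

End MonomialSubgroup.

(** * Root subgroups and the Steinberg relations *)

(** The root of the commutator is the sum of the two given roots. To avoid the
    case distinctions in this sum, the last clause only says that the
    difference p f - p e adds up for all odd functions p on signed indices;
    with p = [wt] this is the additivity of the height. *)
Definition steinberg_prop n (F : finFieldType) (G : groupType)
    (XG : sidx n -> sidx n -> F -> G) a b c d t u :=
  let r := [~ XG a b t, XG c d u]%g in
  r = 1%g \/ exists e f k, [/\ root e f, r = XG e f k &
    forall p : sidx n -> int, (forall x, p (neg x) = - p x)%R ->
      (p f - p e = (p b - p a) + (p d - p c))%R].

Section RootSubgroups.
Local Open Scope ring_scope.
Variables (n : nat) (F : finFieldType).
Hypothesis n_gt2 : (2 < n)%N.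
Hypothesis pchar2 : 2%N \in [pchar F].
Variables (G : groupType) (pi : G -> ogroup n F).
Hypothesis piM : forall x y, pi (x * y)%g = (pi x * pi y)%g.
Implicit Types (s : {perm 'I_n}) (i j : 'I_n) (x y z : G) (a b d e : sidx n) (t u : F).

Local Notation i0 := (idx0 n_gt2).
Local Notation i1 := (idx1 n_gt2).
Local Notation i2 := (idx2 n_gt2).
Local Notation u_ := (tperm i0 i1).
Local Notation v_ := (perm (@ordS_inj n)).
Local Notation e0 := (i0, false).
Local Notation e1 := (i1, false).
Local Notation e2 := (i2, false).
Local Notation onec := (fun=> 1 : F).

Variable NG : G -> Prop.
Hypothesis NGM : forall x y, NG x -> NG y -> NG (x * y)%g.
Hypothesis NGV : forall x, NG x -> NG x^-1%g.
Variable PS : {perm 'I_n} -> G.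
Hypothesis NG_PS : forall s, NG (PS s).
Hypothesis pi_PS : forall s, pi (PS s) = perm_og F s.
Hypothesis NG_sign : forall A : {set 'I_n}, odd #|A| = false ->
  exists2 x, NG x & pi x = flip_og F A.
Hypothesis NG_torus : forall i t, t != 0 -> exists2 x, NG x & pi x = torus_og i t.

Variable sg : G.
Hypothesis pi_sg : pi sg = X e0 e1 1.
Hypothesis sg_cent : forall x, NG x -> (pi sg ^ pi x)%g = pi sg -> (sg ^ x)%g = sg.

Variable SLG : G -> Prop.
Hypothesis SLGM : forall x y, SLG x -> SLG y -> SLG (x * y)%g.
Hypothesis SLGV : forall x, SLG x -> SLG x^-1%g.
Hypothesis SLG_inj : forall x y, SLG x -> SLG y -> pi x = pi y -> x = y.
Hypothesis SLG_sg : SLG sg.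
Hypothesis SLG_PS : SLG (PS u_).
Hypothesis SLG_torus : forall t, t != 0 -> exists x,
  [/\ NG x, SLG x & pi x = (torus_og i0 t^-1%R * torus_og i1 t)%g].

Variable ZV : G.
Hypothesis NG_ZV : NG ZV.
Hypothesis pi_ZV : pi ZV = flip_og F [set i1; i2].
Hypothesis rel_a : [~ sg, sg ^ PS v_]%g = (sg ^ PS (v_ * u_))%g.
Hypothesis rel_b : [~ sg, sg ^ PS (v_ * u_)]%g = 1%g.
Hypothesis rel_c : [~ sg, sg ^ PS (u_ ^ (v_ * u_))]%g = 1%g.
Hypothesis rel_d : (3 < n)%N -> [~ sg, sg ^ PS (v_ ^+ 2)]%g = 1%g.
Hypothesis rel_e : [~ sg, sg ^ ZV]%g = 1%g.
Hypothesis rel_f : n = 4%N -> [~ sg, sg ^ (ZV * PS (v_ ^+ 2))]%g = 1%g.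

Let pi1 : pi 1%g = 1%g.
Proof. by apply: (mulgI (pi 1%g)); rewrite -piM !mulg1. Qed.
Let piV x : pi x^-1%g = (pi x)^-1%g.
Proof. by apply: (mulgI (pi x)); rewrite -piM !mulgV pi1. Qed.
Let piJ x y : pi (x ^ y)%g = (pi x ^ pi y)%g.
Proof. by rewrite !conjgE !piM piV. Qed.

(** ** Lifting root elements *)

Definition lift a b t x := [/\ root a b, pi x = X a b t & exists2 m, NG m & x = (sg ^ m)%g].

(** Two lifts differ by an element of N that centralises the matrix sigma,
    hence sigma itself. *)
Lemma lift_uniq a b t x y : lift a b t x -> lift a b t y -> x = y.
Proof.
move=> [_ px [m Nm ex]] [_ py [m' Nm' ey]].
have pxy : pi x = pi y by rewrite px py.
apply: (conjg_inj m'^-1%g); rewrite ex ey conjgK -conjgM.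
apply: sg_cent; first exact/NGM/NGV.
by rewrite piM piV conjgM -piJ -ex pxy ey piJ conjgK.
Qed.

Lemma lift_J a b t x y w c : NG y -> mono (pi y) w c -> lift a b t x ->
  lift (w a) (w b) ((c a)^-1 * c b * t) (x ^ y)%g.
Proof.
move=> Ny ym [ab px [m Nm ex]]; split.
- by rewrite /root (mono_fst ym).
- by rewrite piJ px (mono_XJ pchar2 _ ym).
by exists (m * y)%g; [exact: NGM | rewrite conjgM ex].
Qed.

Lemma lift_N a b t x : lift a b t x -> lift (neg b) (neg a) t x.
Proof. by move=> [ab px mx]; split; rewrite ?XN // /root eq_sym. Qed.

Lemma lift_sg : lift e0 e1 1 sg.
Proof. by split=> //; exists 1%g; [rewrite -(mulgV (PS 1)); exact/NGM/NGV | rewrite conjg1]. Qed.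

(** Only even sign changes lift to N, whence the parity condition. Indices
    that are not in the list l keep the sign e_i. *)
Lemma place s (l : seq (sidx n)) :
    uniq (map fst l) -> odd (count snd l) = false ->
  exists x w, [/\ NG x, mono (pi x) w onec &
    forall i a, a \in l -> s i = a.1 -> w (i, false) = a].
Proof.
move=> ul cl; pose A := [set i | (i, true) \in l].
have cA : odd #|A| = false.
  rewrite -cl {cl}; congr odd; rewrite {}/A.
  elim: l ul => [_|a l IHl /= /andP[al ul]].
    by apply/eqP; rewrite cards_eq0; apply/eqP/setP => i; rewrite !inE.
  rewrite -IHl //; case: a al => j [] /= jl.
    rewrite add1n (cardsD1 j) !inE eqxx add1n; congr _.+1; apply: eq_card => i.
    rewrite !inE xpair_eqE andbT; have [->|//] := eqVneq i j.
    by apply/esym/negP => jtl; move/negP: jl; apply; apply/mapP; exists (j, true).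
  by rewrite add0n; apply: eq_card => i; rewrite !inE xpair_eqE andbF.
have [x Nx px] := NG_sign cA.
exists (PS s * x)%g, (flip_ix A \o perm_ix s); split; first exact: NGM.
  rewrite piM pi_PS px; apply: mono_ext (monoM (perm_og_mono _ _) (flip_og_mono _ _)) _ _ => //.
  by move=> a; rewrite /unit_co mulr1.
move=> i a al si; rewrite /flip_ix /perm_ix /= inE si.
case: a al si => j [] /= jl _; first by rewrite jl.
have [jtl|//] := boolP ((j, true) \in l); have := ul.
have nd : (j, true) != (j, false) by rewrite xpair_eqE andbF.
rewrite (perm_uniq (perm_map fst (perm_to_rem jl))) /= => /andP[+ _].
case/mapP; exists (j, true) => //.
have /perm_mem/(_ (j, true)) := perm_to_rem jl.
by rewrite jtl inE (negPf nd).
Qed.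

Lemma lift_ex a b t : root a b -> t != 0 -> exists x, lift a b t x.
Proof.
move=> ab t0; have [k /andP[ka kb]] := third_index n_gt2 a.1 b.1.
have [ak bk] : a.1 != k /\ b.1 != k by rewrite !(eq_sym _ k).
have [s [s0 s1 s2]] := @perm3_ex _ n_gt2 a.1 b.1 k ab ak bk.
have [y Ny py] := NG_torus i0 t0.
have ym := torus_og_mono i0 t0; rewrite -py in ym.
(* The sign at a third index k makes the number of sign changes even. *)
have [||x [w [Nx xm weq]]] := @place s [:: a; b; (k, a.2 (+) b.2)].
- by rewrite /= !inE negb_or (ab : a.1 != b.1) ak bk.
- by rewrite /= addn0 !oddD !oddb addbA addbb.
exists ((sg ^ y) ^ x)%g.
have := lift_J Nx xm (lift_J Ny ym lift_sg); rewrite /= (weq _ a) ?(weq _ b) ?inE ?eqxx ?orbT //.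
by rewrite /torus_co /= invrK ?ne10 !mulr1 invr1 !mul1r.
Qed.

(** The lift of X a b t, chosen by its existence and uniqueness. The parameter
    0 is treated apart because 1 is not a conjugate of sigma. *)
Definition XG a b t : G :=
  if t == 0 then 1%g else
  if pselect (exists x, lift a b t x) is left ex then projT1 (cid ex) else 1%g.

Lemma XG0 a b : XG a b 0 = 1%g. Proof. by rewrite /XG eqxx. Qed.

Lemma XGP a b t : root a b -> t != 0 -> lift a b t (XG a b t).
Proof.
move=> ab t0; rewrite /XG (negPf t0); case: pselect => [ex|[]]; first by case: cid.
exact: lift_ex.
Qed.

Lemma XG_lift a b t x : t != 0 -> lift a b t x -> x = XG a b t.
Proof. move=> t0 xl; have [ab _ _] := xl; exact: lift_uniq xl (XGP ab t0). Qed.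

Lemma pi_XG a b t : root a b -> pi (XG a b t) = X a b t.
Proof.
move=> ab; have [->|t0] := eqVneq t 0; first by rewrite XG0 pi1 X0.
by case: (XGP ab t0).
Qed.

Lemma XG_J y w c a b t : NG y -> mono (pi y) w c -> root a b ->
  (XG a b t ^ y)%g = XG (w a) (w b) ((c a)^-1 * c b * t).
Proof.
move=> Ny ym ab; have [->|t0] := eqVneq t 0; first by rewrite mulr0 !XG0 conj1g.
apply: XG_lift; last exact: lift_J Ny ym (XGP ab t0).
by rewrite !mulf_neq0 // ?invr_eq0 (mono_neq0 ym).
Qed.

Lemma XG_J1 y w a b t : NG y -> mono (pi y) w onec -> root a b ->
  (XG a b t ^ y)%g = XG (w a) (w b) t.
Proof. by move=> Ny ym ab; rewrite (XG_J t Ny ym ab) invr1 !mul1r. Qed.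

Lemma XG_N a b t : root a b -> XG (neg b) (neg a) t = XG a b t.
Proof.
move=> ab; have [->|t0] := eqVneq t 0; first by rewrite !XG0.
by apply/esym/XG_lift => //; apply/lift_N/XGP.
Qed.

(** ** Rank one *)

(** The diagonal matrix of r in SL(2,q) multiplies the parameter by r^-2 or
    r^2, and squaring is bijective on a finite field of characteristic 2; so
    all lifts for the root of sigma lie in the copy of SL(2,q). *)
Lemma SLG_XG t : SLG (XG e0 e1 t).
Proof.
have SLG1 : SLG 1%g by rewrite -(mulgV sg); exact/SLGM/SLGV.
have [->|t0] := eqVneq t 0; first by rewrite XG0.
have [r r2] := sqrt_pchar2 pchar2 t^-1.
have r0 : r != 0 by apply: contraNneq t0 => r0; rewrite -invr_eq0 -r2 r0 expr2 mul0r.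
have [h [Nh Sh ph]] := SLG_torus r0.
rewrite -(@XG_lift e0 e1 t (sg ^ h)%g) //; first by rewrite conjgE; apply: SLGM (SLGM _ _) => //; exact: SLGV.
have ri0 : r^-1 != 0 by rewrite invr_eq0.
have hm := monoM (torus_og_mono i0 ri0) (torus_og_mono i1 r0).
rewrite -ph in hm; have := lift_J Nh hm lift_sg.
rewrite /torus_co /= ?ne01 ?ne10 /= !invrK !(mulr1, mul1r) -invfM -expr2 r2 invrK.
by [].
Qed.

(** Conjugating by the placing element reduces every identity between two root
    subgroups to the corresponding identity near the first indices. *)
Lemma place_pair a b : root a b -> exists x w,
  [/\ NG x, mono (pi x) w onec, w e0 = a & w e1 = b].
Proof.
move=> ab; have [k /andP[ka kb]] := third_index n_gt2 a.1 b.1.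
have [ak bk] : a.1 != k /\ b.1 != k by rewrite !(eq_sym _ k).
have [s [s0 s1 s2]] := @perm3_ex _ n_gt2 a.1 b.1 k ab ak bk.
have [||x [w [Nx xm weq]]] := @place s [:: a; b; (k, a.2 (+) b.2)].
- by rewrite /= !inE negb_or (ab : a.1 != b.1) ak bk.
- by rewrite /= addn0 !oddD !oddb addbA addbb.
by exists x, w; split=> //; apply: weq; rewrite ?inE ?eqxx ?orbT.
Qed.

(** Inside the copy of SL(2,q) the addition law may be checked on matrices. *)
Lemma XGD a b t u : root a b -> (XG a b t * XG a b u)%g = XG a b (t + u).
Proof.
move=> ab; have [x [w [Nx xm <- <-]]] := place_pair ab.
rewrite -!(XG_J1 _ Nx xm) // -conjMg; congr (_ ^ _)%g.
by apply: SLG_inj; rewrite ?piM ?pi_XG ?XD //; [apply: SLGM|]; exact: SLG_XG.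
Qed.

Lemma XGV a b t : root a b -> (XG a b t)^-1%g = XG a b t.
Proof. by move=> ab; apply: mulg1_eq; rewrite XGD // (addrr2 pchar2) XG0. Qed.

(** The identity of SL(2,q) that makes the double coset argument work: in
    characteristic 2 the permutation matrix U is a Weyl element. *)
Lemma weyl_sl2 t : t != 0 ->
  (X e0 e1 t * perm_og F u_)%g
    = (X e1 e0 t^-1%R * (torus_og i0 t^-1%R * torus_og i1 t) * X e0 e1 t^-1%R)%g.
Proof.
move=> t0; have ti0 : t^-1 != 0 by rewrite invr_eq0.
have Dm := monoM (torus_og_mono i0 ti0) (torus_og_mono i1 t0).
apply: og_bvP => -[j z]; rewrite (vmulM _ (X e0 e1 t)) !(vmulM _ (X e1 e0 _ * _)%g) (vmulM _ (X e1 e0 _)).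
rewrite !(actX pchar2) // !mulmxDl -!scalemxAl !Dm !perm_og_mono /unit_co !scale1r.
apply/vecP => c; rewrite !coE /torus_co /perm_ix /neg /= tpermL tpermR.
have [->|j0] := eqVneq j i0; last have [->|j1] := eqVneq j i1.
- rewrite tpermL; case: z; rewrite ?eqxx ?ne01 ?ne10 /= ?xpair_eqE ?andbF ?andbT ?eqxx /=;
    rewrite !(mulr0, mul0r, mulr1, mul1r, addr0, add0r) ?invrK.
    by rewrite mulVf // mulr1 mulKf // addrAC (addrr2 pchar2) add0r.
  by rewrite mulVf // mul1r addrC.
- rewrite tpermR; case: z; rewrite ?eqxx ?ne01 ?ne10 /= ?xpair_eqE ?andbF ?andbT ?eqxx /=;
    rewrite !(mulr0, mul0r, mulr1, mul1r, addr0, add0r) ?invrK.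
    by rewrite mulVf // mul1r addrC.
  by rewrite mulVf // mulr1 mulKf // addrAC (addrr2 pchar2) add0r.
rewrite tpermD 1?eq_sym // !xpair_eqE (negPf j0) (negPf j1) /=.
by rewrite !(mulr0, mul0r, mulr1, mul1r, addr0, add0r).
Qed.

(** ** Commutators *)

Lemma comm_eq (x y z : G) : [~ x, y]%g = z -> [~ y, x]%g = z^-1%g.
Proof. by move=> <-; rewrite invgR. Qed.

Lemma sgE : sg = XG e0 e1 1.
Proof. by apply: XG_lift lift_sg; exact: oner_neq0. Qed.

Lemma XG_PS a b t s : root a b -> (XG a b t ^ PS s)%g = XG (perm_ix s a) (perm_ix s b) t.
Proof. by move=> ab; rewrite (@XG_J1 (PS s) (perm_ix s)) //; rewrite pi_PS; exact: perm_og_mono. Qed.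

(** The three scalings of the first basis vectors realise all pairs of
    parameters, so the relations hold as soon as they hold for parameter 1. *)
Lemma torus3 k0 k1 k2 : k0 != 0 -> k1 != 0 -> k2 != 0 -> exists2 y, NG y &
  mono (pi y) id (fun a => let k := if a.1 == i0 then k0 else if a.1 == i1 then k1
     else if a.1 == i2 then k2 else 1 in if a.2 then k^-1 else k).
Proof.
move=> k00 k10 k20.
have [y0 N0 p0] := NG_torus i0 (invr_neq0 k00).
have [y1 N1 p1] := NG_torus i1 (invr_neq0 k10).
have [y2 N2 p2] := NG_torus i2 (invr_neq0 k20).
exists (y0 * y1 * y2)%g; first by do 2?apply: NGM.
rewrite !piM p0 p1 p2.
apply: mono_ext (monoM (monoM (torus_og_mono _ _) (torus_og_mono _ _)) (torus_og_mono _ _)) _ _;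
  rewrite ?invr_eq0 // => -[j z]; rewrite /torus_co /=.
have [->|_] := eqVneq j i0; first by rewrite ne01 ne02 !mulr1; case: z; rewrite ?invrK.
have [->|_] := eqVneq j i1; first by rewrite ne12 mulr1 mul1r; case: z; rewrite ?invrK.
by rewrite !mul1r; case: eqP => _; case: z; rewrite ?invrK ?invr1.
Qed.

Lemma chev_base t u :
  [~ XG e0 e1 t, XG e1 e2 u]%g = XG e0 e2 (t * u)%R.
Proof.
have [->|t0] := eqVneq t 0; first by rewrite mul0r !XG0 comm1g.
have [->|u0] := eqVneq u 0; first by rewrite mulr0 !XG0 commg1.
have [y Ny ym] := torus3 (oner_neq0 _) t0 (mulf_neq0 t0 u0).
(* Conjugate the relation for parameter 1 by a diagonal element that gives the
   first two root elements the parameters t and u. *)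
have := congr1 (conjg^~ y) rel_a; rewrite /= conjRg sgE !XG_PS //.
rewrite /perm_ix /= cycle0 cycle1 cycle_transp0 cycle_transp1 !(XG_J _ Ny ym) //=.
by rewrite ?eqxx ?ne10 ?ne20 ?ne21 /= invr1 !mul1r !mulr1 mulKf.
Qed.

Lemma acute_base t u : commute (XG e0 e1 t) (XG e0 e2 u).
Proof.
have [->|t0] := eqVneq t 0; first by rewrite XG0; exact/commute_sym/commute1.
have [->|u0] := eqVneq u 0; first by rewrite XG0; exact/commute1.
have [y Ny ym] := torus3 (oner_neq0 _) t0 u0.
have := congr1 (conjg^~ y) rel_b; rewrite /= conjRg conj1g sgE !XG_PS //.
rewrite /perm_ix /= cycle_transp0 cycle_transp1 !(XG_J _ Ny ym) //=.
by rewrite ?eqxx ?ne10 ?ne20 ?ne21 /= invr1 !mul1r !mulr1 => /eqP/commgP.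
Qed.

Lemma acute_base' t u : commute (XG e0 e1 t) (XG e2 e1 u).
Proof.
have [->|t0] := eqVneq t 0; first by rewrite XG0; exact/commute_sym/commute1.
have [->|u0] := eqVneq u 0; first by rewrite XG0; exact/commute1.
have [y Ny ym] := torus3 (invr_neq0 t0) (oner_neq0 _) (invr_neq0 u0).
have := congr1 (conjg^~ y) rel_c; rewrite /= conjRg conj1g sgE !XG_PS //.
rewrite /perm_ix /= tpermJ cycle_transp0 cycle_transp1 tpermL tpermD //=.
rewrite !(XG_J _ Ny ym) //=.
by rewrite ?eqxx ?ne10 ?ne20 ?ne21 /= !invrK !mulr1 => /eqP/commgP.
Qed.

(** The diagonal scalings k_0, k_1 multiply the parameters of the two root
    elements by k_1 / k_0 and by 1 / (k_0 k_1). To reach t and u one needs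
    k_0^2 = 1 / (t u), hence a square root. *)
Lemma orth_base t u : commute (XG e0 e1 t) (XG e0 (neg e1) u).
Proof.
have [->|t0] := eqVneq t 0; first by rewrite XG0; exact/commute_sym/commute1.
have [->|u0] := eqVneq u 0; first by rewrite XG0; exact/commute1.
have [r r2] := sqrt_pchar2 pchar2 (t * u)^-1.
have tu0 := mulf_neq0 t0 u0.
have r0 : r != 0 by apply: contraNneq tu0 => r0; rewrite -invr_eq0 -r2 r0 expr2 mul0r.
have [y Ny ym] := torus3 r0 (mulf_neq0 t0 r0) (oner_neq0 _).
have := congr1 (conjg^~ y) rel_e; rewrite /= conjRg conj1g sgE.
have ZVm : mono (pi ZV) (flip_ix [set i1; i2]) onec by rewrite pi_ZV; exact: flip_og_mono.
rewrite (XG_J1 _ NG_ZV ZVm) // /flip_ix /= !inE ne01 ne02 eqxx /=.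
rewrite !(XG_J _ Ny ym) //=.
rewrite ?eqxx ?ne10 ?ne20 ?ne21 /= !mulr1 mulrCA mulVf // mulr1.
have -> : r^-1 * (t * r)^-1 = u.
  by rewrite mulrC -invfM -mulrA -expr2 r2 invfM invrK mulrA mulVf // mul1r.
by move=> /eqP/commgP.
Qed.

(** For three signed indices there may be no further index, so the parity of
    the signs is a genuine condition. *)
Lemma place_triple a b d : root a b -> root a d -> root b d ->
    a.2 (+) b.2 (+) d.2 = false ->
  exists x w, [/\ NG x, mono (pi x) w onec & [/\ w e0 = a, w e1 = b & w e2 = d]].
Proof.
move=> ab ad bd par; have [s [s0 s1 s2]] := @perm3_ex _ n_gt2 a.1 b.1 d.1 ab ad bd.
have [||x [w [Nx xm weq]]] := @place s [:: a; b; d].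
- by rewrite /= !inE negb_or (ab : a.1 != b.1) (ad : a.1 != d.1) (bd : b.1 != d.1).
- by rewrite /= addn0 !oddD !oddb addbA.
by exists x, w; split=> //; split; apply: weq; rewrite ?inE ?eqxx ?orbT.
Qed.

(** If the parity of the signs of a, b, d is odd, that of -d, -b, -a is even,
    and X(a,b) = X(-b,-a) turns the relation for the second triple into the
    relation for the first with the two factors exchanged. *)
Lemma chevalley a b d t u : root a b -> root b d -> root a d ->
  [~ XG a b t, XG b d u]%g = XG a d (t * u)%R.
Proof.
move=> ab bd ad; case par: (a.2 (+) b.2 (+) d.2).
  have [||||x [w [Nx xm [w0 w1 w2]]]] := @place_triple (neg d) (neg b) (neg a).
  - by rewrite /root eq_sym.
  - by rewrite /root eq_sym.
  - by rewrite /root eq_sym.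
  - by rewrite /= ; case: (a.2) (b.2) (d.2) par => [] [] [].
  have := congr1 (conjg^~ x) (chev_base u t); rewrite /= conjRg !(XG_J1 _ Nx xm) //.
  rewrite w0 w1 w2 !XG_N // mulrC => /comm_eq ->.
  by rewrite XGV.
have [x [w [Nx xm [<- <- <-]]]] := place_triple ab ad bd par.
by rewrite -!(XG_J1 _ Nx xm) // -conjRg chev_base.
Qed.

Lemma commute_conj (x y z : G) : commute x y -> commute (x ^ z)%g (y ^ z)%g.
Proof. by move=> xy; rewrite /commute -!conjMg xy. Qed.

(** As in [chevalley], one of two triples of signs can be reached; the
    relations for the two triples come from different relations of the
    presentation, since the negation exchanges common sources and common
    targets. *)
Lemma acute a b d t u : root a b -> root a d -> root b d ->
  commute (XG a b t) (XG a d u).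
Proof.
move=> ab ad bd; case par: (a.2 (+) b.2 (+) d.2).
  have [||||x [w [Nx xm [w0 w1 w2]]]] := @place_triple (neg b) (neg a) (neg d).
  - by rewrite /root eq_sym.
  - by [].
  - by [].
  - by rewrite /=; case: (a.2) (b.2) (d.2) par => [] [] [].
  have := commute_conj x (acute_base' t u); rewrite !(XG_J1 _ Nx xm) //.
  by rewrite w0 w1 w2 !XG_N.
have [x [w [Nx xm [<- <- <-]]]] := place_triple ab ad bd par.
by rewrite -!(XG_J1 _ Nx xm) //; apply/commute_conj/acute_base.
Qed.

Lemma orthogonal a b t u : root a b -> commute (XG a b t) (XG a (neg b) u).
Proof.
move=> ab; have [x [w [Nx xm <- <-]]] := place_pair ab.
by rewrite -(mono_neg xm) -!(XG_J1 _ Nx xm) //; apply/commute_conj/orth_base.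
Qed.

(** Roots with a common source a: equal, differing in the sign of the target,
    or on three indices. *)
Lemma same_source a b d t u : root a b -> root a d ->
  commute (XG a b t) (XG a d u).
Proof.
move=> ab ad; have [bd|] := boolP (root b d); first exact: acute.
rewrite rootE negb_and !negbK => /orP[] /eqP e.
  by rewrite -e /commute !XGD // addrC.
by rewrite -(negK d) -e; exact: orthogonal.
Qed.

Lemma disj_base t u : (3 < n)%N -> commute (XG e0 e1 t) (XG e2 (v_ i2, false) u).
Proof.
move=> n3; have [e03 e13 e23] := cycle2_neq n_gt2 n3.
have [->|t0] := eqVneq t 0; first by rewrite XG0; exact/commute_sym/commute1.
have [->|u0] := eqVneq u 0; first by rewrite XG0; exact/commute1.
have [y Ny ym] := torus3 (oner_neq0 _) t0 (invr_neq0 u0).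
have := congr1 (conjg^~ y) (rel_d n3); rewrite /= conjRg conj1g sgE !XG_PS //.
rewrite /perm_ix /= expg2 !permM cycle0 cycle1 !(XG_J _ Ny ym) /root /= ?e23 //.
rewrite ?eqxx ?ne10 ?ne20 ?ne21 (eq_sym _ i0) (eq_sym _ i1) (eq_sym _ i2) e03 e13 e23 /=.
by rewrite invr1 invrK !mul1r !mulr1 => /eqP/commgP.
Qed.

Lemma disj_base' t u : n = 4%N -> commute (XG e0 e1 t) (XG e2 (v_ i2, true) u).
Proof.
move=> n4; have n3 : (3 < n)%N by rewrite n4.
have [e03 e13 e23] := cycle2_neq n_gt2 n3.
have [->|t0] := eqVneq t 0; first by rewrite XG0; exact/commute_sym/commute1.
have [->|u0] := eqVneq u 0; first by rewrite XG0; exact/commute1.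
have [y Ny ym] := torus3 (oner_neq0 _) t0 (invr_neq0 u0).
have ZVm : mono (pi ZV) (flip_ix [set i1; i2]) onec by rewrite pi_ZV; exact: flip_og_mono.
have := congr1 (conjg^~ y) (rel_f n4); rewrite /= conjRg conj1g sgE conjgM.
rewrite (XG_J1 _ NG_ZV ZVm) // /flip_ix /= !inE ne01 ne02 eqxx /= XG_PS //.
rewrite /perm_ix /= expg2 !permM cycle0 cycle1 !(XG_J _ Ny ym) /root /= ?e23 //.
rewrite ?eqxx ?ne10 ?ne20 ?ne21 (eq_sym _ i0) (eq_sym _ i1) (eq_sym _ i2) e03 e13 e23 /=.
by rewrite !invr1 invrK !mul1r !mulr1 => /eqP/commgP.
Qed.

(** The four signs have odd or even parity. Even parity is reached from the
    standard position. Odd parity is reached too if there is a fifth index,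
    whose sign is changed as well; for n = 4 it is a separate orbit, with its
    own relation. *)
Lemma disjoint_roots a b c d t u : root a b -> root c d ->
    root a c -> root a d -> root b c -> root b d ->
  commute (XG a b t) (XG c d u).
Proof.
move=> ab cd ac ad bc bd.
pose l4 := [:: a; b; c; d].
have ul : uniq (map fst l4).
  rewrite /= !inE !negb_or (ab : a.1 != b.1) (ac : a.1 != c.1) (ad : a.1 != d.1).
  by rewrite (bc : b.1 != c.1) (bd : b.1 != d.1) (cd : c.1 != d.1).
have n3 : (3 < n)%N.
  by have := max_card (mem (map fst l4)); rewrite (card_uniqP ul) card_ord.
have [e03 e13 e23] := cycle2_neq n_gt2 n3.
have [s [s0 s1 s2 s3]] : exists s, [/\ s i0 = a.1, s i1 = b.1, s i2 = c.1 & s (v_ i2) = d.1].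
  have [s [s0 s1 s2]] := @perm3_ex _ n_gt2 a.1 b.1 c.1 ab ac bc.
  exists (s * tperm (s (v_ i2)) d.1)%g; rewrite !permM tpermL.
  have sne i : (i == v_ i2) = false -> s (v_ i2) != s i.
    by move=> e; rewrite (inj_eq perm_inj) eq_sym e.
  by split=> //; rewrite tpermD ?sne ?s0 ?s1 ?s2 //; rewrite eq_sym.
have mem4 (l : seq (sidx n)) (e f g h : sidx n) :
    [&& e \in l, f \in l, g \in l & h \in l] -> forall w : sidx n -> sidx n,
    (forall i (k : sidx n), k \in l -> s i = k.1 -> w (i, false) = k) ->
    s i0 = e.1 -> s i1 = f.1 -> s i2 = g.1 -> s (v_ i2) = h.1 ->
  [/\ w e0 = e, w e1 = f, w e2 = g & w (v_ i2, false) = h].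
  by case/and4P=> el fl gl hl w weq *; split; apply: weq.
have finish (z : bool) x w : NG x -> mono (pi x) w onec ->
    w e0 = a -> w e1 = b -> w e2 = c -> w (v_ i2, z) = d ->
    (forall t u, commute (XG e0 e1 t) (XG e2 (v_ i2, z) u)) ->
  commute (XG a b t) (XG c d u).
  move=> Nx xm w0 w1 w2 w3 base; rewrite -w0 -w1 -w2 -w3 -!(XG_J1 _ Nx xm) ?/root //= ?e23 //.
  exact/commute_conj/base.
case par: (odd (count snd l4)); last first.
  have [x [w [Nx xm weq]]] := place s ul par.
  have [|w0 w1 w2 w3] := mem4 _ a b c d _ w weq s0 s1 s2 s3.
    by rewrite !inE !eqxx !orbT.
  by apply: (finish false x w) => // *; exact: disj_base.
(* Odd parity from here on. *)
have [n4|n4] := eqVneq n 4%N.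
  have [||x [w [Nx xm weq]]] := @place s [:: a; b; c; neg d].
  - by move: ul.
  - by move: par; rewrite /= !addn0 !oddD !oddb; case: (a.2) (b.2) (c.2) (d.2) => [] [] [] [].
  have [|w0 w1 w2 w3] := mem4 _ a b c (neg d) _ w weq s0 s1 s2 s3.
    by rewrite !inE !eqxx !orbT.
  apply: (finish true x w) => // [|*]; last exact: disj_base'.
  by rewrite -[(v_ i2, true)]/(neg (v_ i2, false)) (mono_neg xm) w3 negK.
have [k kl] : exists k, k \notin map fst l4.
  apply: contrapT => no; have : (n <= size (map fst l4))%N.
    rewrite -(card_uniqP ul) -[n in (n <= _)%N]card_ord; apply/subset_leq_card/subsetP => k _.
    by apply: contrapT => /negP kl; apply: no; exists k.
  by rewrite size_map leq_eqVlt (negPf n4) ltnNge n3.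
have [||x [w [Nx xm weq]]] := @place s [:: (k, true), a, b, c & [:: d]].
- by rewrite -[uniq _]/((k \notin map fst l4) && uniq (map fst l4)) kl ul.
- by rewrite -[count _ _]/(1 + count snd l4)%N oddD par.
have [|w0 w1 w2 w3] := mem4 _ a b c d _ w weq s0 s1 s2 s3.
  by rewrite !inE !eqxx !orbT.
by apply: (finish false x w) => // *; exact: disj_base.
Qed.

Lemma commute_steinberg a b c d t u :
  commute (XG a b t) (XG c d u) -> steinberg_prop XG a b c d t u.
Proof. by move=> /commgP/eqP; left. Qed.

Lemma steinberg_negr a b c d t u : root c d ->
  steinberg_prop XG a b (neg d) (neg c) t u -> steinberg_prop XG a b c d t u.
Proof.
move=> cd; rewrite /steinberg_prop XG_N // => -[|[e [f [k [ef eq w]]]]]; first by left.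
right; exists e, f, k; split=> // p pN; rewrite w // !pN; ring.
Qed.

Lemma steinberg_negl a b c d t u : root a b ->
  steinberg_prop XG (neg b) (neg a) c d t u -> steinberg_prop XG a b c d t u.
Proof.
move=> ab; rewrite /steinberg_prop XG_N // => -[|[e [f [k [ef eq w]]]]]; first by left.
right; exists e, f, k; split=> // p pN; rewrite w // !pN; ring.
Qed.

Lemma steinberg_sym a b c d t u :
  steinberg_prop XG c d a b u t -> steinberg_prop XG a b c d t u.
Proof.
rewrite /steinberg_prop -(invgR (XG c d u)) => -[->|[e [f [k [ef -> w]]]]].
  by left; rewrite invg1.
by right; exists e, f, k; split=> // [|p pN]; rewrite ?XGV // w // addrC.
Qed.

(** The roots a -> b and b -> d have the sum a -> d, except if d is the
    negative of a, when the two root elements commute. *)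
Lemma steinberg_mid a b d t u : root a b -> root b d -> a != d ->
  steinberg_prop XG a b b d t u.
Proof.
move=> ab bd nad; have [ad|] := boolP (root a d).
  right; exists a, d, (t * u); split=> //; first exact: chevalley.
  by move=> p pN; ring.
rewrite rootE nad /= negbK => /eqP ead.
apply: steinberg_negr => //; apply: commute_steinberg.
by rewrite -ead; apply: same_source.
Qed.

Lemma root_negr a b : root a (neg b) = root a b. Proof. by []. Qed.

(** After replacing (c, d) by (-d, -c) and exchanging the two roots as needed,
    the roots are disjoint, have a common source, or the target of one is the
    source of the other. *)
Lemma steinberg a b c d t u : root a b -> root c d ->
    ~~ ((c == b) && (d == a)) -> ~~ ((c == neg a) && (d == neg b)) ->
  steinberg_prop XG a b c d t u.
Proof.
move=> ab cd; rewrite negb_and => n1; rewrite negb_and => n2.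
have ba : root b a by rewrite rootC.
have dc : root d c by rewrite rootC.
have eqs (x y : sidx n) : root x y = false -> y = x \/ y = neg x.
  by rewrite rootE => /negbT; rewrite negb_and !negbK => /orP[]/eqP->; rewrite ?negK; [left|right].
case ac: (root a c); last first.
  case/eqs: ac n2 cd dc => -> n2 cd' dc'; first exact/commute_steinberg/same_source.
  apply: steinberg_negr => //; rewrite negK; apply: steinberg_sym.
  apply: steinberg_mid => //.
  by move: n2; rewrite eqxx /= eq_negl.
case ad: (root a d); last first.
  case/eqs: ad n1 cd => -> n1 cd'.
    by apply: steinberg_sym; apply: steinberg_mid => //; move: n1; rewrite eqxx /= orbF.
  apply: steinberg_negr => //; rewrite negK.
  by apply/commute_steinberg/same_source => //; rewrite root_negr.
case bc: (root b c); last first.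
  case/eqs: bc n1 cd dc => -> n1 cd' dc'.
    by apply: steinberg_mid => //; move: n1; rewrite eqxx /= eq_sym.
  by apply: steinberg_negl => //; apply/commute_steinberg/same_source.
case bd: (root b d); last first.
  case/eqs: bd n2 cd dc => -> n2 cd' dc'.
    apply: steinberg_negl => //; apply: steinberg_negr => //.
    exact/commute_steinberg/same_source.
  apply: steinberg_negr => //; rewrite negK; apply: steinberg_mid => //.
  by move: n2; rewrite eqxx /= orbF eq_sym -eq_negl.
exact/commute_steinberg/disjoint_roots.
Qed.

(** ** Weyl elements *)

Lemma weyl_base t : t != 0 -> exists2 h, NG h &
  (XG e0 e1 t * PS u_)%g = (XG e1 e0 t^-1%R * h * XG e0 e1 t^-1%R)%g.
Proof.
move=> t0; have [h [Nh Sh ph]] := SLG_torus t0.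
have S10 : SLG (XG e1 e0 t^-1).
  have -> : XG e1 e0 t^-1 = (XG e0 e1 t^-1%R ^ PS u_)%g.
    by rewrite XG_PS // /perm_ix /= tpermL tpermR.
  by rewrite conjgE; exact: (SLGM (SLGV SLG_PS) (SLGM (SLG_XG _) SLG_PS)).
exists h => //; apply: SLG_inj.
- exact: (SLGM (SLG_XG _) SLG_PS).
- exact: (SLGM (SLGM S10 Sh) (SLG_XG _)).
by rewrite !piM !pi_XG // pi_PS ph weyl_sl2.
Qed.

(** The Weyl element of the root a -> b is a conjugate of U; it exchanges a
    and b and fixes the basis vectors of all other pairs. *)
Lemma weyl_element a b : root a b -> exists y w,
  [/\ NG y, mono (pi y) w onec, w a = b, w b = a &
    (forall d, root a d -> root b d -> w d = d) /\
    forall t, t != 0 -> exists2 h, NG h &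
      (XG a b t * y)%g = (XG b a t^-1%R * h * XG a b t^-1%R)%g].
Proof.
move=> ab; have [x [w [Nx xm wa wb]]] := place_pair ab.
have [w' [wK w'K xm']] := mono_inv xm.
have ym := monoM (monoM xm' (perm_og_mono F u_)) xm.
exists (PS u_ ^ x)%g, (w \o (perm_ix u_ \o w')); split.
- by rewrite conjgE; exact: (NGM (NGV Nx) (NGM (NG_PS _) Nx)).
- rewrite piJ pi_PS conjgE mulgA; apply: mono_ext ym _ _ => // d.
  by rewrite /= /unit_co invr1 !mulr1.
- by rewrite /= -wa wK /perm_ix /= tpermL.
- by rewrite /= -wb wK /perm_ix /= tpermR.
split=> [d ad bd|t t0].
  have rd (z : sidx n) : root (w z) d = root z (w' d) by rewrite -{1}(w'K d) /root (mono_fst xm).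
  move: ad bd; rewrite -wa -wb !rd /root /= => ad bd.
  by rewrite /= /perm_ix tpermD // -surjective_pairing w'K.
have [h Nh eqh] := weyl_base t0; exists (h ^ x)%g.
  by rewrite conjgE; exact: (NGM (NGV Nx) (NGM Nh Nx)).
rewrite -wa -wb -!(XG_J1 _ Nx xm) // -!conjMg.
by congr (_ ^ _)%g.
Qed.

End RootSubgroups.

(** * Positive roots, the unipotent subgroup and the Bruhat decomposition *)

Section Weights.
Local Open Scope ring_scope.
Variable n : nat.
Implicit Types a b : sidx n.

(** The weight orders the basis as e_1, ..., e_n, f_n, ..., f_1; a root is positive
    when its root elements are upper unitriangular in this order. *)
Definition wt a : int := if a.2 then (n - a.1)%N%:Z else - (n - a.1)%N%:Z.

Lemma wtN a : wt (neg a) = - wt a.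
Proof. by case: a => i []; rewrite /wt /= ?opprK. Qed.

Lemma wt_inj : injective wt.
Proof.
move=> [i x] [j y]; rewrite /wt /= => e.
have ij : i = j by apply: val_inj; move: e (ltn_ord i) (ltn_ord j); case: x y => [] [] /=; lia.
by move: e; rewrite ij; move: (ltn_ord j); case: x y => [] [] //=; lia.
Qed.

Lemma wt_bounds a : [/\ wt a != 0, - n%:Z <= wt a & wt a <= n%:Z].
Proof. by case: a => i x; rewrite /wt /=; move: (ltn_ord i); case: x => /=; split; lia. Qed.

(** A rank function on positive roots: it separates roots, and a root of larger
    height has larger rank. *)
Definition kappa a b : nat :=
  (absz (wt b - wt a)%R * (2 * n).+1 + absz (wt a + wt b)%R)%N.

Lemma kappaN a b : kappa (neg b) (neg a) = kappa a b.
Proof. by rewrite /kappa !wtN; congr (_ * _ + _)%N; lia. Qed.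

Lemma kappa_bound a b : (kappa a b < (2 * n).+1 * (2 * n).+1)%N.
Proof.
have [_ a1 a2] := wt_bounds a; have [_ b1 b2] := wt_bounds b.
have h1 : (absz (wt b - wt a)%R <= 2 * n)%N by lia.
have h2 : (absz (wt a + wt b)%R <= 2 * n)%N by lia.
rewrite /kappa; nia.
Qed.

Lemma kappa_lt a b c d : wt a < wt b -> wt b - wt a < wt d - wt c ->
  (kappa a b < kappa c d)%N.
Proof.
move=> ab abcd; rewrite /kappa.
have [_ a1 a2] := wt_bounds a; have [_ b1 b2] := wt_bounds b.
have h1 : (absz (wt b - wt a)%R < absz (wt d - wt c)%R)%N by lia.
have h2 : (absz (wt a + wt b)%R <= 2 * n)%N by lia.
nia.
Qed.

Lemma kappa_inj a b c d : wt a < wt b -> wt c < wt d -> kappa a b = kappa c d ->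
  (c, d) = (a, b) \/ (c, d) = (neg b, neg a).
Proof.
move=> ab cd; rewrite /kappa => e.
have [_ a1 a2] := wt_bounds a; have [_ b1 b2] := wt_bounds b.
have [_ c1 c2] := wt_bounds c; have [_ d1 d2] := wt_bounds d.
have h1 : (absz (wt a + wt b)%R < (2 * n).+1)%N by lia.
have h2 : (absz (wt c + wt d)%R < (2 * n).+1)%N by lia.
have e1 : absz (wt b - wt a)%R = absz (wt d - wt c)%R.
  have := congr1 (fun m => m %/ (2 * n).+1)%N e.
  by rewrite !divnMDl // !divn_small // !addn0.
have e2 : absz (wt a + wt b)%R = absz (wt c + wt d)%R by move: e; rewrite e1 => /addnI.
have [s|s] : wt a + wt b = wt c + wt d \/ wt a + wt b = - (wt c + wt d) by lia.
  by left; congr (_, _); apply: wt_inj; lia.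
by right; congr (_, _); apply: wt_inj; rewrite wtN; lia.
Qed.

Lemma wt_root_neq a b : root a b -> [/\ wt a != wt b & wt a != - wt b].
Proof.
by rewrite rootE -wtN !(inj_eq wt_inj) => /andP[].
Qed.

(** The simple roots; the second kind is the branch of the diagram at the last
    two hyperbolic pairs. *)
Definition simple a b :=
  root a b /\ (wt b = wt a + 1 \/ wt a = - 2%:Z /\ wt b = 1).

Lemma simple_pos a b : simple a b -> wt a < wt b.
Proof. by case=> _ [->|[-> ->]]; lia. Qed.

(** A simple reflection permutes the positive roots other than its own.
    Everything is expressed by weights, where it becomes linear arithmetic. *)
Lemma simple_reflection a b (w : sidx n -> sidx n) :
    simple a b -> w a = b -> w b = a -> (forall d, w (neg d) = neg (w d)) ->
    (forall d, root a d -> root b d -> w d = d) ->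
  forall c d, root c d -> wt c < wt d ->
    (c, d) <> (a, b) -> (c, d) <> (neg b, neg a) -> wt (w c) < wt (w d).
Proof.
move=> [ab sab] wa wb wN wfix c d cd pcd n1 n2.
have wtw x : [\/ [/\ x = a & wt (w x) = wt b], [/\ x = b & wt (w x) = wt a],
                [/\ x = neg a & wt (w x) = - wt b] | [/\ x = neg b & wt (w x) = - wt a]]
         \/ [/\ wt (w x) = wt x, wt x != wt a, wt x != wt b, wt x != - wt a & wt x != - wt b].
  have [->|xa] := eqVneq x a; first by left; apply: Or41; rewrite wa.
  have [->|xb] := eqVneq x b; first by left; apply: Or42; rewrite wb.
  have [->|xna] := eqVneq x (neg a); first by left; apply: Or43; rewrite wN wa wtN.
  have [->|xnb] := eqVneq x (neg b); first by left; apply: Or44; rewrite wN wb wtN.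
  right; rewrite -!wtN !(inj_eq wt_inj) xa xb xna xnb wfix //.
    by rewrite rootE (eq_sym a) xa (eq_negr a) xna.
  by rewrite rootE (eq_sym b) xb (eq_negr b) xnb.
have [w0 _ _] := wt_bounds c; have [w0' _ _] := wt_bounds d.
have [cd1 cd2] := wt_root_neq cd.
have n1' : ~ (wt c = wt a /\ wt d = wt b).
  by move=> [/wt_inj ca /wt_inj db]; apply: n1; rewrite ca db.
have n2' : ~ (wt c = - wt b /\ wt d = - wt a).
  by rewrite -!wtN => -[/wt_inj ca /wt_inj db]; apply: n2; rewrite ca db.
have {wtw} wtw x : (wt x = wt a /\ wt (w x) = wt b) \/ (wt x = wt b /\ wt (w x) = wt a) \/
    (wt x = - wt a /\ wt (w x) = - wt b) \/ (wt x = - wt b /\ wt (w x) = - wt a) \/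
    (wt (w x) = wt x /\ wt x <> wt a /\ wt x <> wt b /\ wt x <> - wt a /\ wt x <> - wt b).
  case: (wtw x) => [[[-> ->]|[-> ->]|[-> ->]|[-> ->]]|[-> /eqP ? /eqP ? /eqP ? /eqP ?]];
    rewrite ?wtN; tauto.
move: (wtw c) (wtw d) sab n1' n2' pcd w0 w0' cd1 cd2.
move: (wt (w c)) (wt (w d)) (wt c) (wt d) (wt a) (wt b) => c' d' C D A B.
move=> Hc Hd [EB|[EA EB]] n1' n2' pcd /eqP C0 /eqP D0 /eqP CD1 /eqP CD2;
  case: Hc => [[? ->]|[[? ->]|[[? ->]|[[? ->]|[-> [? [? [? ?]]]]]]]];
  case: Hd => [[? ->]|[[? ->]|[[? ->]|[[? ->]|[-> [? [? [? ?]]]]]]]]; lia.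
Qed.

End Weights.

Section Bruhat.
Local Open Scope ring_scope.
Variables (n : nat) (F : finFieldType).
Hypothesis n_gt2 : (2 < n)%N.
Hypothesis pchar2 : 2%N \in [pchar F].
Variables (G : groupType) (pi : G -> ogroup n F).
Hypothesis piM : forall x y, pi (x * y)%g = (pi x * pi y)%g.
Implicit Types (s : {perm 'I_n}) (i j : 'I_n) (x y z : G) (a b c d : sidx n) (t u : F).
Local Notation onec := (fun=> 1 : F).

Variable NG : G -> Prop.
Hypothesis NGM : forall x y, NG x -> NG y -> NG (x * y)%g.
Hypothesis NGV : forall x, NG x -> NG x^-1%g.
Hypothesis NG_mono : forall x, NG x -> exists w (k : sidx n -> F), mono (pi x) w k.
Hypothesis NG_inj : forall x y, NG x -> NG y -> pi x = pi y -> x = y.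
Variable XG : sidx n -> sidx n -> F -> G.
Hypothesis XG0 : forall a b, XG a b 0 = 1%g.
Hypothesis pi_XG : forall a b t, root a b -> pi (XG a b t) = X a b t.
Hypothesis XG_J : forall y w (k : sidx n -> F) a b t, NG y -> mono (pi y) w k -> root a b ->
  (XG a b t ^ y)%g = XG (w a) (w b) ((k a)^-1 * k b * t).
Hypothesis XGD : forall a b t u, root a b -> (XG a b t * XG a b u)%g = XG a b (t + u).
Hypothesis XGV : forall a b t, root a b -> (XG a b t)^-1%g = XG a b t.
Hypothesis XG_N : forall a b t, root a b -> XG (neg b) (neg a) t = XG a b t.
Hypothesis steinberg : forall a b c d t u, root a b -> root c d ->
    ~~ ((c == b) && (d == a)) -> ~~ ((c == neg a) && (d == neg b)) ->
  steinberg_prop XG a b c d t u.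
Hypothesis weyl_element : forall a b, root a b -> exists y w,
  [/\ NG y, mono (pi y) w onec, w a = b, w b = a &
    (forall d, root a d -> root b d -> w d = d) /\
    forall t, t != 0 -> exists2 h, NG h &
      (XG a b t * y)%g = (XG b a t^-1%R * h * XG a b t^-1%R)%g].

Let pi1 : pi 1%g = 1%g.
Proof. by apply: (mulgI (pi 1%g)); rewrite -piM !mulg1. Qed.
Let piV x : pi x^-1%g = (pi x)^-1%g.
Proof. by apply: (mulgI (pi x)); rewrite -piM !mulgV pi1. Qed.

Definition Uroots (S : sidx n -> sidx n -> Prop) : G -> Prop :=
  gen (fun x => exists a b t, [/\ root a b, S a b & x = XG a b t]).

Lemma Uroots_in (S : sidx n -> sidx n -> Prop) a b t : root a b -> S a b -> Uroots S (XG a b t).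
Proof. by move=> ab Sab; apply: gen_in; exists a, b, t. Qed.

Lemma UrootsM S x y : Uroots S x -> Uroots S y -> Uroots S (x * y)%g.
Proof. exact: genM. Qed.

Lemma UrootsV S x : Uroots S x -> Uroots S x^-1%g.
Proof.
apply: genV => {}x [a [b [t [ab Sab ->]]]].
by rewrite XGV //; exact: Uroots_in.
Qed.

Lemma Uroots_sub (S T : sidx n -> sidx n -> Prop) :
  (forall a b, root a b -> S a b -> T a b) -> forall x, Uroots S x -> Uroots T x.
Proof.
move=> ST; apply: gen_sub => x [a [b [t [ab Sab ->]]]].
by apply: Uroots_in => //; exact: ST.
Qed.

(** A root subgroup can be split off when the remaining roots contain all roots
    of larger height: by the commutator relations it normalises the rest. *)
Lemma Uroots_split (S T : sidx n -> sidx n -> Prop) a b :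
    root a b -> wt a < wt b ->
    (forall c d, root c d -> S c d ->
       [\/ T c d, (c, d) = (a, b) | (c, d) = (neg b, neg a)]) ->
    (forall c d, T c d -> wt c < wt d) ->
    (forall c d, root c d -> wt b - wt a < wt d - wt c -> T c d) ->
  forall x, Uroots S x -> exists t y, x = (XG a b t * y)%g /\ Uroots T y.
Proof.
move=> ab pab ST Tpos Tbig.
have normX y u : Uroots T y -> Uroots T (y ^ XG a b u)%g.
  elim=> [|y1 z _ IHy [c [d [r [cd Tcd ->]]]]]; first by rewrite conj1g; exact: gen1.
  rewrite conjMg; apply: UrootsM => //; have pcd := Tpos _ _ Tcd.
  have -> : (XG c d r ^ XG a b u = XG c d r * [~ XG c d r, XG a b u])%g.
    by rewrite commgEl mulKVg.
  apply: UrootsM; first exact: Uroots_in.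
  have [||->|[e [f [k [ef -> w]]]]] := @steinberg c d a b r u cd ab.
  - by apply/negP => /andP[/eqP e1 /eqP e2]; move: pcd pab; rewrite e1 e2; lia.
  - by apply/negP => /andP[/eqP e1 /eqP e2]; move: pcd pab; rewrite e1 e2 !wtN; lia.
  - exact: gen1.
  apply: Uroots_in => //; apply: Tbig => //; rewrite (w _ (@wtN n)).
  by move: pcd; lia.
move=> x; elim=> [|y z _ [t [y' [-> Ty']]] [c [d [r [cd Scd ->]]]]].
  by exists 0, 1%g; rewrite XG0 mulg1; split=> //; exact: gen1.
have absorb k : exists t1 y1, (XG a b t * y' * XG a b k)%g = (XG a b t1 * y1)%g /\ Uroots T y1.
  exists (t + k), (y' ^ XG a b k)%g; split; last exact: normX.
  by rewrite -XGD // -!mulgA -conjgC.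
case: (ST c d cd Scd) => [Tcd|[-> ->]|[-> ->]]; last 2 first.
- exact: absorb.
- by rewrite XG_N.
exists t, (y' * XG c d r)%g; rewrite mulgA; split=> //.
by apply: UrootsM => //; exact: Uroots_in.
Qed.

(** ** The matrices separate unipotent elements *)

Local Notation ent M a b := (co (@bv n F a *m M) b).

(** The matrix is 1 plus a matrix supported on the positions (a, c) that are
    positive of rank at least k. *)
Definition unitri k (M : 'M[F]_(n + n)) := forall a c,
  [/\ ent M a a = 1 & a != c -> ~~ ((wt a < wt c) && (k <= kappa a c)%N) -> ent M a c = 0].

Lemma ent_mul M N a c : ent (M *m N) a c = \sum_b ent M a b * ent N b c.
Proof.
rewrite mulmxA {1}(vec_expand (@bv n F a *m M)) mulmx_suml co_sum.
by apply: eq_bigr => b _; rewrite -scalemxAl coZ.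
Qed.

Lemma unitri_mul k M N : unitri k M -> unitri k N -> unitri k (M *m N).
Proof.
move=> HM HN a c; rewrite !ent_mul.
have zero b e : b != a -> b != e -> ~~ [&& wt a < wt b, (k <= kappa a b)%N & wt b < wt e] ->
    ent M a b * ent N b e = 0.
  move=> ba bc; have [_ Mab] := HM a b; have [_ Nbc] := HN b e.
  case abp: ((wt a < wt b) && (k <= kappa a b)%N); last first.
    by rewrite Mab ?mul0r 1?eq_sym // abp.
  rewrite andbA abp /= => bcp; rewrite Nbc ?mulr0 //.
  by rewrite (negPf bcp).
split=> [|ac hac].
  rewrite (bigD1 a) //= big1 ?addr0 => [|b ba].
    by have [-> _] := HM a a; have [-> _] := HN a a; rewrite mulr1.
  by apply: zero => //; apply/negP => /and3P[ab _ ba']; move: ab ba'; lia.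
apply: big1 => b _; have [->|ba] := eqVneq b a.
  by have [_ ->] := HN a c; rewrite ?mulr0.
have [->|bc] := eqVneq b c.
  by have [_ ->] := HM a c; rewrite ?mul0r.
apply: zero => //; apply: contra hac => /and3P[ab kab bc'].
have abac : wt b - wt a < wt c - wt a by move: bc'; lia.
rewrite (leq_trans kab (ltnW (kappa_lt ab abac))) andbT.
by move: ab bc'; lia.
Qed.

Lemma unitri_1 k : unitri k 1%:M.
Proof.
move=> a c; rewrite !mulmx1 !co_bv eqxx; split=> // /negPf ac _.
by rewrite ac.
Qed.

Lemma unitri_X k a b t : root a b -> wt a < wt b -> (k <= kappa a b)%N ->
  unitri k (X a b t : ogroup n F).
Proof.
move=> ab pab kab c d; rewrite !(actX pchar2) // !coE.
have [e1 e2 e3 e4] := root_neqs ab.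
split=> [|/negPf cd hcd].
  rewrite eqxx; have [->|_] := eqVneq c a.
    by rewrite e2 e3 !(mulr0, mul0r, addr0).
  have [->|_] := eqVneq c (neg b); last by rewrite !(mulr0, mul0r, addr0).
  by rewrite eq_neg e1 !(mulr0, mul0r, addr0).
rewrite cd add0r -!mulrA; have -> : (c == a)%:R * (b == d)%:R = 0 :> F.
  have [ca|_] := eqVneq c a; last by rewrite mul0r.
  have [bd|_] := eqVneq b d; last by rewrite mulr0.
  by move: hcd; rewrite ca -bd pab kab.
have -> : (c == neg b)%:R * (neg a == d)%:R = 0 :> F.
  have [cb|_] := eqVneq c (neg b); last by rewrite mul0r.
  have [ad|_] := eqVneq (neg a) d; last by rewrite mulr0.
  by move: hcd; rewrite cb -ad kappaN kab !wtN; move: pab; lia.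
by rewrite !mulr0 addr0.
Qed.

Lemma Uroots_unitri k (S : sidx n -> sidx n -> Prop) :
    (forall a b, S a b -> wt a < wt b /\ (k <= kappa a b)%N) ->
  forall x, Uroots S x -> unitri k (pi x).
Proof.
move=> Sk x; elim=> [|y z _ IHy [a [b [t [ab Sab ->]]]]].
  by rewrite pi1; exact: unitri_1.
rewrite piM; apply: unitri_mul => //; rewrite pi_XG //.
by case: (Sk _ _ Sab) => pab kab; exact: unitri_X.
Qed.

Definition pos k a b := wt a < wt b /\ (k <= kappa a b)%N.

(** Split off the root of rank k. Its parameter is an entry of the matrix pi x
    in which the remaining factor has no contribution, so the parameter is 0. *)
Lemma Uroots_step k x : Uroots (pos k) x -> pi x = 1%g -> Uroots (pos k.+1) x.
Proof.
move=> Ux px.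
have [[a [b [ab [pab kab]]]]|no] := pselect (exists a b, root a b /\ (wt a < wt b /\ kappa a b = k)); last first.
  apply: Uroots_sub Ux => a b ab [pab kab]; split=> //.
  rewrite ltn_neqAle kab andbT; apply/negP => /eqP e.
  by apply: no; exists a, b.
have [|||t [y [ex Uy]]] := @Uroots_split (pos k) (pos k.+1) a b ab pab _ _ _ x Ux.
- move=> c d cd [pcd kcd]; case: (eqVneq k (kappa c d)) => [e|ne].
    have [->|->] := kappa_inj pab pcd (etrans kab e); [exact: Or32|exact: Or33].
  by apply: Or31; split=> //; rewrite ltn_neqAle ne.
- by move=> c d [].
- move=> c d cd hcd; split; first by move: pab hcd; lia.
  by rewrite -kab kappa_lt.
suff t0 : t = 0 by rewrite ex t0 XG0 mul1g.
have uy : unitri k.+1 (pi y) by apply: Uroots_unitri Uy => c d [].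
have [_ yab] := uy a b; have [ybb _] := uy b b.
have [e1 e2 e3 e4] := root_neqs ab.
have := congr1 (fun g : ogroup n F => co (@bv n F a *m g) b) px.
rewrite /= vmul1 co_bv e1 ex piM vmulM pi_XG // (actX pchar2) // !co_bv eqxx e3.
rewrite mulr0 scale0r addr0 mulr1 mulmxDl -scalemxAl !coE ybb mulr1 yab ?add0r //.
  by rewrite e1.
by rewrite kab ltnn andbF.
Qed.

Lemma Uroots_inj k x : Uroots (pos k) x -> pi x = 1%g -> x = 1%g.
Proof.
move=> Ux px; have Ukm m : Uroots (pos (k + m)) x.
  by elim: m => [|m IHm]; rewrite ?addn0 ?addnS //; exact: Uroots_step.
have := Ukm ((2 * n).+1 * (2 * n).+1)%N.
elim=> // y z _ -> [a [b [t [_ [_ kab] _]]]]; move: kab.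
by rewrite leqNgt (leq_trans (kappa_bound a b)) // leq_addl.
Qed.

(** ** The double cosets of the unipotent subgroup *)

Definition Upos := Uroots (pos 0).

Definition UNU x := exists u m v : G, [/\ Upos u, NG m, Upos v & x = (u * m * v)%g].

Definition absorbs g := forall x, UNU x -> UNU (x * g)%g.

Lemma absorbsM g h : absorbs g -> absorbs h -> absorbs (g * h)%g.
Proof. by move=> ag ah x Bx; rewrite mulgA; apply/ah/ag. Qed.

Lemma absorbs_U g : Upos g -> absorbs g.
Proof.
move=> Ug x [u [m [v [Uu Nm Uv ->]]]]; exists u, m, (v * g)%g.
by split=> //; [exact: UrootsM | rewrite mulgA].
Qed.

Lemma Upos_in a b t : root a b -> wt a < wt b -> Upos (XG a b t).
Proof. by move=> ab pab; apply: Uroots_in. Qed.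

Lemma Uroots_J (S T : sidx n -> sidx n -> Prop) y w (k : sidx n -> F) :
    NG y -> mono (pi y) w k ->
    (forall a b, root a b -> S a b -> T (w a) (w b)) ->
  forall x, Uroots S x -> Uroots T (x ^ y)%g.
Proof.
move=> Ny ym ST x; elim=> [|x1 z _ IHx [a [b [t [ab Sab ->]]]]].
  by rewrite conj1g; exact: gen1.
rewrite conjMg; apply: UrootsM => //; rewrite (XG_J t Ny ym ab).
by apply: Uroots_in; [rewrite /root (mono_fst ym) | exact: ST].
Qed.

Lemma absorbs_torus y (k : sidx n -> F) : NG y -> mono (pi y) id k -> absorbs y.
Proof.
move=> Ny ym x [u [m [v [Uu Nm Uv ->]]]]; exists u, (m * y)%g, (v ^ y)%g; split=> //.
- exact: NGM.
- exact: (Uroots_J Ny ym) Uv.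
by rewrite -!mulgA -conjgC.
Qed.

Lemma pass_left (u m x v y : G) :
  (u * m * (x * v) * y = u * x ^ m^-1 * (m * y) * v ^ y)%g.
Proof. by rewrite !conjgE !mulgA invgK mulgVK mulgK. Qed.

Lemma exchange (u m x v y z h x' : G) : (x * y = z * h * x')%g ->
  (u * m * (x * v) * y = u * z ^ m^-1 * (m * h) * (x' * v ^ y))%g.
Proof.
move=> e; have -> : (u * m * (x * v) * y = u * m * (x * y) * v ^ y)%g.
  by rewrite -!mulgA -conjgC.
by rewrite e conjgE !mulgA invgK mulgVK.
Qed.

(** The key step of the Bruhat decomposition: the root subgroup of a simple root
    either passes to the left of the monomial factor or, by the identity of rank
    one, is exchanged for the opposite root subgroup, which does. *)
Lemma absorbs_simple a b y w : simple a b -> NG y -> mono (pi y) w onec ->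
    w a = b -> w b = a -> (forall d, root a d -> root b d -> w d = d) ->
    (forall t, t != 0 -> exists2 h, NG h &
      (XG a b t * y)%g = (XG b a t^-1%R * h * XG a b t^-1%R)%g) ->
  absorbs y.
Proof.
move=> sab Ny ym wa wb wfix wstep x [u [m [v [Uu Nm Uv ->]]]].
have ab : root a b by case: sab.
have pab := simple_pos sab.
pose T c d := wt c < wt d /\ ~ ((c, d) = (a, b) \/ (c, d) = (neg b, neg a)).
have [|||t [v' [-> Tv']]] := @Uroots_split (pos 0) T a b ab pab _ _ _ v Uv.
- move=> c d cd [pcd _]; have [e|ne] := pselect ((c, d) = (a, b)); first exact: Or32.
  have [e|ne'] := pselect ((c, d) = (neg b, neg a)); first exact: Or33.
  by apply: Or31; split=> // -[].
- by move=> c d [].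
- move=> c d cd hcd; split; first by move: pab hcd; lia.
  by case=> -[ec ed]; move: hcd; rewrite ec ed ?wtN; lia.
have Uvy : Upos (v' ^ y)%g.
  apply: (Uroots_J Ny ym) Tv' => c d cd [pcd ncd]; split=> //.
  by apply: (simple_reflection sab wa wb (mono_neg ym) wfix) => // e; apply: ncd; [left|right].
have [w1 [k1 m1]] := NG_mono (NGV Nm).
have [->|t0] := eqVneq t 0.
  rewrite XG0 mul1g; exists u, (m * y)%g, (v' ^ y)%g; split=> //; first exact: NGM.
  by rewrite -!mulgA -conjgC.
have w1ab : root (w1 a) (w1 b) by rewrite /root (mono_fst m1).
have w1ba : root (w1 b) (w1 a) by rewrite rootC.
have [lt|ge] := boolP (wt (w1 a) < wt (w1 b)).
  exists (u * XG a b t ^ m^-1)%g, (m * y)%g, (v' ^ y)%g; split=> //.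
  - apply: UrootsM => //; rewrite (XG_J t (NGV Nm) m1 ab); exact: Upos_in.
  - exact: NGM.
  exact: pass_left.
have [h Nh eqh] := wstep t t0.
have ba : root b a by rewrite rootC.
have lt : wt (w1 b) < wt (w1 a).
  by have [] := wt_root_neq w1ab; move: ge; lia.
exists (u * XG b a t^-1%R ^ m^-1)%g, (m * h)%g, (XG a b t^-1%R * v' ^ y)%g; split.
- apply: UrootsM => //; rewrite (XG_J _ (NGV Nm) m1 ba); exact: Upos_in.
- exact: NGM.
- by apply: UrootsM => //; exact: Upos_in.
exact: exchange.
Qed.

Variable PS : {perm 'I_n} -> G.
Hypothesis PSM : forall s s', PS (s * s')%g = (PS s * PS s')%g.
Hypothesis NG_PS : forall s, NG (PS s).
Hypothesis pi_PS : forall s, pi (PS s) = perm_og F s.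

Lemma NG_one : NG 1%g.
Proof. by rewrite -(mulgV (PS 1)); exact/NGM/NGV. Qed.

Lemma PS1' : PS 1 = 1%g.
Proof. by apply: (mulgI (PS 1)); rewrite -PSM !mulg1. Qed.

Lemma PSV' s : PS s^-1 = (PS s)^-1%g.
Proof. by apply: (mulgI (PS s)); rewrite -PSM !mulgV PS1'. Qed.

Lemma absorbs1 : absorbs 1%g.
Proof. by move=> x; rewrite mulg1. Qed.

(** The adjacent transpositions are the Weyl elements of the simple roots e_i
    -> e_(i+1). *)
Lemma absorbs_PS s : absorbs (PS s).
Proof.
apply: (@perm_stab_ind n 0 (fun s => absorbs (PS s))) => //.
- by rewrite PS1'; exact: absorbs1.
- by move=> s1 s2 a1 a2; rewrite PSM; exact: absorbsM.
move=> i j _ ij; pose a : sidx n := (i, false); pose b : sidx n := (j, false).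
have ab : root a b by rewrite /root -val_eqE /= ij ltn_eqF.
have sab : simple a b.
  by split=> //; left; rewrite /wt /=; move: (ltn_ord j); lia.
have [y [w [Ny ym wa wb [wfix wstep]]]] := weyl_element ab.
suff <- : y = PS (tperm i j) by exact: absorbs_simple sab Ny ym wa wb wfix wstep.
apply: NG_inj => //; rewrite pi_PS; apply: mono_eqg (perm_og_mono F _).
apply: (mono_ext ym) => // d.
have wna : w (neg a) = neg b by rewrite (mono_neg ym) wa.
have wnb : w (neg b) = neg a by rewrite (mono_neg ym) wb.
rewrite /perm_ix; have [di|di] := eqVneq d.1 i.
  by case: d di => _ [] /= ->; rewrite tpermL.
have [dj|dj] := eqVneq d.1 j.
  by case: d dj di => _ [] /= -> _; rewrite tpermR.
by rewrite tpermD 1?eq_sym // -surjective_pairing wfix // /root eq_sym.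
Qed.

Local Notation i0 := (idx0 n_gt2).
Local Notation i1 := (idx1 n_gt2).

(** The simple root at the branch supplies a sign change of the last two pairs;
    all others are conjugate to it under the symmetric group. *)
Lemma absorbs_sign Z : NG Z -> pi Z = flip_og F [set i0; i1] -> absorbs Z.
Proof.
move=> NZ pZ; have lt1 : (n.-2 < n)%N by lia.
have lt2 : (n.-1 < n)%N by lia.
pose i := Ordinal lt1; pose j := Ordinal lt2.
have ij : i != j by rewrite -val_eqE /=; lia.
pose a : sidx n := (i, false); pose b : sidx n := (j, true).
have ab : root a b by [].
have sab : simple a b by split=> //; right; rewrite /wt /=; lia.
have [y [w [Ny ym wa wb [wfix wstep]]]] := weyl_element ab.
have ay := absorbs_simple sab Ny ym wa wb wfix wstep.
have [s [s0 s1]] : exists s, s i0 = i /\ s i1 = j by exact: perm2_ex.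
(* The Weyl element y exchanges e_i with f_j and e_j with f_i; multiplied by
   the transposition (i j) it becomes a sign change of i and j. *)
suff -> : Z = (PS s * (y * PS (tperm i j)) * PS s^-1)%g.
  by apply: absorbsM (absorbs_PS _); apply: absorbsM (absorbs_PS _) _; apply: absorbsM ay (absorbs_PS _).
have Nyt : NG (y * PS (tperm i j))%g by exact: NGM.
apply: NG_inj => //; first by apply: NGM => //; exact: NGM.
have -> : pi Z = (perm_og F s * flip_og F [set i; j] * perm_og F s^-1)%g.
  rewrite pZ -s0 -s1 -imset2 -flip_ogJ perm_ogV conjgE.
  by rewrite !mulgA mulgV mul1g mulgK.
rewrite !piM !pi_PS; congr (_ * _ * _)%g.
apply: mono_eqg (flip_og_mono F _) _.
apply: mono_ext (monoM ym (perm_og_mono F _)) _ _ => d; last by rewrite /= /unit_co mulr1.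
have wna : w (neg a) = neg b by rewrite (mono_neg ym) wa.
have wnb : w (neg b) = neg a by rewrite (mono_neg ym) wb.
rewrite /perm_ix /flip_ix /= !inE; have [di|di] := eqVneq d.1 i.
  case: d di => _ [] /= ->.
    by rewrite -[(i, true)]/(neg a) wna /neg /= tpermR.
  by rewrite -/a wa /= tpermR.
have [dj|dj] := eqVneq d.1 j.
  case: d dj di => _ [] /= -> _; first by rewrite -/b wb /= tpermL.
  by rewrite -[(j, false)]/(neg b) wnb /neg /= tpermL.
have -> : w d = d by apply: wfix; rewrite /root eq_sym.
by rewrite tpermD 1?eq_sym // addbF.
Qed.

(** A monomial unitriangular matrix cannot lower weights. As this also holds
    on the negative of a basis vector, whose weight is opposite, it fixes all
    weights, so it is the identity. *)
Lemma mono_unitri m : NG m -> unitri 0 (pi m) -> m = 1%g.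
Proof.
move=> Nm mu; have [w [k mm]] := NG_mono Nm.
have le a : wt a <= wt (w a).
  have [wa|wa] := eqVneq a (w a); first by rewrite -wa.
  have [_ mw] := mu a (w a); rewrite leNgt; apply/negP => lt.
  have := mw wa; rewrite mm !coE eqxx mulr1 leq0n andbT => e.
  by move/eqP: (mono_neq0 mm a); apply; apply: e; rewrite -leNgt ltW.
have wid a : w a = a.
  apply: wt_inj; apply: le_anti; rewrite le andbT.
  by have := le (neg a); rewrite (mono_neg mm) !wtN lerN2.
apply: NG_inj => //; first exact: NG_one.
rewrite pi1; apply: mono_eqg (@mono1 n F); apply: (mono_ext mm) => // a.
by have [+ _] := mu a a; rewrite mm wid !coE eqxx mulr1.
Qed.

Lemma UNU_kernel x : UNU x -> pi x = 1%g -> x = 1%g.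
Proof.
move=> [u [m [v [Uu Nm Uv ->]]]] px.
have Uuni y : Upos y -> unitri 0 (pi y) by apply: Uroots_unitri => a b [].
have m1 : m = 1%g.
  apply: mono_unitri => //; have -> : pi m = pi (u^-1 * v^-1)%g.
    rewrite piM !piV; apply: (mulgI (pi u)); apply: (mulIg (pi v)).
    by rewrite -!piM px mulKVg mulVg.
  by apply: Uuni; apply: UrootsM; exact: UrootsV.
move: px; rewrite m1 mulg1; apply: Uroots_inj.
exact: UrootsM Uu Uv.
Qed.

Variables (om : F) (gG : Om_letter -> G).
Hypothesis om_neq0 : om != 0.
Hypothesis G_ind : forall P : G -> Prop, P 1%g ->
    (forall l y, P y -> P (gG l * y)%g) -> (forall l y, P y -> P ((gG l)^-1 * y)%g) ->
  forall x, P x.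
Hypothesis g_sigma : gG Om_sigma = XG (i0, false) (i1, false) 1.
Hypothesis NG_delta : NG (gG Om_delta).
Hypothesis pi_delta : pi (gG Om_delta) = torus_og i0 om.
Hypothesis NG_Z : NG (gG Om_Z).
Hypothesis pi_Z : pi (gG Om_Z) = flip_og F [set i0; i1].
Hypothesis g_U : gG Om_U = PS (tperm i0 i1).
Hypothesis g_V : gG Om_V = PS (perm (@ordS_inj n)).

Lemma absorbs_gen l : absorbs (gG l) /\ absorbs (gG l)^-1%g.
Proof.
have pos01 : wt (i0, false) < wt (i1, false) by rewrite /wt /=; lia.
case: l.
- rewrite g_sigma XGV //.
  by split; apply: absorbs_U; exact: Upos_in.
- have dm := torus_og_mono i0 om_neq0; rewrite -pi_delta in dm.
  split; first exact: absorbs_torus NG_delta dm.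
  have [w [wK w'K dm']] := mono_inv dm.
  apply: (absorbs_torus (NGV NG_delta)); rewrite piV; exact: (mono_ext dm').
- split; first exact: absorbs_sign.
  apply: absorbs_sign; first exact: NGV.
  by rewrite piV pi_Z; apply: mulg1_eq; exact: flip_ogE.
- by rewrite g_U; split; [|rewrite -PSV']; exact: absorbs_PS.
by rewrite g_V; split; [|rewrite -PSV']; exact: absorbs_PS.
Qed.

Theorem bruhat_inj x : pi x = 1%g -> x = 1%g.
Proof.
apply: UNU_kernel; have : absorbs x.
  move: x; apply: G_ind => [|l y|l y]; first exact: absorbs1.
    by apply: absorbsM; case: (absorbs_gen l).
  by apply: absorbsM; case: (absorbs_gen l).
move/(_ 1%g); rewrite mul1g; apply; exists 1%g, 1%g, 1%g.
by split; rewrite ?mulg1 //; [exact: gen1 | exact: NG_one | exact: gen1].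
Qed.

End Bruhat.

(** * Recognition of the orthogonal group *)

Section Recognition.
Variables (n : nat) (F : finFieldType).
Hypothesis n_gt2 : 2 < n.
Hypothesis pchar2 : 2%N \in [pchar F]%R.
Variable omega : {unit F}.
Hypothesis omega_prim : <[omega]> = [set: {unit F}].
Variables (R_Sn : freeGroup Sn_letter -> Prop) (R_SL2 : freeGroup SL2_letter -> Prop).
Hypothesis R_Sn_ok : presents_on R_Sn (Sn_gen n_gt2).
Hypothesis R_SL2_ok : presents_on
  (fun r => R_SL2 r \/ r = fg_gen SL2_Delta ^+ (#|F| - 1)) (SL2_gen omega).
Variables (G : groupType) (gG : Om_letter -> G).
Hypothesis gG_rel : forall w, relators n #|F| R_Sn R_SL2 w -> fg_eval gG w = 1.
Hypothesis G_ind : forall P : G -> Prop, P 1 ->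
    (forall l y, P y -> P (gG l * y)) -> (forall l y, P y -> P ((gG l)^-1 * y)) ->
  forall x, P x.
Variable pi : G -> ogroup n F.
Hypothesis piM : forall x y, pi (x * y) = pi x * pi y.
Hypothesis pi_gen : forall l, pi (gG l) = og_gen n_gt2 omega l.
Implicit Types (i j : 'I_n) (x y : G) (t : F) (A : {set 'I_n}).

Local Notation i0 := (idx0 n_gt2).
Local Notation i1 := (idx1 n_gt2).
Local Notation i2 := (idx2 n_gt2).
Local Notation u_ := (tperm i0 i1).
Local Notation v_ := (perm (@ordS_inj n)).
Local Notation om := (FinRing.uval omega).
Local Notation NG := (NG n_gt2 gG).
Local Notation SLG := (SLG gG).
Local Notation PS := (PS n_gt2 gG).
Local Notation delta_at := (delta_at n_gt2 gG).
Local Notation Z_at := (Z_at n_gt2 gG).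
Local Notation ZV := (gG Om_Z ^ PS v_).

Let PS_u : PS u_ = gG Om_U.
Proof. exact: (PS_U R_Sn_ok gG_rel). Qed.
Let PS_v : PS v_ = gG Om_V.
Proof. exact: (PS_V R_Sn_ok gG_rel). Qed.
Let N_J x y : NG x -> NG y -> NG (x ^ y).
Proof. exact: (NGJ pchar2 R_Sn_ok gG_rel). Qed.
Let N_V x : NG x -> NG x^-1.
Proof. exact: (NGV pchar2 R_Sn_ok gG_rel). Qed.

Let N_M x y : NG x -> NG y -> NG (x * y).
Proof. exact: NGM. Qed.
Let N_P s : NG (PS s).
Proof. exact: NG_PS. Qed.
Let pi_P s : pi (PS s) = perm_og F s.
Proof. exact: (pi_PS R_Sn_ok gG_rel piM pi_gen). Qed.
Let pi_sg : pi (gG Om_sigma) = X (i0, false) (i1, false) 1%R.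
Proof. exact: pi_gen. Qed.

Lemma primitive_pow t : (t != 0 -> exists m, t = om ^+ m)%R.
Proof.
rewrite -unitfE => tu; have : FinRing.unit _ tu \in <[omega]> by rewrite omega_prim inE.
by case/cycleP => m /(congr1 val) /=; rewrite FinRing.val_unitX => ->; exists m.
Qed.

Lemma NG_delta_at i : NG (delta_at i).
Proof. by apply: N_J; [exact: NG_delta | exact: NG_PS]. Qed.

Lemma NG_torus i t : (t != 0)%R -> exists2 x, NG x & pi x = torus_og i t.
Proof.
move=> /primitive_pow[m ->]; exists (delta_at i ^+ m); first exact/NGX/NG_delta_at.
by rewrite (piX piM) (pi_delta_at R_Sn_ok gG_rel piM pi_gen) torus_ogX // om_neq0.
Qed.

Lemma NG_Z_at i : NG (Z_at i).
Proof.
rewrite /Z_at; case: eqP => _; first exact: NG1.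
by apply: N_J; [exact: (NG_Z n_gt2 gG) | exact: NG_PS].
Qed.

Lemma NG_sign A : odd #|A| = false -> exists2 x, NG x & pi x = flip_og F A.
Proof.
move=> eA; exists (powprod Z_at (fun i => i \in A)).
  rewrite /powprod; apply: big_ind => [|x y|i _]; [exact: NG1 | exact: NGM |].
  exact/NGX/NG_Z_at.
rewrite (pi_powprod_Z R_Sn_ok gG_rel piM pi_gen); last by rewrite -sum1_card big_mkcond in eA.
by congr flip_og; apply/setP => i; rewrite inE; case: (i \in A).
Qed.

Lemma SLG_torus t : (t != 0)%R ->
  exists x, [/\ NG x, SLG x & pi x = torus_og i0 t^-1%R * torus_og i1 t].
Proof.
move=> t0; have om0 := om_neq0 omega; have omV0 := invr_neq0 om0.
have [m tm] := primitive_pow (invr_neq0 t0).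
exists (gSL gG SL2_Delta ^+ m); split.
- rewrite /= (Delta_delta_at R_Sn_ok gG_rel).
  by apply/NGX/NGM; [apply: N_V|]; exact: NG_delta_at.
- exact/SLGX/SLG_gen.
rewrite (piX piM) /= (Delta_delta_at R_Sn_ok gG_rel) piM (piV piM).
rewrite !(pi_delta_at R_Sn_ok gG_rel piM pi_gen) torus_ogV //.
rewrite expgMn; last exact: torus_ogC.
rewrite !torus_ogX // exprVn -tm invrK; apply: torus_ogC => //.
exact: invr_neq0.
Qed.

Local Notation XG := (XG pi NG (gG Om_sigma)).

Let pXG a b t : root a b -> pi (XG a b t) = X a b t.
Proof. exact: (pi_XG pchar2 piM N_M N_V N_P pi_P NG_sign NG_torus pi_sg). Qed.

Lemma pi_inj1 x : pi x = 1 -> x = 1.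
Proof.
have PM := PSM R_Sn_ok gG_rel; have PJ := PSJ R_Sn_ok gG_rel.
have PX := PSX R_Sn_ok gG_rel.
have NZV : NG ZV by apply: N_J; [exact: NG_Z | exact: N_P].
have pZV : pi ZV = flip_og F [set i1; i2].
  by rewrite (piJ piM) pi_gen pi_P ZJP cycle0 cycle1.
have sg_cent := sigma_cent pchar2 omega_prim R_Sn_ok gG_rel piM pi_gen.
have SL_inj := SLG_inj pchar2 R_Sn_ok gG_rel piM pi_gen R_SL2_ok.
have SL_M := @SLGM _ gG; have SL_V := @SLGV _ gG.
have SL_sg : SLG (gG Om_sigma) by exact: (SLG_gen gG SL2_sigma).
have SL_u : SLG (PS u_) by rewrite PS_u; exact: (SLG_gen gG SL2_U).
have ra : [~ gG Om_sigma, gG Om_sigma ^ PS v_] = gG Om_sigma ^ PS (v_ * u_).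
  have := gG_rel (rel_sigma_sigmaV n #|F| R_Sn R_SL2); rewrite !fg_evalE.
  by rewrite PM PS_u PS_v => /divg1_eq.
have rb : [~ gG Om_sigma, gG Om_sigma ^ PS (v_ * u_)] = 1.
  have := gG_rel (rel_sigma_sigmaVU n #|F| R_Sn R_SL2); rewrite !fg_evalE.
  by rewrite PM PS_u PS_v.
have rc : [~ gG Om_sigma, gG Om_sigma ^ PS (u_ ^ (v_ * u_))] = 1.
  have := gG_rel (rel_sigma_sigmaW n #|F| R_Sn R_SL2); rewrite !fg_evalE.
  by rewrite PJ PM PS_u PS_v.
have rd : 3 < n -> [~ gG Om_sigma, gG Om_sigma ^ PS (v_ ^+ 2)] = 1.
  move=> n3; have := gG_rel (rel_sigma_sigmaVV #|F| R_Sn R_SL2 n3); rewrite !fg_evalE.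
  by rewrite PX PS_v.
have re : [~ gG Om_sigma, gG Om_sigma ^ ZV] = 1.
  have := gG_rel (rel_sigma_sigmaZV n #|F| R_Sn R_SL2); rewrite !fg_evalE.
  by rewrite PS_v.
have rf : n = 4 -> [~ gG Om_sigma, gG Om_sigma ^ (ZV * PS (v_ ^+ 2))] = 1.
  move=> n4; have := gG_rel (rel_sigma_sigmaZVVV #|F| R_Sn R_SL2 n4); rewrite !fg_evalE.
  by rewrite PX PS_v.
have XJ := XG_J pchar2 piM N_M N_V N_P pi_P NG_sign NG_torus pi_sg sg_cent.
have XD := XGD pchar2 piM N_M N_V N_P pi_P NG_sign NG_torus pi_sg sg_cent
  SL_M SL_V SL_inj SL_sg SLG_torus.
have XV := XGV pchar2 piM N_M N_V N_P pi_P NG_sign NG_torus pi_sg sg_cent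
  SL_M SL_V SL_inj SL_sg SLG_torus.
have XN := XG_N pchar2 piM N_M N_V N_P pi_P NG_sign NG_torus pi_sg sg_cent.
have sE := sgE pchar2 piM N_M N_V N_P pi_P NG_sign NG_torus pi_sg sg_cent.
have N_mono := NG_mono pchar2 R_Sn_ok gG_rel piM pi_gen.
have N_inj := NG_inj pchar2 omega_prim R_Sn_ok gG_rel piM pi_gen.
have st := steinberg pchar2 piM N_M N_V N_P pi_P NG_sign NG_torus pi_sg sg_cent
  SL_M SL_V SL_inj SL_sg SLG_torus NZV pZV ra rb rc rd re rf.
have we := weyl_element pchar2 piM N_M N_V N_P pi_P NG_sign NG_torus pi_sg sg_cent
  SL_M SL_V SL_inj SL_sg SL_u SLG_torus.
apply: (bruhat_inj pchar2 piM N_M N_V N_mono N_inj (XG0 pi NG (gG Om_sigma))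
  pXG XJ XD XV XN st we PM N_P pi_P (om_neq0 omega) G_ind sE) => //.
- exact: NG_delta.
exact: NG_Z.
Qed.

Lemma pi_even x : even_og (pi x).
Proof.
have even_gen l : even_og (pi (gG l)).
  rewrite pi_gen; case: l => /=.
  - exact: even_X.
  - exact/even_torus/om_neq0.
  - exact: even_flip2.
  - exact: even_perm_og.
  exact: even_perm_og.
move: x; apply: G_ind => [|l y|l y].
- by rewrite (pi1 piM); exact: even1.
- by rewrite piM; exact: evenM.
by rewrite piM (piV piM); apply: evenM; exact: evenV.
Qed.

Lemma pi_onto g : dickson (omx g) = false -> exists x, pi x = g.
Proof.
apply: (@dickson_kernel_sub _ _ pchar2 n_gt2 (fun g => exists x, pi x = g)).
- by exists 1; rewrite (pi1 piM).
- by move=> _ _ [x <-] [y <-]; exists (x * y); rewrite piM.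
- by move=> _ [x <-]; exists x^-1; rewrite (piV piM).
- move=> a b t ab; exists (XG a b t); exact: pXG.
- by move=> s; exists (PS s).
- by move=> i j ij; have [|x _ px] := NG_sign (A := [set i; j]); [rewrite cards2 ij | exists x].
- by move=> i t /(NG_torus i)[x _ px]; exists x.
by move=> _ [x <-]; exact: pi_even.
Qed.

End Recognition.

Theorem theorem9p9 (e n : nat) (e_gt1 : 1 < e) (n_gt2 : 2 < n)
    (F : finFieldType) (cardF : #|F| = (2 ^ e)%N)
    (omega : {unit F}) (omega_prim : <[omega]> = [set: {unit F}])
    (R_Sn : freeGroup Sn_letter -> Prop)
    (R_Sn_ok : presents_on R_Sn (Sn_gen n_gt2))
    (R_SL2 : freeGroup SL2_letter -> Prop)
    (R_SL2_ok : presents_on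
       (fun r => R_SL2 r \/ r = fg_gen SL2_Delta ^+ (#|F| - 1)) (SL2_gen omega)) :
  isog_mxgroup (presentedGroup (relators n #|F| R_Sn R_SL2)) (Omegaplus n F).
Proof.
have pchar2 : 2%N \in [pchar F]%R := card_finPcharP cardF isT.
have Sn_ok r : R_Sn r -> fg_eval (Sn_gen n_gt2) r = 1.
  by move=> Rr; apply/R_Sn_ok => N _; exact.
have SL2_ok r : R_SL2 r -> fg_eval (SL2_gen omega) r = 1.
  by move=> Rr; apply/R_SL2_ok => N _; apply; left.
have hrel := relators_og pchar2 Sn_ok SL2_ok.
pose pi := pres_lift (R := relators n #|F| R_Sn R_SL2) (og_gen n_gt2 omega).
have piM := pres_liftM hrel; have pi_gen := pres_lift_gen hrel.
have gG_rel := @pres_rel _ (relators n #|F| R_Sn R_SL2).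
have G_ind := @pres_ind _ (relators n #|F| R_Sn R_SL2).
have inj1 := pi_inj1 pchar2 omega_prim R_Sn_ok R_SL2_ok gG_rel G_ind piM pi_gen.
have even := pi_even pchar2 G_ind piM pi_gen.
have onto := pi_onto pchar2 omega_prim R_Sn_ok gG_rel G_ind piM pi_gen.
exists (fun x => omx (pi x)); split.
- by move=> x y; rewrite /pi piM.
- move=> x y /val_inj pxy; apply: divg1_eq; apply: inj1.
  by rewrite piM (piV piM) -/pi pxy mulgV.
move=> A; split.
  rewrite inE => /andP[AO /negPf dA].
  by have [x px] := onto (OGroup AO) dA; exists x; rewrite /pi px.
case=> x <-; rewrite inE (valP (pi x)) /=.
by rewrite (even_dickson (even x)).
Qed.
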